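(* Let $\underline{\lambda}^{(1)}, \underline{\lambda}^{(2)}, \ldots$ be a sequence of block diagonal skew partitions, and for each $N$ let $X_N$ be the random variable $\mathrm{maj}(T)$, where $T$ is chosen uniformly at random from the set $\mathrm{SYT}(\underline{\lambda}^{(N)})$ of standard Young tableaux of shape $\underline{\lambda}^{(N)}$. Then the sequence $X_1, X_2, \ldots$ is asymptotically normal if and only if $\mathrm{aft}(\underline{\lambda}^{(N)}) \to \infty$ as $N\to\infty$.
   Context: Diagrams are drawn in English notation (row 1 at the top). A block diagonal skew partition $\underline{\lambda}=(\lambda^{1},\ldots,\lambda^{m})$ is a finite sequence of partitions, identified with the skew shape obtained by translating the Young diagrams of $\lambda^1,\dots,\lambda^m$ so that the rows and columns occupied by different components are disjoint, they form a valid skew shape, and they appear in order from top to bottom (so $\lambda^1$ is topmost and rightmost). Its size is $|\underline{\lambda}|=\sum_i|\lambda^i|$, and $\mathrm{aft}(\underline{\lambda}) := |\underline{\lambda}| - \max_i\{\lambda^{i}_1, (\lambda^{i})'_1\}$, the maximum being over all row lengths $\lambda^i_1$ and column lengths $(\lambda^i)'_1$ (where $'$ denotes the conjugate partition). A standard Young tableau of a skew shape with $n$ cells is a bijective filling of its cells with $1,\ldots,n$ increasing to the right along rows and downward along columns. An integer $i\in\{1,\dots,n-1\}$ is a descent of $T$ if $i+1$ lies in a strictly lower row of $T$ than $i$; $\mathrm{maj}(T)$ is the sum of the descents of $T$. For a real random variable $X$ with mean $\mu$ and variance $\sigma^2>0$, the normalized variable is $X^* := (X-\mu)/\sigma$;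 if $\sigma=0$, by convention $X^*:=0$. A sequence $X_1,X_2,\ldots$ is asymptotically normal if $X_N^*$ converges in distribution to the standard normal random variable. *)

(* Defs.v *)
From HB Require Import structures.
From mathcomp Require Import all_boot all_order all_algebra.
From mathcomp Require Import boolp classical_sets functions cardinality reals.
From mathcomp Require Import ereal topology normedtype sequences measure.
From mathcomp Require Import lebesgue_measure lebesgue_integral probability.
From mathcomp Require Import interval_inference measurable_realfun.

Set Implicit Arguments.
Unset Strict Implicit.
Unset Printing Implicit Defensive.

Import Order.TTheory GRing.Theory Num.Theory.
Import numFieldNormedType.Exports.

(** * Partitions and block diagonal skew partitions *)

Record intpart := IntPart {
  parts :> seq nat;
  _ : sorted geq parts && (0 \notin parts) }.

HB.instance Definition _ := [isSub for parts].

Definition conjugate (mu : seq nat) : seq nat :=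
  [seq count (fun p => j < p) mu | j <- iota 0 (head 0 mu)].

Definition blockpart := seq intpart.

Definition bsize (l : blockpart) : nat := \sum_(mu <- l) sumn mu.

(* [head 0 mu] is mu_1, with the convention mu_1 = 0 for the empty partition. *)
Definition aft (l : blockpart) : nat :=
  bsize l - \max_(mu <- l) maxn (head 0 mu) (head 0 (conjugate mu)).

(** * The skew diagram *)

(* Cells are pairs (row, column), counted from 0, with row 0 at the top. *)
Definition diagram (mu : seq nat) : seq (nat * nat) :=
  [seq (r, c) | r <- iota 0 (size mu), c <- iota 0 (nth 0 mu r)].

Definition shift (dr dc : nat) (x : nat * nat) : nat * nat :=
  (x.1 + dr, x.2 + dc).

Definition bwidth (l : blockpart) : nat := \sum_(mu <- l) head 0 mu.

(* The first component lies above and to the right of all the others. *)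
Fixpoint cells (l : blockpart) : seq (nat * nat) :=
  if l is mu :: l' then
    map (shift 0 (bwidth l')) (diagram mu) ++ map (shift (size mu) 0) (cells l')
  else [::].

Definition cell (l : blockpart) : finType := seq_sub (cells l).

Definition row_of l (x : cell l) : nat := (val x).1.
Definition col_of l (x : cell l) : nat := (val x).2.

(** * Standard Young tableaux and the major index *)

Definition filling (l : blockpart) := {ffun cell l -> 'I_(bsize l)}.

(* The entries of a filling run over 1, ..., n, whereas 'I_n is {0, ..., n-1}. *)
Definition entry l (T : filling l) (x : cell l) : nat := (T x).+1.

Definition standard l (T : filling l) : bool :=
  [&& injectiveb T, [forall k, exists x, T x == k],
      [forall x, forall y, (row_of x == row_of y) && (col_of x < col_of y)
         ==> (entry T x < entry T y)]
    & [forall x, forall y, (col_of x == col_of y) && (row_of x < row_of y)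
         ==> (entry T x < entry T y)]].

Definition SYT (l : blockpart) := {T : filling l | standard T}.

HB.instance Definition _ l := Finite.on (SYT l).

Definition descent l (T : SYT l) (i : nat) : bool :=
  [exists x, exists y,
    [&& entry (val T) x == i, entry (val T) y == i.+1 & row_of x < row_of y]].

Definition maj l (T : SYT l) : nat := \sum_(1 <= i < bsize l | descent T i) i.

(** * Existence of standard tableaux *)

Lemma size_diagram mu : size (diagram mu) = sumn mu.
Proof.
rewrite size_allpairs_dep; congr sumn.
apply: (@eq_from_nth _ 0); first by rewrite size_map size_iota.
move=> i; rewrite size_map size_iota => ilt.
by rewrite (nth_map 0) ?size_iota// nth_iota// size_iota.
Qed.

Lemma size_cells l : size (cells l) = bsize l.
Proof.
elim: l => [|mu l IH]; first by rewrite /bsize big_nil.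
by rewrite /bsize big_cons /= size_cat !size_map size_diagram IH.
Qed.

Lemma shift_inj a b : injective (shift a b).
Proof.
by move=> [x1 x2] [y1 y2] [] /eqP + /eqP; rewrite !eqn_add2r => /eqP-> /eqP->.
Qed.

Lemma uniq_cells l : uniq (cells l).
Proof.
elim: l => [//|mu l IH] /=.
rewrite cat_uniq !(map_inj_uniq (@shift_inj _ _)) IH andbT.
apply/andP; split.
  apply: allpairs_uniq_dep; rewrite ?iota_uniq//.
    by move=> i _; apply: iota_uniq.
  by move=> [x1 x2] [y1 y2] _ _ /= [-> ->].
apply/hasPn => _ /mapP[z _ ->]; apply/negP => /mapP[w].
case/allpairsPdep => r [c [+ _ ->]].
rewrite mem_iota add0n /= => rlt [E _].
by move: rlt; rewrite -[r]addn0 -E ltnNge leq_addl.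
Qed.

Definition lexle (x y : nat * nat) : bool :=
  (x.1 < y.1) || ((x.1 == y.1) && (x.2 <= y.2)).

Lemma lexle_total : total lexle.
Proof.
by move=> [a b] [c d]; rewrite /lexle /=; case: (ltngtP a c) => //= _; apply: leq_total.
Qed.

Lemma lexle_trans : transitive lexle.
Proof.
move=> [a b] [c d] [e f]; rewrite /lexle /=.
case/orP => [ca|/andP[/eqP<- db]]; case/orP => [ae|/andP[/eqP<- bf]].
- by rewrite (ltn_trans ca ae).
- by rewrite ca.
- by rewrite ae.
- by rewrite eqxx (leq_trans db bf) orbT.
Qed.

Lemma lexle_refl : reflexive lexle.
Proof. by move=> [a b]; rewrite /lexle eqxx leqnn orbT. Qed.

Lemma SYT_inhabited l : exists T : filling l, standard T.
Proof.
pose s := sort lexle (cells l).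
have ss : size s = bsize l by rewrite size_sort size_cells.
have ms (x : cell l) : val x \in s by rewrite mem_sort; apply: valP.
have lt (x : cell l) : index (val x) s < bsize l by rewrite -ss index_mem.
pose T : filling l := [ffun x => Ordinal (lt x)].
have Tinj : injective T.
  move=> x y /(congr1 val); rewrite !ffunE /= => E.
  by apply: val_inj; exact: (index_inj (0, 0) (ms x) (ms y) E).
have Tlt (x y : cell l) : ~~ lexle (val y) (val x) -> entry T x < entry T y.
  apply: contraR; rewrite /entry ltnS !ffunE /= -leqNgt => h.
  have srt : sorted lexle s by apply: sort_sorted lexle_total _.
  exact: (sorted_leq_index lexle_trans lexle_refl srt _ _ (ms y) (ms x) h).
exists T; apply/and4P; split.
- exact/injectiveP.
- apply/forallP => k; apply/existsP.
  have ks : nth (0, 0) s k \in cells l.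
    by rewrite -(mem_sort lexle) mem_nth // ss.
  exists (SeqSub ks); apply/eqP/val_inj; rewrite ffunE /= index_uniq ?ss//.
  by rewrite sort_uniq uniq_cells.
- apply/'forall_forallP => x y; apply/implyP => /andP[/eqP e h].
  apply: Tlt; move: e h; rewrite /lexle /row_of /col_of => -> h.
  by rewrite ltnn eqxx /= -ltnNge.
- apply/'forall_forallP => x y; apply/implyP => /andP[_ h].
  apply: Tlt; move: h; rewrite /lexle /row_of => h.
  by rewrite negb_or negb_and -leqNgt ltnW//= neq_ltn h orbT.
Qed.

Definition SYT_point l : SYT l :=
  let: exist T st := cid (SYT_inhabited l) in exist _ T st.

(** * The uniform probability on standard tableaux of a given shape *)

Local Open Scope classical_set_scope.
Local Open Scope ring_scope.

HB.instance Definition _ l := isPointed.Build (SYT l) (SYT_point l).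

HB.instance Definition _ l := @isMeasurable.Build default_measure_display
  (SYT l) discrete_measurable discrete_measurable0
  discrete_measurableC discrete_measurableU.

Definition uniform_SYT (R : realType) (l : blockpart) (A : set (SYT l)) : \bar R :=
  (#|A|%:R / #|{: SYT l}|%:R)%:E.

Section uniform_SYT_probability.
Variables (R : realType) (l : blockpart).
Local Notation n := #|{: SYT l}|.
Local Notation U := (@uniform_SYT R l).

Let n_gt0 : (0 < n)%N.
Proof. by apply/card_gt0P; exists point. Qed.

Let U_msum : U = mscale (n%:R^-1 : R)%:nng
  (msum (fun i => @dirac _ (SYT l) (nth (SYT_point l) (enum {: SYT l}) i) R) n).
Proof.
apply/funext => A; rewrite /uniform_SYT /mscale /msum /= mulrC EFinM.
congr (_ * _)%E.
rewrite /msum; under eq_bigr => i _ do rewrite /= diracE.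
rewrite sumEFin -natr_sum; congr (_%:R%:E).
have -> : #|A| = (\sum_(x <- enum {: SYT l}) (x \in A))%N.
  by rewrite big_enum -sum1_card big_mkcond.
by rewrite (big_nth (SYT_point l)) big_mkord -cardE.
Qed.

Let U0 : U set0 = 0%E.
Proof. by rewrite U_msum measure0. Qed.

Let U_ge0 A : (0 <= U A)%E.
Proof. by rewrite U_msum measure_ge0. Qed.

Let U_sigma_additive : semi_sigma_additive U.
Proof. by rewrite U_msum; exact: measure_semi_sigma_additive. Qed.

HB.instance Definition _ := isMeasure.Build _ _ _ U U0 U_ge0 U_sigma_additive.

Let U_setT : U [set: SYT l] = 1%E.
Proof.
rewrite /uniform_SYT (@eq_card _ _ (mem {: SYT l})); last by move=> x; rewrite [LHS]in_setT.
by rewrite divff// pnatr_eq0 -lt0n.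
Qed.

HB.instance Definition _ := Measure_isProbability.Build _ _ _ U U_setT.

End uniform_SYT_probability.

Definition majR (R : realType) (l : blockpart) (T : SYT l) : R := (maj T)%:R.

HB.instance Definition _ (R : realType) (l : blockpart) :=
  @isMeasurableFun.Build _ _ (SYT l) R (@majR R l) (fun _ _ _ => I).

Definition maj_RV (R : realType) (l : blockpart) : {RV (@uniform_SYT R l) >-> R} :=
  @majR R l.

(** * Asymptotic normality *)

Section normalized.
Context d (T : measurableType d) (R : realType) (P : probability T R).
Variable X : {RV P >-> R}.

(* Meant for X of finite variance. *)
Definition normalized (t : T) : R :=
  if 'V_P[X] == 0%E then 0
  else (X t - fine 'E_P[X]) / Num.sqrt (fine 'V_P[X]).

Let measurable_normalized : measurable_fun [set: T] normalized.
Proof.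
rewrite /normalized; case: ('V_P[X] == 0%E); first exact: measurable_cst.
by apply: measurable_funM => //; apply: measurable_funB.
Qed.

HB.instance Definition _ :=
  isMeasurableFun.Build _ _ _ _ normalized measurable_normalized.

Definition normalized_RV : {RV P >-> R} := normalized.

End normalized.

Definition cvg_in_distribution (R : realType) (d : nat -> measure_display)
    (T : forall N, measurableType (d N)) (P : forall N, probability (T N) R)
    (X : forall N, {RV (P N) >-> R}) (mu : probability (measurableTypeR R) R) : Prop :=
  forall x : R, {for x, continuous (fun y : R => mu `]-oo, y]%classic)} ->
    cdf (X N) x @[N --> \oo] --> mu `]-oo, x]%classic.

(* The random variables may live on different probability spaces. *)
Definition asymptotically_normal (R : realType) (d : nat -> measure_display)
    (T : forall N, measurableType (d N)) (P : forall N, probability (T N) R)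
    (X : forall N, {RV (P N) >-> R}) : Prop :=
  cvg_in_distribution (fun N => normalized_RV (X N)) (normal_prob 0 1).

(* Main.v *)
(* Reading off the row of each entry turns tableaux into words of rows, and a
   recursion on the last ascending run shows that the generating polynomial of
   maj, divided by (1-q)...(1-q^n), is a sum over the shapes obtained by removing a
   horizontal strip.  A determinant in the beta numbers satisfies the same recursion,
   whence Stanley's formula: the polynomial equals q^b [1]...[n] / (product of the [h],
   h a hook length).  So maj plus independent uniform variables on {0, ..., h-1} has the
   law of b plus independent uniform variables on {0, ..., k-1}, k = 1, ..., n; the
   variance of maj is (sum of k^2 - sum of h^2)/12, and its characteristic function is
   a quotient of products of sin(x)/x.

   At most n+1-j hooks are at least j, so replacing the hooks by 1, ..., n can only
   increase a sum of values of a nondecreasing function.  Applied to the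
   logarithm of sin(x)/x this shows that the characteristic function of the
   normalized variable at t is exp(-t^2/2 + O(t^4 n^2/variance)).  The sum of the
   squared hooks of a partition of n is n^2 plus that of the squared contents, which
   gives variance >= n^2 aft / 288 for n >= 12, hence the convergence when aft
   tends to infinity.  Conversely, maj is at most its mean plus aft * n / 2, so
   the normalized variable stays below a constant while aft is bounded, which the
   normal law does not. *)

Require Import Defs.
From mathcomp Require Import all_boot all_order all_algebra.
From mathcomp Require Import boolp classical_sets functions reals.
From mathcomp Require Import ereal topology normedtype sequences derive realfun.
From mathcomp Require Import exp trigo measure lebesgue_measure numfun.
From mathcomp Require Import lebesgue_integral ftc probability.
From mathcomp Require Import measurable_realfun.
From mathcomp Require Import zify ring lra.

Set Implicit Arguments.
Unset Strict Implicit.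
Unset Printing Implicit Defensive.

Import Order.TTheory GRing.Theory Num.Theory.
Import numFieldNormedType.Exports.

(** * Words and the major index *)

(** The recursion treats a word together with one further letter r appended to it: a horizontal
    strip is then removed row by row, and sums over the last letter telescope. Beta numbers are used
    throughout because a determinant kills the illegal removals (two rows become equal) and because
    hook lengths are differences of such numbers. The transform of maj is kept real by taking
    cosines with an arbitrary phase s: the phases of all the factors [k] and [h] add up to the mean,
    so centring removes them. The passage from cosines to distribution functions is explicit: a
    trigonometric polynomial built from powers of a sine is close to the indicator of a half line on
    a window of half-width L, and the bound on second moments pays for everything outside the
    window. The constant 288 is 12 times 24: the variance is the gap between sums of squares over
    12, and 24 times that gap is at least n^2 aft. *)

Definition dec (v : nat -> nat) (r : nat) : nat -> nat := fun i => v i - (i == r).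

Definition weight (m : nat) (v : nat -> nat) : nat := \sum_(i < m) v i.

(** The last letter is chosen first, and [ok] is tested on the content of every nonempty prefix.
    With the test that each component is a partition, these are the row words of standard
    tableaux. *)
Fixpoint words (ok : (nat -> nat) -> bool) (m n : nat) (v : nat -> nat) : seq (seq nat) :=
  if n is n'.+1 then
    if ok v then
      flatten [seq [seq rcons w r | w <- words ok m n' (dec v r)]
              | r <- iota 0 m & 0 < v r]
    else [::]
  else [:: [::]].

(** The row of entry i stands at position i - 1, and lower rows have larger indices, so the descents
    of a tableau become the strict ascents summed here. *)
Definition majw (w : seq nat) : nat :=
  \sum_(1 <= i < size w | nth 0 w i.-1 < nth 0 w i) i.

Lemma majw_rcons2 w r r' :
  majw (rcons (rcons w r) r') = majw (rcons w r) + (r < r') * (size w).+1.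
Proof.
rewrite /majw !size_rcons [LHS]big_mkcond big_nat_recr //= -big_mkcond /=.
congr (_ + _); last first.
  by rewrite !nth_rcons !size_rcons !ltnn ltnSn !eqxx; case: (r < r'); rewrite ?mul1n ?mul0n.
rewrite big_nat_cond [RHS]big_nat_cond; apply: eq_bigl => i.
case: (boolP (0 < i < (size w).+1)) => //= /andP[i1 i2].
rewrite !(nth_rcons 0 (rcons w r)) !size_rcons i2.
by have -> : i.-1 < (size w).+1 by lia.
Qed.

Lemma majw_rcons0 w : majw (rcons w 0) = majw w.
Proof.
case/lastP: w => [|w r]; last by rewrite majw_rcons2 ltn0 addn0.
by rewrite /majw /= !big_geq.
Qed.

Lemma majw_seq1 r : majw [:: r] = 0.
Proof. by rewrite /majw big_geq. Qed.

Lemma size_words ok m n v w : w \in words ok m n v -> size w = n.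
Proof.
elim: n v w => [v w|n IH v w] /=; first by rewrite inE => /eqP->.
case: ifP => // _ /flatten_mapP[r _ /mapP[w' /IH w's ->]].
by rewrite size_rcons w's.
Qed.

Lemma weight_dec m v r : r < m -> 0 < v r -> (weight m (dec v r)).+1 = weight m v.
Proof.
move=> rm vr; rewrite /weight (bigD1 (Ordinal rm)) //= [RHS](bigD1 (Ordinal rm)) //=.
rewrite {1}/dec eqxx subn1 -addSn prednK //; congr (_ + _).
apply: eq_bigr => i; rewrite /dec -val_eqE /= => /negbTE ->; exact: subn0.
Qed.

Section WordRecursion.
Local Open Scope ring_scope.
Variables (F : fieldType) (q : F).

Definition qfact (n : nat) : F := \prod_(i < n) (1 - q ^+ i.+1).

Lemma qfactS n : qfact n.+1 = qfact n * (1 - q ^+ n.+1).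
Proof. by rewrite /qfact big_ord_recr. Qed.

Variables (ok : (nat -> nat) -> bool) (m : nat) (K : (nat -> nat) -> nat -> F).
(* [K u r] stands for the sum of [q ^ |v| * T v / qfact |v|] over the shapes [v] got from
   [u] by removing a horizontal strip from the rows of index at least [r], where [T v]
   is the sum of [q ^ maj] over the words of content [v]. *)
Hypothesis Kstep : forall u r, ok u -> (r < m)%N ->
  K u r - K u r.+1 = if (0 < u r)%N && ok (dec u r) then K (dec u r) r else 0.
Hypothesis Klast : forall u, ok u -> K u m = q ^+ weight m u * K u 0.
Hypothesis K0 : forall u r, (r <= m)%N -> weight m u = 0%N -> K u r = 1.
Hypothesis ok0 : forall u, weight m u = 0%N -> ok u.

(** The appended letter [r] makes the induction close: a last letter r' of the word creates a new
    ascent exactly when r' < r, so the sum over r' splits at [r] into two telescoping sums. *)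
Lemma words_last n u r : weight m u = n -> (r < m)%N ->
  \sum_(w <- words ok m n u) q ^+ majw (rcons w r) = if ok u then qfact n * K u r else 0.
Proof.
elim: n u r => [|n IH] u r wu rm.
  by rewrite /= big_seq1 majw_seq1 ok0 // K0 // 1?ltnW // expr0 /qfact big_ord0 mulr1.
rewrite /=; case: ifP => uok; last by rewrite big_nil.
rewrite big_flatten /= big_map big_filter.
under eq_bigr => r' ur'.
  rewrite big_map.
  under eq_big_seq => w ww do
    rewrite majw_rcons2 (size_words ww) exprD mulrC mulnC exprM.
  rewrite -big_distrr /=.
  over.
rewrite (_ : iota 0 m = index_iota 0 m); last by rewrite /index_iota subn0.
rewrite (eq_bigr (fun r' => q ^+ n.+1 ^+ (r' < r)%N *
   \sum_(w <- words ok m n (dec u r')) q ^+ majw (rcons w r'))) //.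
rewrite big_mkcond big_nat /=.
rewrite (eq_bigr (fun r' => q ^+ n.+1 ^+ (r' < r)%N * (qfact n * (K u r' - K u r'.+1)))); last first.
  move=> r' /= r'm; case: ifP => ur'; last by rewrite Kstep // ur' /= !mulr0.
  rewrite IH //; last by apply/eqP; rewrite -eqSS (weight_dec r'm ur') wu.
  by rewrite Kstep // ur' /=; case: ifP => // _; rewrite !mulr0.
have tel a b : (a <= b)%N -> \sum_(a <= i < b) (K u i - K u i.+1) = K u a - K u b.
  elim: b => [|b IHb]; first by rewrite leqn0 => /eqP->; rewrite big_geq // subrr.
  rewrite leq_eqVlt => /orP[/eqP->|ab]; first by rewrite big_geq // subrr.
  by rewrite big_nat_recr //= IHb // addrA subrK.
rewrite -big_nat (big_cat_nat (n := r)) //=; last exact: ltnW.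
rewrite (eq_big_nat _ _ (F2 := fun i => q ^+ n.+1 * qfact n * (K u i - K u i.+1))); last first.
  by move=> i /andP[_ ->]; rewrite expr1 mulrA.
rewrite [X in _ + X](eq_big_nat _ _ (F2 := fun i => qfact n * (K u i - K u i.+1))); last first.
  by move=> i /andP[ri _]; rewrite ltnNge ri expr0 mul1r.
rewrite -!big_distrr /= !tel //; last exact: ltnW.
(* The two pieces are q^(n+1) (K u 0 - K u r) and K u r - K u m. As K u m = q^(n+1) K u 0, they add
   up to (1 - q^(n+1)) K u r. *)
rewrite Klast // wu qfactS; ring.
Qed.

Lemma words_sum n u : (0 < m)%N -> ok u -> weight m u = n ->
  \sum_(w <- words ok m n u) q ^+ majw w = qfact n * K u 0.
Proof.
move=> m0 uok wu; have := words_last wu m0; rewrite uok => <-.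
by apply: eq_bigr => w _; rewrite majw_rcons0.
Qed.

End WordRecursion.

(** * Sums over horizontal strips as determinants *)

Definition beta (m : nat) (v : nat -> nat) (i : nat) : nat := v i + (m.-1 - i).

Definition ok1 (m : nat) (v : nat -> nat) : bool :=
  all (fun i => v i.+1 <= v i) (iota 0 m.-1).

Lemma ok1P m v : reflect (forall i, i.+1 < m -> v i.+1 <= v i) (ok1 m v).
Proof.
apply: (iffP allP) => h i; first by move=> im; apply: h; rewrite mem_iota; lia.
by rewrite mem_iota => /andP[_ im]; apply: h; lia.
Qed.

Lemma sum_beta m v : (\sum_(i < m) beta m v i = weight m v + \sum_(i < m) i).
Proof.
rewrite /beta big_split /= -/(weight m v); congr (_ + _).
rewrite (reindex_inj rev_ord_inj) /=; apply: eq_bigr => i _.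
by have := ltn_ord i; lia.
Qed.

Lemma weight0 m v : weight m v = 0 -> forall i, (i < m) -> v i = 0.
Proof.
move=> /eqP; rewrite sum_nat_eq0 => /forallP h i im.
by have := h (Ordinal im) => /= /eqP.
Qed.

Lemma ok1_weight0 m v : weight m v = 0 -> ok1 m v.
Proof. by move=> /weight0 v0; apply/ok1P => i im; rewrite v0. Qed.

Section Determinant.
Local Open Scope ring_scope.
Variables (F : fieldType) (q : F).
Hypothesis q0 : q != 0.
Hypothesis q1 : forall k, (0 < k)%N -> q ^+ k != 1.

Lemma qfact_neq0 n : qfact q n != 0.
Proof. by apply/prodf_neq0 => i _; rewrite subr_eq0 eq_sym q1. Qed.

(** Up to a constant, the value expected for a shape v is the determinant of the q^(l k) / qfact l
    over its beta numbers l; the additional factor q^l in each row provides the q^|v| of the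
    recursion. *)
Definition rowterm (k l : nat) : F := q ^+ (l * k.+1) / qfact q l.
Definition rowsum (k l : nat) : F := \sum_(p < l) rowterm k p.

(* From row [r] on, row [i] is summed over the shorter lengths of row [i]; lengths that
   do not form a partition yield two equal rows, so they do not contribute. *)
Definition stripmx (m : nat) (v : nat -> nat) (r : nat) : 'M[F]_m :=
  \matrix_(i, k) (if (i < r)%N then rowterm k (beta m v i) else rowsum k (beta m v i).+1).

Definition vdm (m : nat) (v : nat -> nat) : F :=
  \prod_(i < m) \prod_(j < m | (i < j)%N) (q ^+ beta m v j - q ^+ beta m v i).

(** Summing a row over shorter lengths closes up to a polynomial of degree k in q^l, with leading
    coefficient q^k, over [qfact q l]. So the matrix with all rows summed is a row-scaled
    Vandermonde matrix times a triangular one, and its determinant is again a product. *)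
Fixpoint rowpoly (k : nat) : {poly F} :=
  if k is k'.+1 then (q ^+ k)%:P * 'X^k + (1 - q ^+ k)%:P * rowpoly k' else 1.

Lemma rowsum_rowpoly k l : rowsum k l.+1 * qfact q l = (rowpoly k).[q ^+ l].
Proof.
elim: k l => [|k IHk] l.
  rewrite /= hornerC; elim: l => [|l IHl].
    by rewrite /rowsum big_ord_recl big_ord0 /rowterm mul0n /qfact big_ord0 expr0 divr1 addr0 mulr1.
  rewrite /rowsum big_ord_recr /= -/(rowsum 0 l.+1) mulrDl /rowterm muln1.
  by rewrite divfK ?qfact_neq0 // qfactS mulrA IHl mul1r subrK.
have tel n : rowsum k.+1 n.+1 * qfact q n =
    q ^+ k.+1 * q ^+ (n * k.+1) + (1 - q ^+ k.+1) * (rowsum k n.+1 * qfact q n).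
  elim: n => [|n IHn].
    rewrite /rowsum !big_ord_recl !big_ord0 /rowterm !mul0n /qfact big_ord0 expr0 divr1 addr0 mulr1.
    by rewrite !mulr1 addrC subrK.
  rewrite /rowsum 2![\sum_(p < n.+2) _]big_ord_recr /= -/(rowsum k.+1 n.+1) -/(rowsum k n.+1).
  rewrite /rowterm !mulrDl !divfK ?qfact_neq0 // qfactS !mulrA IHn.
  have -> : (n.+1 * k.+2 = (n * k.+1 + k.+1) + n.+1)%N by lia.
  have -> : (n.+1 * k.+1 = n * k.+1 + k.+1)%N by lia.
  rewrite !exprD; ring.
by rewrite tel IHk /= !hornerE -exprM.
Qed.

Lemma size_rowpoly k : (size (rowpoly k) <= k.+1)%N.
Proof.
elim: k => [|k IH] /=; first by rewrite size_poly1.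
apply: (leq_trans (size_polyD _ _)); rewrite geq_max; apply/andP; split.
  by apply: (leq_trans (size_polyMleq _ _)); rewrite size_polyXn size_polyC; case: (_ != 0); lia.
apply: (leq_trans (size_polyMleq _ _)); rewrite size_polyC.
by move: IH; case: (_ != 0) => /=; lia.
Qed.

Lemma coef_rowpoly k : (rowpoly k)`_k = q ^+ k.
Proof.
case: k => [|k] /=; first by rewrite coef1 expr0.
rewrite coefD !coefCM coefXn eqxx mulr1 [X in _ * X]nth_default ?mulr0 ?addr0 //.
exact: size_rowpoly.
Qed.

Lemma det_scale_rows m (d : 'I_m -> F) (A : 'M[F]_m) :
  \det (\matrix_(i, k) (d i * A i k)) = (\prod_i d i) * \det A.
Proof.
have -> : \matrix_(i, k) (d i * A i k) = diag_mx (\row_i d i) *m A.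
  by apply/matrixP => i k; rewrite mul_diag_mx !mxE.
by rewrite det_mulmx det_diag; congr (_ * _); apply: eq_bigr => i _; rewrite mxE.
Qed.

Lemma det_vdm m v : \det (\matrix_(i < m, k < m) (q ^+ beta m v i) ^+ k) = vdm m v.
Proof.
have -> : \matrix_(i < m, k < m) (q ^+ beta m v i) ^+ k =
    (Vandermonde m (\row_i q ^+ beta m v i))^T.
  by apply/matrixP => i k; rewrite !mxE.
rewrite det_tr det_Vandermonde /vdm; apply: eq_bigr => i _; apply: eq_bigr => j _.
by rewrite !mxE.
Qed.

Lemma det_stripmx0 m v : \det (stripmx m v 0) =
  (\prod_(i < m) q ^+ i) * (\prod_(i < m) (qfact q (beta m v i))^-1) * vdm m v.
Proof.
pose C : 'M[F]_m := \matrix_(j, k) (rowpoly k)`_j.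
have detC : \det C = \prod_(i < m) q ^+ i.
  rewrite -det_tr det_trig; last first.
    apply/is_trig_mxP => i j ij; rewrite !mxE nth_default //.
    exact: leq_trans (size_rowpoly i) ij.
  by apply: eq_bigr => i _; rewrite !mxE coef_rowpoly.
rewrite -mulrA [X in _ = X]mulrC -mulrA -detC -det_vdm -det_mulmx -det_scale_rows.
congr (\det _); apply/matrixP => i k; rewrite !mxE /=.
rewrite -[LHS](mulfK (qfact_neq0 (beta m v i))) rowsum_rowpoly mulrC; congr (_ * _).
rewrite (@horner_coef_wide _ m); last first.
  exact: leq_trans (size_rowpoly k) (ltn_ord k).
by apply: eq_bigr => j _; rewrite !mxE mulrC.
Qed.

Lemma det_stripmx_last m v : \det (stripmx m v m) =
  (\prod_(i < m) q ^+ beta m v i) * (\prod_(i < m) (qfact q (beta m v i))^-1) * vdm m v.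
Proof.
rewrite -det_vdm -big_split /= -det_scale_rows.
congr (\det _); apply/matrixP => i k; rewrite !mxE /= ltn_ord /rowterm mulnS exprD exprM.
ring.
Qed.

Lemma det_stripmx_last0 m v :
  \det (stripmx m v m) = q ^+ weight m v * \det (stripmx m v 0).
Proof.
rewrite det_stripmx_last det_stripmx0 !mulrA; congr (_ * _ * _).
by rewrite !prodrXr -exprD -sum_beta.
Qed.

(** The two matrices differ only in row r, so by multilinearity the difference is det D, where row r
    of D sums over strictly shorter lengths. If a cell can be removed from row r, D is the matrix of
    the smaller shape. Otherwise either row r is the last one and empty, and then row r of D is an
    empty sum, or rows r and r + 1 have equal length, and then their beta numbers differ by 1 and
    these two rows of D coincide. *)
Lemma det_stripmx_step m v r : ok1 m v -> (r < m)%N ->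
  \det (stripmx m v r) - \det (stripmx m v r.+1) =
  if (0 < v r)%N && ok1 m (dec v r) then \det (stripmx m (dec v r) r) else 0.
Proof.
move=> /ok1P vok rm.
pose i0 := Ordinal rm.
pose D : 'M[F]_m := \matrix_(i, k) (if (i < r)%N then rowterm k (beta m v i)
  else if i == i0 then rowsum k (beta m v i) else rowsum k (beta m v i).+1).
have -> : \det (stripmx m v r) - \det (stripmx m v r.+1) = \det D.
  rewrite -[\det D]mul1r -[\det (stripmx m v r.+1)]mul1r; apply/eqP; rewrite subr_eq; apply/eqP.
  apply: (@determinant_multilinear _ _ _ _ _ i0).
  - apply/rowP => k; rewrite !mxE !mul1r /= ltnn ltnSn eqxx.
    by rewrite /rowsum big_ord_recr.
  - apply/matrixP => i k; rewrite !mxE /=.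
    by rewrite [lift _ _ == _]eq_sym (negbTE (neq_lift _ _)).
  - apply/matrixP => i k; rewrite !mxE /=.
    have : lift i0 i != r :> nat by rewrite -[r]/(i0 : nat) val_eqE eq_sym neq_lift.
    by rewrite ltnS leq_eqVlt => /negbTE->.
case: ifP => [/andP[vr /ok1P dok]|/negbT].
  congr (\det _); apply/matrixP => i k; rewrite !mxE.
  have bd j : j != r -> beta m (dec v r) j = beta m v j.
    by move=> jr; rewrite /beta /dec (negbTE jr) subn0.
  case: ifP => [ir|/negbT ir]; first by rewrite bd // ltn_eqF.
  case: eqP => [->|/eqP]; last by rewrite -val_eqE /= => /bd->.
  by congr rowsum; rewrite /beta /dec /= eqxx; lia.
rewrite negb_and => h.
have [rl|rl] := leqP m r.+1.
  have vr0 : v r = 0%N.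
    move: h => /orP[|/ok1P h]; first by rewrite lt0n negbK => /eqP.
    by case: h => i im; rewrite /dec; have := vok i im; lia.
  have Z : row i0 D = 0 by apply/rowP => k; rewrite !mxE ltnn eqxx /beta vr0 /rowsum add0n (_ : (m.-1 - r)%N = 0%N) ?big_ord0 //; lia.
  rewrite (expand_det_row _ i0) big1 // => k _.
  by move/rowP: Z => /(_ k); rewrite !mxE => ->; rewrite mul0r.
have eqv : v r.+1 = v r.
  apply/eqP; rewrite eqn_leq vok //=.
  case/orP: h => [|/ok1P h]; first by rewrite lt0n negbK => /eqP->.
  rewrite leqNgt; apply/negP => lt; case: h => i im; rewrite /dec.
  have := vok i im; have [ir|_] := i =P r; last by case: eqP => _; lia.
  by rewrite ir; case: eqP => _; lia.
apply: (@determinant_alternate _ _ _ i0 (Ordinal rl)).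
  by rewrite -val_eqE /= neq_ltn ltnSn.
move=> k; rewrite !mxE /= ltnn eqxx ltnNge leqnSn /= -val_eqE /= gtn_eqF //.
by congr rowsum; rewrite /beta eqv; lia.
Qed.

Lemma vdm_neq0 m v : ok1 m v -> vdm m v != 0.
Proof.
move=> /ok1P vok; apply/prodf_neq0 => i _; apply/prodf_neq0 => j ij.
have dl a b : (a <= b)%N -> (b < m)%N -> (v b <= v a)%N.
  elim: b => [|b IHb]; first by rewrite leqn0 => /eqP->.
  rewrite leq_eqVlt => /orP[/eqP->//|]; rewrite ltnS => ab bm.
  by apply: leq_trans (vok _ bm) (IHb ab (ltnW bm)).
have vji := dl i j (ltnW ij) (ltn_ord j).
have -> : beta m v i = (beta m v j + (v i - v j + (j - i)))%N.
  by rewrite /beta; have := ltn_ord j; lia.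
rewrite exprD -[X in X - _]mulr1 -mulrBr mulf_neq0 ?expf_neq0 // subr_eq0 eq_sym q1 //; lia.
Qed.

Definition stripK (m : nat) (v : nat -> nat) (r : nat) : F :=
  \det (stripmx m v r) / \det (stripmx m (fun=> 0%N) 0).

Lemma stripK_last m v : stripK m v m = q ^+ weight m v * stripK m v 0.
Proof. by rewrite /stripK det_stripmx_last0 mulrA. Qed.

Lemma stripK_step m v r : ok1 m v -> (r < m)%N ->
  stripK m v r - stripK m v r.+1 =
  if (0 < v r)%N && ok1 m (dec v r) then stripK m (dec v r) r else 0.
Proof.
move=> vok rm; rewrite /stripK -mulrBl det_stripmx_step //.
by case: ifP => //; rewrite mul0r.
Qed.

Lemma det_stripmx0_neq0 m v : ok1 m v -> \det (stripmx m v 0) != 0.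
Proof.
move=> vok; rewrite det_stripmx0 !mulf_neq0 ?vdm_neq0 //; apply/prodf_neq0 => i _.
  by rewrite expf_neq0.
by rewrite invr_neq0 // qfact_neq0.
Qed.

Lemma stripmx_ext m u v r : (forall i, (i < m)%N -> u i = v i) -> stripmx m u r = stripmx m v r.
Proof. by move=> uv; apply/matrixP => i k; rewrite !mxE /beta uv. Qed.

Lemma stripK_weight0 m v r : (r <= m)%N -> weight m v = 0%N -> stripK m v r = 1.
Proof.
move=> rm wv; have v0 := weight0 wv.
elim: r rm => [_|r IH rm].
  rewrite /stripK (@stripmx_ext m v (fun=> 0%N)) // divff // det_stripmx0_neq0 //.
  exact/ok1P.
rewrite -IH; last exact: ltnW.
have := stripK_step (ok1_weight0 wv) rm; rewrite v0 //= => /eqP.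
by rewrite subr_eq0 => /eqP->.
Qed.

(** Taking q^(beta_j) out of each Vandermonde factor with i < j produces q to the sum of the i v_i,
    times a power of q that does not depend on v and cancels against the empty shape. *)
Lemma stripK0E m v : ok1 m v ->
  stripK m v 0 * \prod_(i < m) qfact q (beta m v i) =
  q ^+ (\sum_(i < m) i * v i)%N *
    \prod_(i < m) \prod_(j < m | (i < j)%N) (1 - q ^+ (beta m v i - beta m v j)).
Proof.
have dl u a b : ok1 m u -> (a <= b)%N -> (b < m)%N -> (u b <= u a)%N.
  move=> /ok1P uok; elim: b => [|b IHb]; first by rewrite leqn0 => /eqP->.
  rewrite leq_eqVlt => /orP[/eqP->//|]; rewrite ltnS => ab bm.
  by apply: leq_trans (uok _ bm) (IHb ab (ltnW bm)).
have vdmE u : ok1 m u -> vdm m u = q ^+ (\sum_(i < m) i * u i)%N *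
    (\prod_(i < m) \prod_(j < m | (i < j)%N) q ^+ (m.-1 - j)) *
    \prod_(i < m) \prod_(j < m | (i < j)%N) (1 - q ^+ (beta m u i - beta m u j)).
  move=> uok.
  have -> : q ^+ (\sum_(i < m) i * u i)%N = \prod_(i < m) \prod_(j < m | (i < j)%N) q ^+ (u j).
    rewrite (exchange_big_dep xpredT) //= expr_sum; apply: eq_bigr => j _.
    by rewrite -(big_ord_widen m (fun=> q ^+ u j)) ?prodr_const ?card_ord 1?mulnC ?exprM // ltnW.
  rewrite -!big_split /=; apply: eq_bigr => i _; rewrite -!big_split /=; apply: eq_bigr => j ij.
  have uji := dl u i j uok (ltnW ij) (ltn_ord j).
  rewrite -exprD -/(beta m u j) mulrBr mulr1 -exprD; congr (_ - q ^+ _).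
  by rewrite /beta; have := ltn_ord j; lia.
have ok0 : ok1 m (fun=> 0%N) by apply/ok1P.
move=> vok; rewrite /stripK !det_stripmx0 !vdmE //.
set V := \prod_(i < m) \prod_(j < m | _) q ^+ _.
set A := \prod_(i < m) q ^+ i.
(* For the empty shape the differences of beta numbers in row i are j - i, which run over 1, ..., m
   - 1 - i: these are the exponents in [qfact] of its beta number m - 1 - i. *)
have -> : \prod_(i < m) (qfact q (beta m (fun=> 0%N) i))^-1 =
   (\prod_(i < m) \prod_(j < m | (i < j)%N) (1 - q ^+ (beta m (fun=> 0%N) i - beta m (fun=> 0%N) j)))^-1.
  rewrite prodfV; congr (_^-1); apply: eq_bigr => i _.
  rewrite /qfact /beta add0n.
  rewrite [RHS](eq_bigr (fun j : 'I_m => 1 - q ^+ (j - i))); last first.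
    by move=> j ij; congr (1 - q ^+ _); have := ltn_ord j; lia.
  rewrite -(big_mkord (fun j => (i < j)%N) (fun j => 1 - q ^+ (j - i))).
  rewrite (big_cat_nat (n := i.+1)) //= [X in _ = X * _]big_nat_cond [X in _ = X * _]big_pred0; last first.
    by move=> j; apply/negbTE; lia.
  rewrite Monoid.mul1m [RHS]big_nat_cond.
  rewrite [RHS](eq_bigl (fun j => (i < j < m)%N && true)); last by move=> j; lia.
  rewrite -big_nat_cond -[i.+1]add0n big_addn big_mkord.
  have -> : (m - i.+1 = m.-1 - i)%N by lia.
  by apply: eq_bigr => j _; congr (1 - q ^+ _); lia.
set B := \prod_(i < m) \prod_(j < m | _) (1 - q ^+ (beta m (fun=> 0%N) i - _)).
have B0 : B != 0.
  apply/prodf_neq0 => i _; apply/prodf_neq0 => j ij.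
  by rewrite subr_eq0 eq_sym q1 // /beta; have := ltn_ord j; lia.
rewrite prodfV; set Q := \prod_(i < m) qfact q _.
have Q0 : Q != 0 by apply/prodf_neq0 => i _; exact: qfact_neq0.
rewrite (_ : (\sum_(i < m) i * 0 = 0)%N); last by rewrite big1 // => i _; rewrite muln0.
have V0 : V != 0 by apply/prodf_neq0 => i _; apply/prodf_neq0 => j _; exact: expf_neq0.
have A0 : A != 0 by apply/prodf_neq0 => i _; exact: expf_neq0.
set P := \prod_(i < m) \prod_(j < m | _) _.
by field; rewrite A0 V0 B0 Q0.
Qed.

End Determinant.

(** * Hooks of a beta set and several components *)

Definition tailrows (m : nat) (v : nat -> nat) : nat -> nat := fun i => v (i + m).

Fixpoint okb (ms : seq nat) (v : nat -> nat) : bool :=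
  if ms is m :: ms' then ok1 m v && okb ms' (tailrows m v) else true.

Lemma weight_cat m n v : weight (m + n) v = weight m v + weight n (tailrows m v).
Proof.
by rewrite /weight big_split_ord /=; congr (_ + _); apply: eq_bigr => i _; rewrite /tailrows addnC.
Qed.

Lemma eq_weight m u v : (forall i, i < m -> u i = v i) -> weight m u = weight m v.
Proof. by move=> uv; apply: eq_bigr => i _; rewrite uv. Qed.

Lemma eq_ok1 m u v : (forall i, i < m -> u i = v i) -> ok1 m u = ok1 m v.
Proof. by move=> uv; apply/ok1P/ok1P => h i im; have := h i im; rewrite !uv // ltnW. Qed.

Lemma okb_weight0 ms v : weight (sumn ms) v = 0 -> okb ms v.
Proof.
elim: ms v => //= m ms IH v; rewrite weight_cat => /eqP.
by rewrite addn_eq0 => /andP[/eqP w1 /eqP w2]; rewrite ok1_weight0 // IH.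
Qed.

Section BlockK.
Local Open Scope ring_scope.
Variables (F : fieldType) (q : F).
Hypothesis q0 : q != 0.
Hypothesis q1 : forall k, (0 < k)%N -> q ^+ k != 1.

(** Rows of all components are numbered consecutively. A component lying wholly above row r keeps
    all its cells and contributes [stripK] at r = m, written here in the form given by
    [stripK_last]. *)
Fixpoint blockK (ms : seq nat) (v : nat -> nat) (r : nat) : F :=
  if ms is m :: ms' then
    if (r < m)%N then stripK q m v r * blockK ms' (tailrows m v) 0
    else q ^+ weight m v * stripK q m v 0 * blockK ms' (tailrows m v) (r - m)
  else 1.

Lemma eq_stripK m u v r : (forall i, (i < m)%N -> u i = v i) -> stripK q m u r = stripK q m v r.
Proof. by move=> uv; rewrite /stripK (stripmx_ext _ _ uv). Qed.

Lemma blockK_last ms v : okb ms v ->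
  blockK ms v (sumn ms) = q ^+ weight (sumn ms) v * blockK ms v 0.
Proof.
elim: ms v => [|m ms IH] v /=; first by rewrite /weight big_ord0 mulr1.
case/andP => ok1v okv; rewrite ltnNge leq_addr /= addKn IH // weight_cat exprD.
case: ltnP => [_|]; first by ring.
rewrite leqn0 => /eqP->; rewrite /weight big_ord0 subn0; ring.
Qed.

Lemma blockK_weight0 ms v r : (r <= sumn ms)%N -> weight (sumn ms) v = 0%N ->
  blockK ms v r = 1.
Proof.
elim: ms v r => //= m ms IH v r rm; rewrite weight_cat => /eqP.
rewrite addn_eq0 => /andP[/eqP w1 /eqP w2].
case: ifP => rm'; first by rewrite stripK_weight0 ?IH ?mulr1 // ltnW.
by rewrite w1 stripK_weight0 ?IH ?mulr1 //; lia.
Qed.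

Lemma blockK_step ms u r : okb ms u -> (r < sumn ms)%N ->
  blockK ms u r - blockK ms u r.+1 =
  if (0 < u r)%N && okb ms (dec u r) then blockK ms (dec u r) r else 0.
Proof.
elim: ms u r => //= m ms IH u r /andP[ok1u oku] rm.
have [rlt|rge] := ltnP r m.
  have -> : tailrows m (dec u r) = tailrows m u.
    by apply/funext => i; rewrite /tailrows /dec (_ : (i + m == r)%N = false) ?subn0 //; lia.
  rewrite oku andbT.
  have -> : (if (r.+1 < m)%N then stripK q m u r.+1 * blockK ms (tailrows m u) 0
     else q ^+ weight m u * stripK q m u 0 * blockK ms (tailrows m u) (r.+1 - m)) =
     stripK q m u r.+1 * blockK ms (tailrows m u) 0.
    case: ltnP => // mr; have -> : r.+1 = m by lia.
    by rewrite subnn stripK_last.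
  rewrite -mulrBl stripK_step //.
  by case: ifP => // _; rewrite mul0r.
rewrite ltnNge ltnW /= 1?subSn // -mulrBr IH //; last by lia.
have E i : (i < m)%N -> dec u r i = u i.
  by move=> im; rewrite /dec (_ : (i == r) = false) ?subn0 //; lia.
have -> : tailrows m (dec u r) = dec (tailrows m u) (r - m).
  apply/funext => i; rewrite /tailrows /dec; congr (_ - _)%N.
  by congr nat_of_bool; lia.
rewrite (eq_ok1 E) ok1u /= (eq_weight E) (eq_stripK _ E) /tailrows subnK //.
by case: ifP => // _; rewrite mulr0.
Qed.

Lemma blockK0E (l : seq (seq nat)) : all (sorted geq) l ->
  blockK (map size l) (nth 0%N (flatten l)) 0 *
    \prod_(mu <- l) \prod_(i < size mu) qfact q (beta (size mu) (nth 0%N mu) i) =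
  q ^+ (\sum_(mu <- l) \sum_(i < size mu) i * nth 0 mu i)%N *
    \prod_(mu <- l) \prod_(i < size mu) \prod_(j < size mu | (i < j)%N)
      (1 - q ^+ (beta (size mu) (nth 0%N mu) i - beta (size mu) (nth 0%N mu) j)).
Proof.
elim: l => [|mu l IH] /=; first by rewrite !big_nil expr0.
case/andP => smu sl; rewrite !big_cons.
have E i : (i < size mu)%N -> nth 0%N (mu ++ flatten l) i = nth 0%N mu i.
  by move=> imu; rewrite nth_cat imu.
have -> : tailrows (size mu) (nth 0%N (mu ++ flatten l)) = nth 0%N (flatten l).
  by apply/funext => i; rewrite /tailrows nth_cat ltnNge leq_addl /= addnK.
have okmu : ok1 (size mu) (nth 0%N mu).
  by apply/ok1P => i im; move/(sortedP 0%N): smu => /(_ i im).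
have -> : (if (0 < size mu)%N then stripK q (size mu) (nth 0%N (mu ++ flatten l)) 0
     * blockK (map size l) (nth 0%N (flatten l)) 0
   else q ^+ weight (size mu) (nth 0%N (mu ++ flatten l)) *
    stripK q (size mu) (nth 0%N (mu ++ flatten l)) 0 *
    blockK (map size l) (nth 0%N (flatten l)) (0 - size mu)) =
  stripK q (size mu) (nth 0%N mu) 0 * blockK (map size l) (nth 0%N (flatten l)) 0.
  rewrite (eq_weight E) (eq_stripK _ E); case: posnP => // ->.
  by rewrite subn0 /weight big_ord0 mul1r.
by rewrite mulrACA IH // stripK0E // exprD mulrACA.
Qed.

Lemma okb_flatten (l : seq (seq nat)) : all (sorted geq) l ->
  okb (map size l) (nth 0%N (flatten l)).
Proof.
elim: l => //= mu l IH /andP[smu sl]; apply/andP; split.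
  apply/ok1P => i im; rewrite !nth_cat im (ltnW im).
  by move/(sortedP 0%N): smu => /(_ i im).
rewrite (_ : tailrows _ _ = nth 0%N (flatten l)) ?IH //.
by apply/funext => i; rewrite /tailrows nth_cat ltnNge leq_addl /= addnK.
Qed.

Lemma words_blockK ms u : okb ms u ->
  \sum_(w <- words (okb ms) (sumn ms) (weight (sumn ms) u) u) q ^+ majw w =
  qfact q (weight (sumn ms) u) * blockK ms u 0.
Proof.
move=> oku; have [m0|m0] := posnP (sumn ms).
  by rewrite m0 /weight big_ord0 /= big_seq1 /majw big_geq // blockK_weight0 ?m0 ?/weight ?big_ord0 // /qfact big_ord0 mulr1.
apply: words_sum => //.
- exact: blockK_step.
- exact: blockK_last.
- exact: blockK_weight0.
- exact: okb_weight0.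
Qed.

End BlockK.

Definition betas (mu : seq nat) : seq nat := mkseq (beta (size mu) (nth 0 mu)) (size mu).

(* The hook lengths of a diagram are the differences [x - y] with [x] in its beta set
   and [y < x] outside. *)
Definition hooks (mu : seq nat) : seq nat :=
  [seq x - y | x <- betas mu, y <- [seq y <- iota 0 x | y \notin betas mu]].

Lemma ltn_beta (mu : seq nat) i j : sorted geq mu -> i < j -> j < size mu ->
  beta (size mu) (nth 0 mu) j < beta (size mu) (nth 0 mu) i.
Proof.
move=> smu ij jm.
have h : nth 0 mu j <= nth 0 mu i.
  apply: (sorted_leq_nth (leT := geq)) => //; try exact: ltnW.
  - by move=> a b c /= ba cb; apply: leq_trans cb ba.
  - by move=> a /=.
  - by rewrite inE (ltn_trans ij).
by rewrite /beta; lia.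
Qed.

Lemma uniq_betas (mu : seq nat) : sorted geq mu -> uniq (betas mu).
Proof.
move=> smu; apply/mkseq_uniqP => i j im jm e.
have [lt|lt|//] := ltngtP i j.
  by have := ltn_beta smu lt jm; rewrite e ltnn.
by have := ltn_beta smu lt im; rewrite e ltnn.
Qed.

(** For a beta number x, the differences x - y with y < x are 1, ..., x. They are sorted by whether
    y is in the beta set: if so they are differences of beta numbers, if not they are hooks. The
    operation is left abstract because the identity is used for counting, for products and for power
    sums. *)
Lemma big_hooks (M : Type) (idx : M) (op : Monoid.com_law idx) (G : nat -> M) (mu : seq nat) :
  sorted geq mu ->
  \big[op/idx]_(i < size mu) \big[op/idx]_(k < beta (size mu) (nth 0 mu) i) G k.+1 =
  op (\big[op/idx]_(i < size mu) \big[op/idx]_(j < size mu | i < j)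
        G (beta (size mu) (nth 0 mu) i - beta (size mu) (nth 0 mu) j))
     (\big[op/idx]_(h <- hooks mu) G h).
Proof.
move=> smu; set m := size mu; set be := beta m (nth 0 mu).
have -> : \big[op/idx]_(h <- hooks mu) G h =
    \big[op/idx]_(i < m) \big[op/idx]_(y <- iota 0 (be i) | y \notin betas mu) G (be i - y).
  rewrite /hooks big_allpairs_dep /= /betas big_map.
  have <- : index_iota 0 m = iota 0 m by rewrite /index_iota subn0.
  by rewrite big_mkord; apply: eq_bigr => i _; rewrite big_filter.
rewrite -big_split /=; apply: eq_bigr => i _.
have -> : \big[op/idx]_(k < be i) G k.+1 = \big[op/idx]_(y <- iota 0 (be i)) G (be i - y).
  have <- : index_iota 0 (be i) = iota 0 (be i) by rewrite /index_iota subn0.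
  rewrite big_rev_mkord subn0; apply: eq_bigr => k _; congr G.
  by have := ltn_ord k; lia.
rewrite (bigID (mem (betas mu))) /=; apply: f_equal2 => //.
rewrite -big_filter.
have /(perm_big _) -> : perm_eq [seq y <- iota 0 (be i) | y \in betas mu]
    [seq y <- betas mu | y < be i].
  apply: uniq_perm; rewrite ?filter_uniq ?iota_uniq ?uniq_betas // => y.
  by rewrite !mem_filter mem_iota /= andbC.
rewrite big_filter /betas big_map.
have <- : index_iota 0 m = iota 0 m by rewrite /index_iota subn0.
rewrite big_mkord; apply: eq_bigl => j.
have [ij|ji|/val_inj->] := ltngtP i j; last by rewrite ltnn.
  by rewrite ltn_beta.
by apply/negbTE; rewrite -leqNgt ltnW // ltn_beta.
Qed.

Lemma hooks_gt0 (mu : seq nat) h : h \in hooks mu -> 0 < h.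
Proof.
case/allpairsPdep => x [y [_]]; rewrite mem_filter mem_iota => /and3P[_ _ yx] ->.
by rewrite subn_gt0.
Qed.

Lemma size_hooks (mu : seq nat) : sorted geq mu -> size (hooks mu) = sumn mu.
Proof.
move=> smu; rewrite -sum1_size.
have := @big_hooks _ _ [the Monoid.com_law 0 of addn] (fun=> 1) mu smu => /=.
have -> : \sum_(i < size mu) \sum_(k < beta (size mu) (nth 0 mu) i) 1 =
    sumn mu + \sum_(i < size mu) i.
  under eq_bigr do rewrite sum1_card card_ord.
  by rewrite sum_beta sumnE (big_nth 0) big_mkord.
have -> : \sum_(i < size mu) \sum_(j < size mu | i < j) 1 = \sum_(i < size mu) i.
  rewrite (exchange_big_dep xpredT) //=; apply: eq_bigr => j _.
  by rewrite -(big_ord_widen _ (fun=> 1)) ?sum1_card ?card_ord // ltnW.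
by rewrite addnC => /addnI.
Qed.

(** * Stanley's formula as an identity of polynomials *)

Section WordPolynomial.
Local Open Scope ring_scope.

(** The recursion was solved for a fixed q that is nonzero and not a root of unity; the integers
    above 1 are enough such values to identify polynomials. *)
Lemma poly_eq_nat (R : numFieldType) (p1 p2 : {poly R}) :
  (forall n, (1 < n)%N -> p1.[n%:R] = p2.[n%:R]) -> p1 = p2.
Proof.
move=> h; apply/eqP; rewrite -subr_eq0; apply/negPn/negP => d0.
have := @max_poly_roots _ _ [seq n%:R | n <- iota 2 (size (p1 - p2))] d0.
rewrite size_map size_iota ltnn => /(_ _ _)/notF; apply; last first.
  by rewrite map_inj_uniq ?iota_uniq // => a b /eqP; rewrite eqr_nat => /eqP.
apply/allP => _ /mapP[n + ->]; rewrite mem_iota => /andP[n2 _].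
by rewrite /root hornerD hornerN h // subrr.
Qed.

Variable R : numFieldType.

Definition bracket (k : nat) : {poly R} := \sum_(j < k) 'X^j.

Lemma bracketE k (x : R) : 1 - x ^+ k = (1 - x) * (bracket k).[x].
Proof.
rewrite /bracket horner_sum -[X in X - _](expr1n _ k) subrXX; congr (_ * _).
by apply: eq_bigr => i _; rewrite expr1n mul1r hornerXn.
Qed.

Lemma words_bracket (l : seq (seq nat)) (ms := map size l) (v := nth 0%N (flatten l))
    (n := sumn (flatten l)) : all (sorted geq) l ->
  (\sum_(w <- words (okb ms) (sumn ms) n v) 'X^(majw w)) *
    \prod_(h <- flatten (map hooks l)) bracket h =
  'X^(\sum_(mu <- l) \sum_(i < size mu) i * nth 0 mu i)%N * \prod_(k < n) bracket k.+1.
Proof.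
move=> sl; apply: poly_eq_nat => c c1; set q : R := c%:R.
have q0 : q != 0 by rewrite pnatr_eq0; lia.
have q1 k : (0 < k)%N -> q ^+ k != 1.
  move=> k0; rewrite -natrX pnatr_eq1; apply/eqP => e.
  by have := ltn_expl k c1; rewrite e; lia.
have wn : weight (sumn ms) v = n.
  by rewrite /weight /n [RHS]sumnE [RHS](big_nth 0%N) [RHS]big_mkord size_flatten.
have := words_blockK q0 q1 (okb_flatten sl); rewrite -/ms -/v wn => e1.
have e2 := blockK0E q0 q1 sl; rewrite -/ms -/v in e2.
rewrite !hornerM hornerXn !horner_prod.
have -> : (\sum_(w <- words (okb ms) (sumn ms) n v) 'X^(majw w)).[q] =
    qfact q n * blockK q ms v 0.
  by rewrite -e1 horner_sum; apply: eq_bigr => w _; rewrite hornerXn.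
have hk : \prod_(mu <- l) \prod_(i < size mu) qfact q (beta (size mu) (nth 0%N mu) i) =
   \prod_(mu <- l) \prod_(i < size mu) \prod_(j < size mu | (i < j)%N)
      (1 - q ^+ (beta (size mu) (nth 0%N mu) i - beta (size mu) (nth 0%N mu) j)) *
   \prod_(h <- flatten (map hooks l)) (1 - q ^+ h).
  rewrite big_flatten big_map -big_split /= big_seq [RHS]big_seq; apply: eq_bigr => mu mul.
  exact: (big_hooks _ (fun k => 1 - q ^+ k) (allP sl _ mul)).
set N := \prod_(mu <- l) \prod_(i < size mu) \prod_(j < size mu | _) _ in e2 hk.
have N0 : N != 0.
  rewrite prodf_seq_neq0; apply/allP => mu mul /=.
  apply/prodf_neq0 => i _; apply/prodf_neq0 => j ij.
  rewrite subr_eq0 eq_sym q1 // subn_gt0 ltn_beta //; exact: (allP sl).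
have K1 : blockK q ms v 0 * \prod_(h <- flatten (map hooks l)) (1 - q ^+ h) =
    q ^+ (\sum_(mu <- l) \sum_(i < size mu) i * nth 0 mu i)%N.
  by apply: (mulIf N0); rewrite -e2 hk -mulrA; congr (_ * _); rewrite mulrC.
(* There are as many hooks as cells, so the factors 1 - q that turn 1 - q^k into [k] occur n times
   on both sides. *)
have sz : size (flatten (map hooks l)) = n.
  rewrite /n size_flatten /shape -map_comp sumn_flatten; congr sumn.
  by apply/eq_in_map => mu mul /=; rewrite size_hooks // (allP sl).
have qn : qfact q n = (1 - q) ^+ n * \prod_(k < n) (bracket k.+1).[q].
  rewrite -[X in _ ^+ X]card_ord -prodr_const -big_split /=.
  by apply: eq_bigr => k _; rewrite bracketE.
have hn : \prod_(h <- flatten (map hooks l)) (1 - q ^+ h) =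
    (1 - q) ^+ n * \prod_(h <- flatten (map hooks l)) (bracket h).[q].
  rewrite -sz; elim: (flatten _) => [|h s IH]; first by rewrite !big_nil mulr1.
  by rewrite !big_cons IH bracketE /= exprS; ring.
by rewrite -K1 hn qn; ring.
Qed.

End WordPolynomial.

(** * Standard tableaux as words *)

Definition content (w : seq nat) : nat -> nat := fun r => count_mem r w.

Lemma dec_content w r : dec (content (rcons w r)) r = content w.
Proof.
apply/funext => i; rewrite /dec /content -cats1 count_cat /= addn0 [r == i]eq_sym.
by rewrite addnK.
Qed.

Lemma mem_words (ok : (nat -> nat) -> bool) m w : all (gtn m) w ->
  (forall k, 0 < k <= size w -> ok (content (take k w))) ->
  w \in words ok m (size w) (content w).
Proof.
elim/last_ind: w => [|w r IH]; first by rewrite inE.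
rewrite all_rcons size_rcons => /andP[/= rm wm] okw.
have := okw (size w).+1; rewrite -(size_rcons w r) take_size size_rcons ltnS leqnn => ->//.
apply/flatten_mapP; exists r.
  by rewrite mem_filter mem_iota /= rm andbT /content -has_count has_pred1 mem_rcons mem_head.
apply/mapP; exists w => //; rewrite dec_content; apply: IH => // k /andP[k0 kw].
by have := okw k; rewrite -cats1 takel_cat // k0 => -> //; rewrite leqW.
Qed.

Lemma wordsP ok m n v w : weight m v = n -> (forall r, m <= r -> v r = 0) ->
  w \in words ok m n v ->
  [/\ all (gtn m) w, v = content w & forall k, 0 < k <= size w -> ok (content (take k w))].
Proof.
elim: n v w => [|n IH] v w wv v0.
  rewrite inE => /eqP->; split => //; last by case.
  by apply/funext => r; have [/v0//|rm] := leqP m r; rewrite (weight0 wv).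
move=> /= /[dup] + ; case: ifP => // okv _ /flatten_mapP[r].
rewrite mem_filter mem_iota add0n => /andP[vr /= rm] /mapP[w' w'in ->].
have wd : weight m (dec v r) = n by apply/eqP; rewrite -eqSS weight_dec // wv.
have d0 i : m <= i -> dec v r i = 0 by rewrite /dec => /v0 ->.
have [am vE okw] := IH _ _ wd d0 w'in.
have vE' : v = content (rcons w' r).
  apply/funext => i; have := congr1 (fun f => f i) vE.
  rewrite /dec /content -cats1 count_cat /= addn0 [r == i]eq_sym => <-.
  by case: eqP => [->|_]; rewrite ?subn0 ?addn0 ?subnK.
split=> //; first by rewrite all_rcons /= rm.
move=> k /andP[k0]; rewrite size_rcons leq_eqVlt => /orP[/eqP->|kw].
  by rewrite -(size_rcons w' r) take_size -vE'.
by rewrite -cats1 takel_cat //; apply: okw; rewrite k0.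
Qed.

Lemma uniq_words ok m n v : uniq (words ok m n v).
Proof.
elim: n v => //= n IH v; case: ifP => // _.
elim: [seq r <- _ | _] (filter_uniq (fun r => 0 < v r) (iota_uniq 0 m)) => //= r s IHs /andP[rs us].
rewrite cat_uniq map_inj_uniq ?IH ?IHs //=; last by move=> a b /rcons_inj[].
rewrite andbT; apply/hasPn => _ /flatten_mapP[r' r's /mapP[w' _ ->]].
apply/negP => /mapP[w'' _ /rcons_inj[_ e]]; by move: rs; rewrite -e r's.
Qed.

Fixpoint component (ms : seq nat) (r : nat) : nat :=
  if ms is m :: ms' then if r < m then 0 else (component ms' (r - m)).+1 else 0.

Lemma okbP ms v :
  reflect (forall r, r.+1 < sumn ms -> component ms r = component ms r.+1 -> v r.+1 <= v r)
    (okb ms v).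
Proof.
elim: ms v => [|m ms IH] v /=; first by constructor.
apply: (iffP andP) => [[/ok1P o1 /IH o2] r rm|h].
  case: ltnP => rm'; case: ltnP => // rm''; first by move=> _; exact: o1.
  move=> [e]; have := o2 (r - m); rewrite /tailrows addSn subnK // => -> //; first lia.
  by rewrite -subSn.
split; first by apply/ok1P => r rm; apply: h; [lia|rewrite rm ltnW].
apply/IH => r rm e; rewrite /tailrows addSn; apply: h; first lia.
by rewrite !ltnNge -addSn !leq_addl /= !addnK e.
Qed.

Fixpoint startcol (l : blockpart) (r : nat) : nat :=
  if l is mu :: l' then if r < size mu then bwidth l' else startcol l' (r - size mu) else 0.

Definition rowlens (l : blockpart) : seq nat := flatten [seq parts mu | mu <- l].

Definition heights (l : blockpart) : seq nat := [seq size mu | mu <- [seq parts mu | mu <- l]].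

Lemma size_rowlens l : size (rowlens l) = sumn (heights l).
Proof. exact: size_flatten. Qed.

Lemma sumn_rowlens l : sumn (rowlens l) = bsize l.
Proof. by rewrite sumn_flatten /bsize sumnE !big_map. Qed.

Lemma sorted_parts (mu : intpart) : sorted geq mu.
Proof. by case: mu => s /= /andP[]. Qed.

Lemma sorted_geq_nth (mu : seq nat) i j : sorted geq mu -> i <= j -> nth 0 mu j <= nth 0 mu i.
Proof.
move=> smu ij; have [js|js] := ltnP j (size mu); last by rewrite (nth_default _ js).
apply: (sorted_leq_nth (leT := geq)) => //.
- by move=> a b c /= ba cb; apply: leq_trans cb ba.
- by move=> a /=.
- by rewrite inE (leq_ltn_trans ij).
Qed.

Lemma mem_cells l x :
  (x \in cells l) = (startcol l x.1 <= x.2 < startcol l x.1 + nth 0 (rowlens l) x.1).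
Proof.
case: x => r c; elim: l r c => [|mu l IH] r c /=.
  by rewrite nth_nil in_nil; lia.
rewrite mem_cat /rowlens /= nth_cat.
have [rm|rm] := ltnP r (size mu).
  rewrite [X in _ || X](_ : _ = false) ?orbF; last first.
    by apply/negP => /mapP[[a b] _ [e _]]; lia.
  apply/mapP/idP => [[[a b]]|/andP[c1 c2]].
    case/allpairsPdep => a' [b' [_ +]] [-> ->]; rewrite mem_iota => h [-> ->]; rewrite addn0; lia.
  exists (r, c - bwidth l); last by rewrite /Defs.shift /= addn0 subnK.
  by apply/allpairsPdep; exists r, (c - bwidth l); rewrite !mem_iota; split=> //; lia.
rewrite [X in X || _](_ : _ = false) /=; last first.
  apply/negP => /mapP[[a b]] /allpairsPdep[a' [b' [+ _ []]]] -> _ [e _].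
  by rewrite mem_iota; lia.
rewrite -/(rowlens l) -(IH (r - size mu) c); apply/mapP/idP => [[[a b] ab [-> ->]]|h].
  by rewrite addn0 addnK.
by exists (r - size mu, c) => //; rewrite /Defs.shift /= addn0 subnK.
Qed.

Lemma startcol_le l r : startcol l r + nth 0 (rowlens l) r <= bwidth l.
Proof.
elim: l r => [|mu l IH] r; first by rewrite nth_nil.
rewrite /bwidth big_cons -/(bwidth l) /rowlens /= nth_cat.
have [rm|rm] := ltnP r (size mu).
  by rewrite addnC leq_add2r -nth0 sorted_geq_nth // sorted_parts.
by apply: leq_trans (IH _) _; rewrite leq_addl.
Qed.

(** Components occupy disjoint column ranges, the later ones to the left, so column conditions never
    compare rows of different components. This is why the prefix test on words only looks inside
    components. *)
Lemma same_col_component l r r' c : (r, c) \in cells l -> (r', c) \in cells l ->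
  component (heights l) r = component (heights l) r'.
Proof.
elim: l r r' => [|mu l IH] r r' //; rewrite !mem_cells /= /rowlens /= !nth_cat -/(rowlens l).
have B (a : nat) := startcol_le l a.
have [rm|rm] := ltnP r (size mu); have [rm'|rm'] := ltnP r' (size mu) => //.
- by have := B (r' - size mu); lia.
- by have := B (r - size mu); lia.
by move=> h h'; congr _.+1; apply: IH; rewrite mem_cells.
Qed.

Lemma component_startcol l r r' : r < sumn (heights l) -> r' < sumn (heights l) ->
  component (heights l) r = component (heights l) r' -> startcol l r = startcol l r'.
Proof.
elim: l r r' => //= mu l IH r r' rm rm'.
have [h|h] := ltnP r (size mu); have [h'|h'] := ltnP r' (size mu) => // -[e].
by apply: IH => //; rewrite /heights /= in rm rm' *; lia.
Qed.

Lemma component_mono ms r r' : r <= r' -> component ms r <= component ms r'.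
Proof.
elim: ms r r' => //= m ms IH r r' rr'.
have [h|h] := ltnP r m => //; have [h'|h'] := ltnP r' m; first lia.
by rewrite ltnS IH //; lia.
Qed.

Lemma okb_le ms v r r' : okb ms v -> r <= r' -> r' < sumn ms ->
  component ms r = component ms r' -> v r' <= v r.
Proof.
move/okbP => h; elim: r' => [|r' IH]; first by rewrite leqn0 => /eqP->.
rewrite leq_eqVlt => /orP[/eqP->//|]; rewrite ltnS => rr' rm e.
have m1 := component_mono ms rr'; have m2 := component_mono ms (leqnSn r').
have e' : component ms r' = component ms r'.+1 by lia.
by apply: leq_trans (h r' rm e') (IH rr' (ltnW rm) _); rewrite e.
Qed.

Lemma all_sorted_parts (l : blockpart) : all (sorted geq) [seq parts mu | mu <- l].
Proof. by elim: l => //= mu l ->; rewrite sorted_parts. Qed.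

Lemma okb_rowlens l : okb (heights l) (nth 0 (rowlens l)).
Proof. by apply: okb_flatten; exact: all_sorted_parts. Qed.

Lemma count_take (w : seq nat) (r k : nat) : k <= size w ->
  count_mem r (take k w) = \sum_(i < k) (nth 0 w i == r).
Proof.
elim: k => [|k IH] kw; first by rewrite take0 big_ord0.
by rewrite (take_nth 0) // -cats1 count_cat IH ?(ltnW kw) // big_ord_recr /= addn0.
Qed.

Definition positions (w : seq nat) (r : nat) : seq nat :=
  [seq i <- iota 0 (size w) | nth 0 w i == r].

Lemma size_positions w r : size (positions w r) = count_mem r w.
Proof.
rewrite -[w in RHS]take_size count_take // size_filter -sum1_count big_mkcond.
have <- : index_iota 0 (size w) = iota 0 (size w) by rewrite /index_iota subn0.
by rewrite big_mkord; apply: eq_bigr => i _; case: eqP.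
Qed.

Lemma sorted_positions w r : sorted ltn (positions w r).
Proof. by apply: sorted_filter; [exact: ltn_trans|exact: iota_ltn_sorted]. Qed.

Lemma mem_positions w r i : (i \in positions w r) = (i < size w) && (nth 0 w i == r).
Proof. by rewrite mem_filter mem_iota add0n andbC. Qed.

Lemma positions_cat w w' r : {s | positions (w ++ w') r = positions w r ++ s}.
Proof.
rewrite /positions size_cat iotaD filter_cat; eexists; congr (_ ++ _).
by apply: eq_in_filter => i; rewrite mem_iota nth_cat => /= ->.
Qed.

(** With [ltn_count_positions] this translates between the place of the j-th occurrence of a letter
    and the number of its occurrences in a prefix. *)
Lemma nth_positions_lt w r j k : k <= size w -> j < count_mem r (take k w) ->
  nth 0 (positions w r) j < k.
Proof.
move=> kw jc; have [s] := positions_cat (take k w) (drop k w) r.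
rewrite cat_take_drop => ->; rewrite nth_cat size_positions jc.
have : nth 0 (positions (take k w) r) j \in positions (take k w) r.
  by rewrite mem_nth // size_positions.
by rewrite mem_positions size_takel // => /andP[].
Qed.

Lemma ltn_count_positions w r j : j < count_mem r w ->
  j < count_mem r (take (nth 0 (positions w r) j).+1 w).
Proof.
rewrite -!size_positions => jp; set p := nth 0 (positions w r) j.
have : p \in positions w r by rewrite mem_nth.
rewrite mem_positions => /andP[pw _].
rewrite -(size_takel jp); apply: uniq_leq_size.
  by rewrite take_uniq // filter_uniq // iota_uniq.
move=> i /(nthP 0)[k]; rewrite size_takel // => kj; rewrite nth_take // => iE.
have kp : k < size (positions w r) by apply: leq_trans kj jp.
have : i \in positions w r by rewrite -iE mem_nth.
rewrite !mem_positions size_takel // => /andP[iw /eqP ir].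
have ip : i < p.+1.
  rewrite ltnS -iE; apply: (sorted_leq_nth leq_trans leqnn) => //.
  by rewrite (sub_sorted (e := ltn)) ?sorted_positions // => a b; exact: ltnW.
by rewrite ip nth_take // ir eqxx.
Qed.

Section TableauWord.
Variable l : blockpart.
Implicit Types (T : SYT l) (x y : cell l).

Let n := bsize l.

Lemma SYT_inj T : injective (val T).
Proof. by have /and4P[/injectiveP] := valP T. Qed.

Lemma SYT_bij T : bijective (val T).
Proof.
apply: inj_card_bij; first exact: SYT_inj.
by rewrite card_ord card_seq_sub ?uniq_cells // size_cells.
Qed.

Lemma SYT_surj T (k : 'I_n) : exists x, val T x = k.
Proof. by have /and4P[_ /forallP /(_ k) /existsP[x /eqP]] := valP T; exists x. Qed.

Lemma SYT_row T x y : row_of x = row_of y -> col_of x < col_of y -> val T x < val T y.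
Proof.
have /and4P[_ _ /'forall_forallP h _] := valP T => e lt.
by have := h x y; rewrite e eqxx lt.
Qed.

Lemma SYT_col T x y : col_of x = col_of y -> row_of x < row_of y -> val T x < val T y.
Proof.
have /and4P[_ _ _ /'forall_forallP h] := valP T => e lt.
by have := h x y; rewrite e eqxx lt.
Qed.

Definition cell_at T (k : nat) : option (cell l) := [pick x | val T x == k :> nat].

Definition word_of T : seq nat :=
  mkseq (fun k => if cell_at T k is Some x then row_of x else 0) n.

Lemma size_word_of T : size (word_of T) = n.
Proof. exact: size_mkseq. Qed.

Lemma nth_word_of T x : nth 0 (word_of T) (val T x) = row_of x.
Proof.
rewrite nth_mkseq // /cell_at; case: pickP => [y /eqP/val_inj/SYT_inj->//|].
by move=> /(_ x); rewrite eqxx.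
Qed.

Lemma count_word_of T r k : k <= n ->
  count_mem r (take k (word_of T)) = #|[set x | (row_of x == r) && (val T x < k)]|.
Proof.
move=> kn; rewrite count_take ?size_word_of // -sum1dep_card big_mkcond /=.
rewrite (big_ord_widen n (fun i => nat_of_bool (nth 0 (word_of T) i == r))) //.
rewrite big_mkcond /= (reindex (val T)) /=; last exact: onW_bij (SYT_bij T).
rewrite [RHS]big_mkcond; apply: eq_bigr => x _; rewrite (nth_word_of T x).
by case: ltnP => _; rewrite ?andbF ?andbT //; case: eqP.
Qed.

Lemma card_row r k : #|[set x : cell l | (row_of x == r) && (col_of x < startcol l r + k)]| =
  minn k (nth 0 (rowlens l) r).
Proof.
set s := [seq (r, c) | c <- iota (startcol l r) (minn k (nth 0 (rowlens l) r))].
rewrite -[RHS](size_iota (startcol l r)) -(size_map (fun c => (r, c))) -/s.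
rewrite cardE -(size_map val); apply: perm_size; apply: uniq_perm.
- by rewrite map_inj_uniq ?enum_uniq //; exact: val_inj.
- by rewrite map_inj_uniq ?iota_uniq // => a b [].
move=> [a c]; apply/mapP/mapP => [[x]|[c' + [-> ->]]].
  rewrite mem_enum inE /row_of /col_of => /andP[/eqP + lt] xE; rewrite -xE => /= ar.
  exists c; last by rewrite -ar.
  have := valP x; rewrite -xE mem_cells /= mem_iota ar; rewrite -xE /= in lt; lia.
rewrite mem_iota => cr.
have rc : (r, c') \in cells l by rewrite mem_cells /=; lia.
by exists (SeqSub rc) => //; rewrite mem_enum inE /row_of /col_of /= eqxx; lia.
Qed.

Lemma row_of_lt x : row_of x < sumn (heights l).
Proof.
rewrite -size_rowlens ltnNge; apply/negP => h.
by have := valP x; rewrite mem_cells /row_of in h *; rewrite nth_default //; lia.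
Qed.

Lemma content_word_of T : content (word_of T) = nth 0 (rowlens l).
Proof.
apply/funext => r; rewrite /content -{1}[word_of T]take_size size_word_of count_word_of //.
have -> : nth 0 (rowlens l) r = minn (nth 0 (rowlens l) r) (nth 0 (rowlens l) r) by rewrite minnn.
rewrite -card_row; apply: eq_card => x; rewrite !inE ltn_ord andbT.
case: eqP => //= <-; symmetry.
by have := valP x; rewrite mem_cells /row_of /col_of => /andP[].
Qed.

Lemma all_word_of T : all (gtn (sumn (heights l))) (word_of T).
Proof.
apply/(all_nthP 0) => k; rewrite size_word_of => kn /=.
by have [x xk] := SYT_surj T (Ordinal kn); have := nth_word_of T x; rewrite xk /= => ->; exact: row_of_lt.
Qed.

(** Moving each cell of row r + 1 with entry below the bound one step up is injective and lands on
    smaller entries of row r, because columns increase. So each prefix contains at least as many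
    letters r as r + 1 when both rows are in the same component. *)
Lemma word_of_in T : word_of T \in words (okb (heights l)) (sumn (heights l)) n (nth 0 (rowlens l)).
Proof.
rewrite -(content_word_of T) -{1}(size_word_of T); apply: mem_words; first exact: all_word_of.
move=> k; rewrite size_word_of => /andP[_ kn]; apply/okbP => r rm rE.
rewrite /content !count_word_of //.
have rlt : r < sumn (heights l) by exact: ltnW.
have oc := component_startcol rlt rm rE.
have up (x : cell l) : row_of x = r.+1 -> (r, col_of x) \in cells l.
  move=> xr; have := valP x; rewrite !mem_cells /= -/(row_of x) -/(col_of x) xr oc.
  by move/okbP: (okb_rowlens l) => /(_ r rm rE); lia.
(* The default [x] of [insubd] is never taken on cells of row r + 1, by [up]. *)
pose f (x : cell l) : cell l := insubd x (r, col_of x).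
have fE x : row_of x = r.+1 -> val (f x) = (r, col_of x).
  by move=> xr; rewrite val_insubd up.
have finj : {in [set x | (row_of x == r.+1) && (val T x < k)] &, injective f}.
  move=> x y; rewrite !inE => /andP[/eqP xr _] /andP[/eqP yr _] /(congr1 val).
  rewrite !fE // => -[cE]; apply: val_inj; apply: injective_projections => //.
  by rewrite -/(row_of x) -/(row_of y) xr yr.
rewrite -(card_in_imset finj); apply: subset_leq_card; apply/fintype.subsetP => _ /imsetP[x + ->].
rewrite !inE => /andP[/eqP xr xk]; rewrite /row_of fE //= eqxx /=.
apply: leq_ltn_trans xk; apply: ltnW; apply: SYT_col; rewrite /row_of /col_of fE //=.
by rewrite -/(row_of x) xr.
Qed.

(** In a row the smaller entries are exactly those to the left, so the word determines the column of
    each cell. Injectivity of [word_of] and the shape of its inverse come from this. *)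
Lemma count_before T x :
  count_mem (row_of x) (take (val T x) (word_of T)) = col_of x - startcol l (row_of x).
Proof.
have := valP x; rewrite mem_cells -/(row_of x) -/(col_of x) => /andP[c1 c2].
rewrite count_word_of; last exact: ltnW.
transitivity (minn (col_of x - startcol l (row_of x)) (nth 0 (rowlens l) (row_of x))); last lia.
rewrite -card_row subnKC //; apply: eq_card => y; rewrite !inE; case: eqP => //= yx.
have [lt|gt|e] := ltngtP (col_of y) (col_of x); first by apply: SYT_row.
  by apply/negbTE; rewrite -leqNgt ltnW //; apply: SYT_row.
have -> : y = x by apply: val_inj; apply: injective_projections.
by rewrite ltnn.
Qed.

Lemma word_of_inj : injective word_of.
Proof.
move=> T T' e; apply: val_inj; apply/ffunP => x; apply: val_inj => /=.
have c1 := count_before T x; have c2 := count_before T' x.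
have n1 := nth_word_of T x; have n2 := nth_word_of T' x.
rewrite -e in c2 n2.
have H (a b : nat) : a < b -> b < n -> nth 0 (word_of T) a = row_of x ->
    count_mem (row_of x) (take a (word_of T)) < count_mem (row_of x) (take b (word_of T)).
  move=> ab bn na; rewrite !count_take ?size_word_of; try lia.
  rewrite -!(big_mkord xpredT (fun i => nat_of_bool (nth 0 (word_of T) i == row_of x))).
  rewrite [X in _ < X](big_cat_nat (n := a.+1)) //= big_nat_recr //= na eqxx addn1.
  by rewrite addSn ltnS leq_addr.
have [lt|lt|//] := ltngtP (val T x) (val T' x).
  by have := H _ _ lt (ltn_ord _) n1; rewrite c1 c2 ltnn.
by have := H _ _ lt (ltn_ord _) n2; rewrite c1 c2 ltnn.
Qed.

Lemma maj_word_of T : maj T = majw (word_of T).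
Proof.
rewrite /maj /majw size_word_of -/n big_nat_cond [RHS]big_nat_cond; apply: eq_bigl => i.
case: (boolP (1 <= i < n)) => //= /andP[i1 i2].
have i3 : i.-1 < n by lia.
have [x xE] := SYT_surj T (Ordinal i3); have [y yE] := SYT_surj T (Ordinal i2).
have nx := nth_word_of T x; have ny := nth_word_of T y; rewrite xE yE /= in nx ny.
rewrite nx ny; apply/'exists_existsP/idP => [[x' [y' /and3P[/eqP ex /eqP ey lt]]]|lt].
  have -> : x = x' by apply: (@SYT_inj T); apply: val_inj; rewrite xE /=; move: ex; rewrite /entry => <-.
  suff -> : y = y' by [].
  by apply: (@SYT_inj T); apply: val_inj; rewrite yE /=; move: ey; rewrite /entry => -[].
by exists x, y; rewrite /entry xE yE /= prednK // !eqxx lt.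
Qed.

Lemma word_of_surj w :
  w \in words (okb (heights l)) (sumn (heights l)) n (nth 0 (rowlens l)) ->
  exists T, word_of T = w.
Proof.
move=> win.
have wn : weight (sumn (heights l)) (nth 0 (rowlens l)) = n.
  by rewrite /n -sumn_rowlens [RHS]sumnE [RHS](big_nth 0) [RHS]big_mkord size_rowlens.
have v0 r : sumn (heights l) <= r -> nth 0 (rowlens l) r = 0.
  by move=> h; rewrite nth_default // size_rowlens.
have [wm vE wok] := wordsP wn v0 win.
have sw := size_words win.
(* The inverse: the cell in place j of row r receives the position of the j-th letter r, counted
   from 0. *)
pose p (x : cell l) := nth 0 (positions w (row_of x)) (col_of x - startcol l (row_of x)).
have jx (x : cell l) : col_of x - startcol l (row_of x) < count_mem (row_of x) w.
  rewrite -/(content w (row_of x)) -vE.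
  by have := valP x; rewrite mem_cells -/(row_of x) -/(col_of x); lia.
have pin (x : cell l) : p x \in positions w (row_of x) by rewrite mem_nth // size_positions.
have pn (x : cell l) : p x < n by have := pin x; rewrite mem_positions sw => /andP[].
have pr (x : cell l) : nth 0 w (p x) = row_of x.
  by have := pin x; rewrite mem_positions => /andP[_ /eqP].
pose T : filling l := [ffun x => Ordinal (pn x)].
have TE x : T x = p x :> nat by rewrite ffunE.
have sc (x : cell l) : startcol l (row_of x) <= col_of x.
  by have := valP x; rewrite mem_cells => /andP[].
have pinj : injective T.
  move=> x y /(congr1 (@nat_of_ord _)); rewrite !TE => e.
  have re : row_of x = row_of y by rewrite -!pr e.
  move: e; rewrite /p re => /eqP; rewrite nth_uniq ?size_positions //.
  - move=> /eqP ce; apply: val_inj; apply: injective_projections => //.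
    by rewrite -/(col_of x) -/(col_of y); have := sc x; have := sc y; rewrite re; lia.
  - by rewrite -re.
  - by rewrite filter_uniq // iota_uniq.
have psurj (k : 'I_n) : exists x, T x = k.
  have r_lt : nth 0 w k < sumn (heights l) by apply: (allP wm); rewrite mem_nth // sw.
  have kin : (k : nat) \in positions w (nth 0 w k) by rewrite mem_positions sw ltn_ord eqxx.
  set r := nth 0 w k in r_lt kin.
  have rc : (r, index (k : nat) (positions w r) + startcol l r) \in cells l.
    rewrite mem_cells /= leq_addl addnC ltn_add2l vE /content -size_positions.
    by rewrite index_mem.
  exists (SeqSub rc); apply: ord_inj; rewrite TE /p /row_of /col_of /= addnK.
  by rewrite nth_index.
have std : standard T.
  apply/and4P; split; first exact/injectiveP.
  - by apply/forallP => k; apply/existsP; have [x <-] := psurj k; exists x.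
  - apply/'forall_forallP => x y; apply/implyP => /andP[/eqP re lt].
    rewrite /entry !TE ltnS /p re; apply: (sorted_ltn_nth ltn_trans) => //.
    + exact: sorted_positions.
    + by rewrite inE size_positions -re.
    + by rewrite inE size_positions.
    + by have := sc x; rewrite re; lia.
  apply/'forall_forallP => x y; apply/implyP => /andP[/eqP ce lt].
  rewrite /entry !TE ltnS.
  have ry := row_of_lt y.
  have comp : component (heights l) (row_of x) = component (heights l) (row_of y).
    apply: (@same_col_component _ _ _ (col_of x)).
      by rewrite /row_of /col_of -surjective_pairing; exact: valP.
    by rewrite ce /row_of /col_of -surjective_pairing; exact: valP.
  have oc := component_startcol (row_of_lt x) ry comp.
  have k1 : 0 < (p y).+1 <= size w by rewrite /= sw pn.
  (* The prefix ending at the position of the lower cell [y] contains more than j letters of its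
     row, where j is the common place of [x] and [y] in their rows. The test gives at least as many
     letters of the higher row, so the position of [x] already lies in this prefix. *)
  have le := okb_le (wok _ k1) (ltnW lt) ry comp.
  have lt2 : p x < (p y).+1.
    apply: nth_positions_lt; first by case/andP: k1.
    by apply: leq_trans le; rewrite ce oc; apply: ltn_count_positions.
  have ne : p x != p y by apply: contraL lt => /eqP e; rewrite -!pr e ltnn.
  by rewrite ltn_neqAle ne.
exists (exist _ T std).
apply: (@eq_from_nth _ 0); first by rewrite size_word_of sw.
move=> k; rewrite size_word_of => kn; have [x xk] := psurj (Ordinal kn).
have := nth_word_of (exist _ T std) x; rewrite /= xk /= => ->.
by rewrite -pr -TE xk.
Qed.

Lemma perm_word_of :
  perm_eq [seq word_of T | T <- enum {: SYT l}]
    (words (okb (heights l)) (sumn (heights l)) n (nth 0 (rowlens l))).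
Proof.
apply: uniq_perm; rewrite ?uniq_words ?(map_inj_uniq word_of_inj) ?enum_uniq //.
move=> w; apply/mapP/idP => [[T _ ->]|/word_of_surj[T <-]]; first exact: word_of_in.
by exists T => //; rewrite mem_enum.
Qed.

End TableauWord.

(** * The generating polynomial of maj *)

Section MajGeneratingFunction.
Local Open Scope ring_scope.
Variable R : numFieldType.

Definition majpoly (l : blockpart) : {poly R} := \sum_(T : SYT l) 'X^(maj T).

Definition block_hooks (l : blockpart) : seq nat := flatten [seq hooks (parts mu) | mu <- l].

Definition min_maj (l : blockpart) : nat :=
  (\sum_(mu <- l) \sum_(i < size mu) i * nth 0 (parts mu) i)%N.

Lemma majpoly_bracket (l : blockpart) :
  majpoly l * \prod_(h <- block_hooks l) bracket R h =
  'X^(min_maj l) * \prod_(k < bsize l) bracket R k.+1.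
Proof.
have := @words_bracket R _ (all_sorted_parts l).
rewrite -/(rowlens l) sumn_rowlens -/(heights l) -map_comp -/(block_hooks l) big_map.
rewrite -/(min_maj l) => <-; congr (_ * _).
rewrite -(perm_big _ (perm_word_of l)) big_map big_enum /=.
by apply: eq_bigr => T _; rewrite maj_word_of.
Qed.

End MajGeneratingFunction.

(** * Hook lengths compared with 1, ..., n *)

(* For a hook x - y of minimal length at least j, every z strictly between y and x
   gives a shorter hook z - y or x - z, hence one shorter than j. *)
Lemma count_hooks (mu : seq nat) j : sorted geq mu ->
  count (leq j) (hooks mu) <= (size (hooks mu)).+1 - j.
Proof.
move=> smu; pose bs := betas mu.
pose prs := [seq (x, y) | x <- bs, y <- [seq y <- iota 0 x | y \notin bs]].
have hE : hooks mu = [seq p.1 - p.2 | p <- prs] by rewrite map_allpairs.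
have uprs : uniq prs.
  apply: allpairs_uniq_dep; first exact: uniq_betas.
    by move=> x _; rewrite filter_uniq // iota_uniq.
  by move=> [x y] [x' y'] _ _ /= [-> ->].
have mprs x y : ((x, y) \in prs) = [&& x \in bs, y \notin bs & y < x].
  apply/allpairsPdep/and3P => [[x' [y' [x's + [-> ->]]]]|[xs ys yx]].
    by rewrite mem_filter mem_iota => /and3P[-> _].
  by exists x, y; rewrite mem_filter mem_iota ys xs.
have [/hasP[h hin jh]|] := boolP (has (leq j) (hooks mu)); last first.
  by rewrite has_count -leqNgt leqn0 => /eqP->.
have ex : exists d, (d \in hooks mu) && (j <= d) by exists h; rewrite hin.
have [d /andP[din jd] dmin] := find_ex_minn ex.
move: din; rewrite hE => /mapP[[x y] + dE]; rewrite mprs => /and3P[xs ys yx] /=.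
rewrite /= in dE.
have := count_predC (leq j) (hooks mu); rewrite hE size_map => cE.
(* With d >= j minimal, d - 1 shorter hooks leave at most n + 1 - d <= n + 1 - j hooks of length at
   least j. *)
suff : d.-1 <= count (predC (leq j)) (hooks mu) by rewrite hE; lia.
pose g z := if z \in bs then (z, y) else (x, z).
rewrite hE count_map -size_filter -(size_iota y.+1 d.-1) -(size_map g).
apply: uniq_leq_size.
  rewrite map_inj_in_uniq ?iota_uniq // => a b; rewrite !mem_iota /g => ha hb.
  by case: ifP => as_; case: ifP => bs_ // [] *; lia.
move=> _ /mapP[z + ->]; rewrite mem_iota => hz; rewrite mem_filter /= /g -ltnNge.
case: ifP => zs; rewrite /= mprs ?xs ?ys ?zs /=; apply/andP; split; try lia.
  rewrite ltnNge; apply/negP => jz; have := dmin (z - y).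
  rewrite jz hE andbT => /(_ (map_f (fun p => p.1 - p.2) (_ : (z, y) \in prs))).
  by rewrite mprs zs ys; lia.
rewrite ltnNge; apply/negP => jz; have := dmin (x - z).
rewrite jz hE andbT => /(_ (map_f (fun p => p.1 - p.2) (_ : (x, z) \in prs))).
by rewrite mprs xs zs; lia.
Qed.

Lemma count_flatten_hooks (L : seq (seq nat)) j : all (sorted geq) L -> 0 < j ->
  count (leq j) (flatten (map hooks L)) <= (sumn (flatten L)).+1 - j.
Proof.
move=> + j0; elim: L => [|mu L IH] /=; first by lia.
case/andP => smu /IH; rewrite count_cat sumn_cat.
by have := count_hooks j smu; rewrite size_hooks //; lia.
Qed.

(** The largest element is at most n and is paired with n. Removing it keeps the counting hypothesis
    for n - 1: the count drops by one for j up to this maximum and is 0 beyond it. *)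
Lemma sum_nondecreasing (R : numDomainType) (g : nat -> R) (n : nat) (H : seq nat) :
  size H = n -> (forall h, h \in H -> 0 < h) ->
  (forall j, 0 < j -> count (leq j) H <= n.+1 - j) ->
  (forall a b, 0 < a -> a <= b -> b <= n -> (g a <= g b)%R) ->
  (\sum_(h <- H) g h <= \sum_(k < n) g k.+1)%R.
Proof.
elim: n H => [|n IH] H sH Hpos cH gmono.
  by rewrite (size0nil sH) big_nil big_ord0.
have ex : exists h, h \in H by case: H sH {Hpos cH} => // h H _; exists h; rewrite mem_head.
have ub h : h \in H -> h <= n.+1.
  move=> hH; rewrite leqNgt; apply/negP => h_gt; have := cH _ (ltn0Sn n.+1).
  rewrite subnn leqn0 => /eqP c0; have : has (leq n.+2) H by apply/hasP; exists h.
  by rewrite has_count c0.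
have [h hH hmax] := ex_maxnP ex ub.
rewrite (perm_big _ (perm_to_rem hH)) big_cons big_ord_recr /= addrC lerD //.
  apply: IH.
  - by rewrite size_rem // sH.
  - by move=> i /mem_rem; exact: Hpos.
  - move=> j j0; have := cH j j0; rewrite (permP (perm_to_rem hH)) /=.
    case: (leqP j h) => jh; first by lia.
    suff -> : count (leq j) (rem h H) = 0 by lia.
    apply/eqP; rewrite -leqn0 leqNgt -has_count; apply/negP => /hasP[i /mem_rem iH ji].
    by have := hmax i iH; lia.
  - by move=> a b a0 ab bn; apply: gmono => //; exact: leqW.
by apply: gmono; [exact: Hpos|exact: ub|].
Qed.

(** * First and second power sums of hook lengths *)

Section HookSums.
Local Open Scope ring_scope.
Variable R : realFieldType.

Lemma sum_ord_lt m (E : nat -> nat -> R) :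
  \sum_(i < m) \sum_(j < m | (i < j)%N) E i j = \sum_(j < m) \sum_(i < j) E i j.
Proof.
rewrite (exchange_big_dep xpredT) //=; apply: eq_bigr => j _.
by rewrite -(big_ord_widen _ (fun i => E i j)) // ltnW.
Qed.

Lemma sum_diff_sq m (b : nat -> R) :
  \sum_(j < m) \sum_(i < j) (b i - b j) ^+ 2 =
  m%:R * (\sum_(i < m) b i ^+ 2) - (\sum_(i < m) b i) ^+ 2.
Proof.
elim: m => [|m IH]; first by rewrite !big_ord0; ring.
rewrite !big_ord_recr /= IH.
rewrite [\sum_(i < m) (b i - b m) ^+ 2](eq_bigr (fun i : 'I_m => b i ^+ 2 + (b i * (- 2 * b m) + b m ^+ 2))); last first.
  by move=> i _; ring.
rewrite !big_split /= sumr_const card_ord -mulr_suml -[in m.+1%:R]addn1 natrD -mulr_natl.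
ring.
Qed.

Lemma sum_diff m (b : nat -> R) :
  \sum_(j < m) \sum_(i < j) (b i - b j) = \sum_(i < m) (m%:R - 1 - 2 * i%:R) * b i.
Proof.
elim: m => [|m IH]; first by rewrite !big_ord0.
rewrite !big_ord_recr /= IH big_split /= sumrN sumr_const card_ord -mulr_natl.
rewrite addrA -big_split /= -[in m.+1%:R]addn1 natrD; congr (_ + _); last by ring.
by apply: eq_bigr => i _; ring.
Qed.

Lemma sum_succ n : \sum_(k < n) k.+1%:R = n%:R * (n%:R + 1) / 2 :> R.
Proof.
elim: n => [|n IH]; first by rewrite big_ord0 mul0r mul0r.
by rewrite big_ord_recr /= IH -addn1 natrD; field.
Qed.

Lemma sum_succ_sq n : \sum_(k < n) k.+1%:R ^+ 2 = n%:R * (n%:R + 1) * (2 * n%:R + 1) / 6 :> R.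
Proof.
elim: n => [|n IH]; first by rewrite big_ord0 !mul0r.
by rewrite big_ord_recr /= IH -addn1 natrD; field.
Qed.

Lemma sum_sq n : \sum_(k < n) k%:R ^+ 2 = n%:R * (n%:R - 1) * (2 * n%:R - 1) / 6 :> R.
Proof.
elim: n => [|n IH]; first by rewrite big_ord0 !mul0r.
by rewrite big_ord_recr /= IH -addn1 natrD; field.
Qed.

Definition content2 (mu : seq nat) : R :=
  \sum_(i < size mu) \sum_(c < nth 0%N mu i) (c%:R - i%:R) ^+ 2.

Lemma beta_natr (mu : seq nat) i : (i < size mu)%N ->
  (beta (size mu) (nth 0%N mu) i)%:R = (nth 0%N mu i)%:R + (size mu)%:R - 1 - i%:R :> R.
Proof.
move=> im; have -> : (beta (size mu) (nth 0 mu) i = nth 0 mu i + (size mu - i.+1))%N.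
  by rewrite /beta; lia.
by rewrite natrD natrB // -addn1 natrD; ring.
Qed.

Lemma natr_sumn (mu : seq nat) : (sumn mu)%:R = \sum_(i < size mu) (nth 0%N mu i)%:R :> R.
Proof. by rewrite sumnE (big_nth 0%N) big_mkord natr_sum. Qed.

Lemma sum_diff_beta (mu : seq nat) (G : R -> R) : sorted geq mu ->
  \sum_(i < size mu) \sum_(j < size mu | (i < j)%N)
     G (beta (size mu) (nth 0%N mu) i - beta (size mu) (nth 0%N mu) j)%:R =
  \sum_(j < size mu) \sum_(i < j)
     G ((nth 0%N mu i)%:R + (size mu)%:R - 1 - i%:R - ((nth 0%N mu j)%:R + (size mu)%:R - 1 - j%:R)).
Proof.
move=> smu; rewrite -(sum_ord_lt (size mu) (fun i j =>
  G ((nth 0%N mu i)%:R + (size mu)%:R - 1 - i%:R - ((nth 0%N mu j)%:R + (size mu)%:R - 1 - j%:R)))).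
apply: eq_bigr => i _; apply: eq_bigr => j ij.
by rewrite natrB ?beta_natr // ltnW // ltn_beta.
Qed.

(** By [big_hooks], squared hooks are the sums 1 + 4 + ... + b_i^2 minus the squared differences of
    beta numbers b_i. Both these and the squared contents are power sums of the b_i, since v_i - i =
    b_i + 1 - m, and the two expressions agree. *)
Lemma sum_hooks_sq (mu : seq nat) : sorted geq mu ->
  \sum_(h <- hooks mu) h%:R ^+ 2 = (sumn mu)%:R ^+ 2 + content2 mu.
Proof.
move=> smu; set m := size mu; pose v i : R := (nth 0%N mu i)%:R.
pose b i : R := v i + m%:R - 1 - i%:R.
have := @big_hooks _ _ [the Monoid.com_law 0 of +%R] (fun k => k%:R ^+ 2 : R) mu smu => /=.
rewrite (sum_diff_beta (fun x => x ^+ 2)) // -/m.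
rewrite [X in _ = X + _](sum_diff_sq m b).
rewrite [X in X = _](eq_bigr (fun i : 'I_m => b i * (b i + 1) * (2 * b i + 1) / 6)); last first.
  by move=> i _; rewrite sum_succ_sq beta_natr.
move=> /eqP; rewrite addrC -subr_eq => /eqP <-.
rewrite /content2 -/m natr_sumn -/m.
(* [Q] satisfies Q (x + 1) - Q x = x^2, so the squared contents of a row telescope. *)
pose Q (x : R) := x * (x - 1) * (2 * x - 1) / 6.
have -> : \sum_(i < m) \sum_(c < nth 0%N mu i) (c%:R - i%:R) ^+ 2 =
    \sum_(i < m) (Q (v i - i%:R) - Q (- i%:R)).
  apply: eq_bigr => i _; rewrite /v; elim: (nth _ _ _) => [|a IH]; first by rewrite big_ord0 sub0r subrr.
  by rewrite big_ord_recr /= IH -[a.+1%:R]natr1 /Q; field.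
have vb : \sum_(i < m) v i = \sum_(i < m) b i - m%:R * (m%:R - 1) / 2.
  have -> : m%:R * (m%:R - 1) / 2 = \sum_(i < m) (m%:R - 1 - i%:R) :> R.
    rewrite (reindex_inj rev_ord_inj) /=.
    transitivity (\sum_(i < m) (i%:R : R)).
      elim: m {b} => [|k IH]; first by rewrite big_ord0 !mul0r.
      by rewrite big_ord_recr /= -IH -[k.+1%:R]natr1; field.
    by apply: eq_bigr => i _; rewrite natrB // -addn1 natrD; ring.
  by rewrite -sumrB; apply: eq_bigr => i _; rewrite /b; ring.
rewrite [X in _ = X ^+ 2 + _]vb.
have QE : \sum_(i < m) Q (- i%:R) = m%:R ^+ 2 * (m%:R - 1) ^+ 2 / 4 + m%:R * Q (1 - m%:R).
  elim: m {b vb} => [|k IH]; first by rewrite big_ord0 /Q; field.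
  by rewrite big_ord_recr /= IH -[k.+1%:R]natr1 /Q; field.
rewrite [X in _ = _ + X]sumrB QE.
have -> : \sum_(i < m) Q (v i - i%:R) = \sum_(i < m) (b i * (b i + 1) * (2 * b i + 1) / 6
   + (b i ^+ 2 * (- m%:R) + (b i * (m%:R * (m%:R - 1)) + Q (1 - m%:R)))).
  by apply: eq_bigr => i _; rewrite /Q /b; field.
move: (Q (1 - m%:R)) => c; clearbody b.
by rewrite !big_split /= sumr_const card_ord -!mulr_suml -mulr_natl; field.
Qed.

(** The classical value n + b(mu) + b(mu'), the last sum being b of the conjugate partition read
    along rows. *)
Lemma sum_hooks (mu : seq nat) : sorted geq mu ->
  \sum_(h <- hooks mu) h%:R = (sumn mu)%:R + \sum_(i < size mu) i%:R * (nth 0%N mu i)%:R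
    + \sum_(i < size mu) (nth 0%N mu i)%:R * ((nth 0%N mu i)%:R - 1) / 2 :> R.
Proof.
move=> smu; set m := size mu; pose v i : R := (nth 0%N mu i)%:R.
pose b i : R := v i + m%:R - 1 - i%:R.
have := @big_hooks _ _ [the Monoid.com_law 0 of +%R] (fun k => k%:R : R) mu smu => /=.
rewrite (sum_diff_beta (fun x => x)) // -/m.
rewrite [X in _ = X + _](sum_diff m b).
rewrite [X in X = _](eq_bigr (fun i : 'I_m => b i * (b i + 1) / 2)); last first.
  by move=> i _; rewrite sum_succ beta_natr.
move=> /eqP; rewrite addrC -subr_eq => /eqP <-.
rewrite natr_sumn -/m -sumrB -!big_split /=.
(* This is what remains of the difference of the two sides once all terms containing row lengths
   have cancelled. *)
have Z : \sum_(i < m) ((m%:R - 1 - i%:R) * (1 - (m%:R - 1 - i%:R)) / 2 + i%:R * (m%:R - 1 - i%:R)) = 0 :> R.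
  have s1 : \sum_(i < m) (i%:R : R) = m%:R * (m%:R - 1) / 2.
    elim: m {b} => [|k IH]; first by rewrite big_ord0 !mul0r.
    by rewrite big_ord_recr /= IH -addn1 natrD; field.
  rewrite [LHS](eq_bigr (fun i : 'I_m => i%:R ^+ 2 * (- 3 / 2) + (i%:R * ((2 * m%:R - 3) / 2 + m%:R - 1) + (m%:R - 1) * (2 - m%:R) / 2))); last first.
    by move=> i _; field.
  by rewrite !big_split /= -!mulr_suml sumr_const card_ord sum_sq s1 -mulr_natl; field.
apply/eqP; rewrite -subr_eq0 -sumrB -[X in _ == X]Z; apply/eqP.
by apply: eq_bigr => i _; rewrite /b /v; field.
Qed.

End HookSums.

Lemma head_conjugate (mu : seq nat) : 0 \notin mu -> head 0 (conjugate mu) = size mu.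
Proof.
case: mu => // a mu; rewrite inE negb_or => /andP[a0 mu0].
rewrite /conjugate /=; case: a a0 => // a _ /=.
rewrite add1n; congr _.+1; apply/eqP; rewrite -all_count; apply/allP => x xmu.
by rewrite lt0n; apply: contraNneq mu0 => <-.
Qed.

Lemma sumn_map_predn (mu : seq nat) : 0 \notin mu -> sumn (map predn mu) = sumn mu - size mu.
Proof.
elim: mu => //= a mu IH; rewrite inE negb_or => /andP[a0 mu0].
have sz : size mu <= sumn mu.
  elim: mu mu0 {IH} => //= b mu IH; rewrite inE negb_or => /andP[b0 /IH]; lia.
by rewrite IH //; lia.
Qed.

Lemma sorted_map_predn (mu : seq nat) : sorted geq mu -> sorted geq (map predn mu).
Proof. by apply: homo_sorted => a b /=; lia. Qed.

Lemma bigmax_seq_eq (T : eqType) (s : seq T) (F : T -> nat) :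
  s = [::] \/ exists2 x, x \in s & \max_(y <- s) F y = F x.
Proof.
elim: s => [|a s IH]; [by left|right].
rewrite big_cons; case: IH => [->|[x xs ->]].
  by exists a; rewrite ?mem_head // big_nil maxn0.
by case: (leqP (F a) (F x)) => h; [exists x|exists a]; rewrite ?mem_head // inE xs orbT.
Qed.

(** * Upper bounds for sums of squared contents *)

Section ContentBounds.
Local Open Scope ring_scope.
Variable R : realFieldType.

(** Deleting the first row lowers the contents of the other cells by 1 as seen from the new corner,
    so an induction on rows needs a free shift. *)
Definition shifted_content2 (mu : seq nat) (s : R) : R :=
  \sum_(i < size mu) \sum_(c < nth 0%N mu i) (c%:R - i%:R - s) ^+ 2.

Lemma shifted_content2_cons a mu s :
  shifted_content2 (a :: mu) s = \sum_(c < a) (c%:R - s) ^+ 2 + shifted_content2 mu (s + 1).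
Proof.
rewrite /shifted_content2 /= big_ord_recl /=; congr (_ + _).
  by apply: eq_bigr => c _; rewrite subr0.
apply: eq_bigr => i _; apply: eq_bigr => c _.
by rewrite /bump leq0n add1n -[i.+1%:R]natr1; congr (_ ^+ 2); ring.
Qed.

(** The extreme case is a single column, whose shifted contents have absolute values s, s + 1, and
    so on. The first cell of the top row matches s, the remaining rows match the next terms by
    induction with shift s + 1, and the rest of the top row is dominated by the last terms. *)
Lemma shifted_content2_le mu s : sorted geq mu -> 0 <= s ->
  shifted_content2 mu s <= \sum_(k < sumn mu) (k%:R + s) ^+ 2.
Proof.
elim: mu s => [|a mu IH] s; first by rewrite /shifted_content2 !big_ord0.
move=> smu s0; rewrite shifted_content2_cons.
have smu' : sorted geq mu by apply: path_sorted smu.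
have {}IH := IH (s + 1) smu' (addr_ge0 s0 ler01).
case: a smu => [|a] smu.
  have mu0 : sumn mu = 0%N.
    apply/eqP; rewrite sumnE big_seq; apply/eqP; apply: big1 => i imu.
    apply/eqP; rewrite -leqn0; move: smu => /=.
    by rewrite path_sortedE => [/andP[/allP /(_ i imu)]|x y z /= yx zy]; [|apply: leq_trans zy yx].
  by rewrite big_ord0 add0r /= add0n mu0 big_ord0; move: IH; rewrite mu0 big_ord0.
rewrite /= addnC addnS !big_ord_recl big_split_ord /= !sub0r !add0r sqrrN -addrA lerD2l addrC.
apply: lerD.
  apply: le_trans IH _; rewrite le_eqVlt; apply/orP; left; apply/eqP; apply: eq_bigr => k _.
  by rewrite /bump leq0n add1n -[k.+1%:R]natr1; congr (_ ^+ 2); ring.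
apply: ler_sum => c _; rewrite /bump !leq0n !add1n -[c.+1%:R]natr1 -[(sumn mu + c).+1%:R]natr1 natrD.
have c0 : 0 <= c%:R :> R by []; have m0 : 0 <= (sumn mu)%:R :> R by [].
by nra.
Qed.

Lemma content2E mu : content2 R mu = shifted_content2 mu 0.
Proof. by apply: eq_bigr => i _; apply: eq_bigr => c _; rewrite subr0. Qed.

Lemma sum_succ_sq_add a b :
  \sum_(k < a) k.+1%:R ^+ 2 + \sum_(k < b) k.+1%:R ^+ 2 <= \sum_(k < a + b) k.+1%:R ^+ 2 :> R.
Proof.
rewrite big_split_ord /= lerD2l; apply: ler_sum => k _.
by rewrite lerXn2r ?nnegrE // ler_nat; lia.
Qed.

Lemma content2_le_sumn mu : sorted geq mu ->
  content2 R mu <= \sum_(k < sumn mu) k.+1%:R ^+ 2.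
Proof.
move=> smu; rewrite content2E; apply: le_trans (shifted_content2_le smu (lexx 0)) _.
by apply: ler_sum => k _; rewrite addr0 lerXn2r ?nnegrE // ler_nat.
Qed.

Lemma content2_row mu : sorted geq mu ->
  content2 R mu <= \sum_(k < head 0%N mu) k%:R ^+ 2 + \sum_(k < sumn mu - head 0%N mu) k.+1%:R ^+ 2.
Proof.
case: mu => [|a mu] smu; first by rewrite content2E /shifted_content2 !big_ord0 addr0.
rewrite content2E shifted_content2_cons /= addKn add0r; apply: lerD.
  by apply: ler_sum => c _; rewrite subr0.
apply: le_trans (shifted_content2_le (path_sorted smu) ler01) _.
by apply: ler_sum => k _; rewrite natr1.
Qed.

(** After deletion of the first column the shift is -1, outside the range of [shifted_content2_le].
    Splitting off the first row of what is left brings the shift back to 0. *)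
Lemma content2_col mu : sorted geq mu -> 0%N \notin mu ->
  content2 R mu <= \sum_(k < size mu) k%:R ^+ 2 + \sum_(k < sumn mu - size mu) k.+1%:R ^+ 2.
Proof.
move=> smu mu0.
have -> : content2 R mu = \sum_(k < size mu) k%:R ^+ 2 + shifted_content2 (map predn mu) (-1).
  rewrite /shifted_content2 size_map -big_split /=; apply: eq_bigr => i _.
  rewrite (nth_map 0%N) //; have : nth 0%N mu i != 0%N.
    by apply: contraNneq mu0 => <-; rewrite mem_nth.
  case: (nth _ _ _) => // a _; rewrite big_ord_recl /= sub0r sqrrN; congr (_ + _).
  by apply: eq_bigr => c _; rewrite /bump leq0n add1n -[c.+1%:R]natr1; congr (_ ^+ 2); ring.
rewrite lerD2l -sumn_map_predn //.
case: mu smu {mu0} => [|a mu] smu; first by rewrite /shifted_content2 !big_ord0.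
rewrite /= shifted_content2_cons addNr; apply: le_trans (sum_succ_sq_add _ _).
apply: lerD; first by apply: ler_sum => c _; rewrite opprK natr1.
rewrite -content2E; apply: content2_le_sumn; apply: sorted_map_predn; exact: path_sorted smu.
Qed.

Lemma content2_le mu w : sorted geq mu -> (head 0%N mu <= w)%N -> (size mu <= w)%N ->
  content2 R mu <= (sumn mu)%:R * w%:R ^+ 2.
Proof.
move=> smu hw sw; rewrite natr_sumn mulr_suml; apply: ler_sum => i _.
have -> : (nth 0%N mu i)%:R * w%:R ^+ 2 = \sum_(c < nth 0%N mu i) w%:R ^+ 2 :> R.
  by rewrite sumr_const card_ord mulr_natl.
apply: ler_sum => c _.
have iw : (i%:R <= w%:R :> R) by rewrite ler_nat; have := ltn_ord i; lia.
have cw : (c%:R <= w%:R :> R).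
  have := sorted_geq_nth smu (leq0n i); rewrite nth0; have := ltn_ord c.
  by rewrite ler_nat; lia.
have c0 : 0 <= c%:R :> R by []; have i0 : 0 <= i%:R :> R by [].
by nra.
Qed.

Lemma sum_content2_le (L : seq (seq nat)) : all (sorted geq) L ->
  \sum_(mu <- L) content2 R mu <= \sum_(k < sumn (flatten L)) k.+1%:R ^+ 2.
Proof.
elim: L => [|mu L IH] /=; first by rewrite big_nil big_ord0.
case/andP => smu sL; rewrite big_cons sumn_cat; apply: le_trans (sum_succ_sq_add _ _).
by apply: lerD; [exact: content2_le_sumn|exact: IH].
Qed.

Lemma sum_content2_max (L : seq (seq nat)) mu m : all (sorted geq) L -> mu \in L ->
  0%N \notin mu -> (m == head 0%N mu) || (m == size mu) ->
  \sum_(nu <- L) content2 R nu <=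
    \sum_(k < m) k%:R ^+ 2 + \sum_(k < sumn (flatten L) - m) k.+1%:R ^+ 2.
Proof.
move=> sL muL mu0 hm; have smu := allP sL _ muL.
have cm : content2 R mu <= \sum_(k < m) k%:R ^+ 2 + \sum_(k < sumn mu - m) k.+1%:R ^+ 2.
  by case/orP: hm => /eqP->; [exact: content2_row|exact: content2_col].
have mmu : (m <= sumn mu)%N.
  case/orP: hm => /eqP->; first by case: (mu) => //= a s; exact: leq_addr.
  elim: (mu) mu0 => //= b s IH; rewrite inE negb_or => /andP[b0 /IH]; lia.
have pL := perm_to_rem muL.
rewrite (perm_big _ pL) big_cons.
have -> : (sumn (flatten L) - m = (sumn mu - m) + sumn (flatten (rem mu L)))%N.
  have -> : sumn (flatten L) = sumn (flatten (mu :: rem mu L)).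
    by rewrite !sumn_flatten; apply: perm_sumn; apply: perm_map.
  by rewrite /= sumn_cat; lia.
apply: le_trans (lerD cm (sum_content2_le _)) _.
  by apply/allP => nu /mem_rem; exact: (allP sL).
by rewrite -addrA lerD2l; exact: sum_succ_sq_add.
Qed.

End ContentBounds.

Definition longest (l : blockpart) : nat := \max_(mu <- l) maxn (head 0 mu) (head 0 (conjugate mu)).

Lemma notin_parts (mu : intpart) : 0 \notin parts mu.
Proof. by case: mu => s /= /andP[]. Qed.

Lemma notin_all_parts (l : blockpart) mu : mu \in [seq parts x | x <- l] -> 0 \notin mu.
Proof.
elim: l => //= nu l IH; rewrite inE => /orP[/eqP->|]; [exact: notin_parts|exact: IH].
Qed.

Lemma longestE (l : blockpart) :
  longest l = \max_(mu <- [seq parts x | x <- l]) maxn (head 0 mu) (size mu).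
Proof. by rewrite big_map; apply: eq_bigr => mu _; rewrite head_conjugate // notin_parts. Qed.

Lemma longest_bound (l : blockpart) mu : mu \in [seq parts x | x <- l] ->
  head 0 mu <= longest l /\ size mu <= longest l.
Proof.
rewrite longestE => mul; have := @leq_bigmax_seq _ _ xpredT (fun mu => maxn (head 0 mu) (size mu)) _ mul isT.
by rewrite geq_max => /andP[].
Qed.

Lemma longest_attained (l : blockpart) : longest l = 0 \/
  exists2 mu, mu \in [seq parts x | x <- l] & (longest l == head 0 mu) || (longest l == size mu).
Proof.
rewrite longestE.
have [->|[mu mul ->]] := bigmax_seq_eq [seq parts x | x <- l] (fun mu => maxn (head 0 mu) (size mu)).
  by left; rewrite big_nil.
by right; exists mu => //; case: (leqP (head 0 mu) (size mu)) => _; rewrite eqxx ?orbT.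
Qed.

Lemma longest_le (l : blockpart) : longest l <= bsize l.
Proof.
have [->//|[mu mul h]] := longest_attained l.
have : longest l <= sumn mu.
  case/orP: h => /eqP->; first by case: (mu) => //= a s; exact: leq_addr.
  have := notin_all_parts mul; elim: (mu) => //= b s IH; rewrite inE negb_or => /andP[b0 /IH]; lia.
move/leq_trans; apply; rewrite -sumn_rowlens /rowlens.
have /permP := perm_to_rem mul; rewrite !sumn_flatten => _.
by rewrite (perm_sumn (perm_map _ (perm_to_rem mul))) /= leq_addr.
Qed.

(** * Comparison of the hooks of a block partition with 1, ..., n *)

Section HookGaps.
Local Open Scope ring_scope.
Variables (R : realFieldType) (l : blockpart).
Local Notation n := (bsize l).
Local Notation H := (block_hooks l).
Let L := [seq parts mu | mu <- l].

Let HE : H = flatten (map hooks L).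
Proof. by rewrite /block_hooks /L -map_comp. Qed.

Lemma block_hooks_gt0 h : h \in H -> (0 < h)%N.
Proof. by rewrite HE => /flatten_mapP[mu _]; exact: hooks_gt0. Qed.

Lemma size_block_hooks : size H = n.
Proof.
rewrite HE -sumn_rowlens /rowlens -/L size_flatten /shape sumn_flatten -map_comp; congr sumn.
by apply/eq_in_map => mu mul /=; rewrite size_hooks // (allP (all_sorted_parts l)).
Qed.

Lemma count_block_hooks j : (0 < j)%N -> (count (leq j) H <= n.+1 - j)%N.
Proof.
move=> j0; rewrite HE -sumn_rowlens /rowlens -/L.
by apply: count_flatten_hooks j0; exact: all_sorted_parts.
Qed.

Lemma sum_block_hooks_le (g : nat -> R) :
  (forall a b, (0 < a)%N -> (a <= b)%N -> (b <= n)%N -> g a <= g b) ->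
  \sum_(h <- H) g h <= \sum_(k < n) g k.+1.
Proof.
move=> gm; apply: sum_nondecreasing gm; first exact: size_block_hooks.
  exact: block_hooks_gt0.
exact: count_block_hooks.
Qed.

Definition gap2 : R := \sum_(k < n) k.+1%:R ^+ 2 - \sum_(h <- H) h%:R ^+ 2.
Definition gap1 : R := \sum_(k < n) k.+1%:R - \sum_(h <- H) h%:R.

Let sum2E : \sum_(h <- H) h%:R ^+ 2 =
  \sum_(mu <- L) (sumn mu)%:R ^+ 2 + \sum_(mu <- L) content2 R mu.
Proof.
rewrite HE big_flatten big_map /= -big_split /= big_seq [RHS]big_seq.
by apply: eq_bigr => mu mul; rewrite sum_hooks_sq // (allP (all_sorted_parts l)).
Qed.

Let sum_sumn_sq : \sum_(mu <- L) (sumn mu)%:R ^+ 2 <= n%:R ^+ 2 :> R.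
Proof.
have -> : n = (\sum_(mu <- L) sumn mu)%N by rewrite big_map.
rewrite natr_sum; elim: L => [|mu s IH]; first by rewrite !big_nil expr0n.
rewrite !big_cons sqrrD -addrA lerD2l; apply: le_trans IH _.
by rewrite lerDr mulrn_wge0 // mulr_ge0 // -natr_sum.
Qed.

(** Let m be the longest row or column. If 2m >= n, the bound through this row or column gives a gap
    of at least n (n - m) (m - 1), and 24 (m - 1) >= n. If 2m < n, contents are at most m in
    absolute value, so the squared hooks sum to at most n^2 + n^3 / 4; then 24 times the gap is at
    least 2 n^3 - 12 n^2, and n >= 12 makes this at least n^3. *)
Lemma gap2_ge : (12 <= n)%N -> n%:R ^+ 2 * (aft l)%:R <= 24 * gap2.
Proof.
move=> n12; rewrite /gap2 sum2E /aft -/(longest l); set m := longest l.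
have mn : (m <= n)%N := longest_le l.
have n12' : 12 <= n%:R :> R by rewrite (ler_nat R 12).
rewrite natrB // sum_succ_sq.
have [h|h] := leqP n (2 * m).
  have [m0|[mu mul hm]] := longest_attained l; first by rewrite -/m in m0; lia.
  have := @sum_content2_max R L mu m (all_sorted_parts l) mul (notin_all_parts mul) hm.
  have -> : sumn (flatten L) = n by rewrite -sumn_rowlens.
  rewrite sum_sq sum_succ_sq natrB // => hC.
  have := lerD sum_sumn_sq hC.
  set S := _ + \sum_(mu <- L) content2 R mu; move: S => S hS.
  have h' : n%:R <= 2 * m%:R :> R by rewrite -(natrM _ 2) ler_nat.
  have m' : m%:R <= n%:R :> R by rewrite ler_nat.
  move: (n%:R : R) (m%:R : R) n12' h' m' hS => x y x12 xy yx hS.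
  have key : x * (x + 1) * (2 * x + 1) / 6 -
    (x ^+ 2 + (y * (y - 1) * (2 * y - 1) / 6 + (x - y) * (x - y + 1) * (2 * (x - y) + 1) / 6))
    = (x - y) * x * (y - 1) by field.
  have k2 : (x - y) * x * (y - 1) <= x * (x + 1) * (2 * x + 1) / 6 - S by rewrite -key lerD2l lerN2.
  apply: le_trans (_ : 24 * ((x - y) * x * (y - 1)) <= _); last by rewrite ler_pM2l.
  have : 0 <= (x - y) * x * (24 * (y - 1) - x) by rewrite !mulr_ge0 //; lra.
  move=> h0; rewrite -subr_ge0; apply: le_trans h0 _; rewrite le_eqVlt; apply/orP; left; apply/eqP; ring.
have hC : \sum_(mu <- L) content2 R mu <= n%:R * m%:R ^+ 2.
  have -> : n = (\sum_(mu <- L) sumn mu)%N by rewrite big_map.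
  rewrite natr_sum mulr_suml big_seq [leRHS]big_seq; apply: ler_sum => mu mul.
  have [h1 h2] := longest_bound mul.
  by apply: content2_le => //; exact: (allP (all_sorted_parts l)).
have := lerD sum_sumn_sq hC.
set S := _ + \sum_(mu <- L) content2 R mu; move: S => S hS.
have h' : 2 * m%:R <= n%:R :> R by rewrite -(natrM _ 2) ler_nat ltnW.
have m' : 0 <= m%:R :> R by [].
move: (n%:R : R) (m%:R : R) n12' h' m' hS => x y x12 xy y0 hS.
have hy : x * y ^+ 2 * 4 <= x * x ^+ 2.
  rewrite -mulrA ler_pM2l; last lra.
  by rewrite -subr_ge0 (_ : _ - _ = (x - 2 * y) * (x + 2 * y)); [rewrite mulr_ge0 //; lra|ring].
have hS' : 24 * S <= 24 * x ^+ 2 + 6 * (x * x ^+ 2) by lra.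
have e1 : x ^+ 2 * (x - y) <= x * x ^+ 2.
  by have := mulr_ge0 (sqr_ge0 x) y0; lra.
have e2 : 24 * (x * (x + 1) * (2 * x + 1) / 6) = 8 * (x * x ^+ 2) + 12 * x ^+ 2 + 4 * x by field.
have e3 : 12 * x ^+ 2 <= x * x ^+ 2 by rewrite ler_pM2r // exprn_gt0 //; lra.
by rewrite [leRHS]mulrBr e2; lra.
Qed.

Lemma gap1_le : gap1 <= (aft l * n)%:R.
Proof.
rewrite /gap1 sum_succ natrM /aft -/(longest l); set m := longest l.
have mn : (m <= n)%N := longest_le l.
rewrite natrB //.
(* Only the component with the longest row or column is kept, and in its hook sum only the terms
   coming from that row or column. *)
have hS : m%:R * (m%:R + 1) / 2 <= \sum_(h <- H) h%:R :> R.
  have [m0|[mu mul hm]] := longest_attained l.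
    by rewrite /m m0 !mul0r; apply: sumr_ge0.
  rewrite HE big_flatten big_map /= (perm_big _ (perm_to_rem mul)) big_cons.
  rewrite -[leLHS]addr0; apply: lerD; last by apply: sumr_ge0 => nu _; apply: sumr_ge0.
  have smu := allP (all_sorted_parts l) _ mul.
  rewrite sum_hooks //.
  have p0 i : 0 <= (nth 0%N mu i)%:R * ((nth 0%N mu i)%:R - 1) / 2 :> R.
    case: (nth _ _ _) => [|a]; first by rewrite !mul0r.
    by rewrite -[a.+1%:R]natr1 addrK; have := sqr_ge0 (a%:R : R); have := ler0n R a; lra.
  rewrite /m; case/orP: hm => /eqP->.
    case: (mu) smu p0 => [|a nu] smu p0.
      by rewrite /= !big_ord0 !mul0r !addr0.
    rewrite /= !big_ord_recl /= mul0r add0r natrD.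
    set A := \sum_(i < _) _; set B := \sum_(i < _) _.
    have A0 : 0 <= A by apply: sumr_ge0 => i _; exact: mulr_ge0.
    have B0 : 0 <= B by apply: sumr_ge0 => i _; exact: (p0 i.+1).
    have C0 : 0 <= (sumn nu)%:R :> R by [].
    by lra.
  rewrite -[leLHS]addr0; apply: lerD; last by apply: sumr_ge0 => i _; exact: p0.
  rewrite -sum_succ natr_sumn -big_split /=; apply: ler_sum => i _.
  have : nth 0%N mu i != 0%N.
    by apply: contraNneq (notin_all_parts mul) => <-; rewrite mem_nth.
  case: (nth _ _ _) => // a _; rewrite -[a.+1%:R]natr1 -[i.+1%:R]natr1 mulrDr mulr1.
  by have := mulr_ge0 (ler0n R i) (ler0n R a); have := ler0n R a; lra.
(* The remaining inequality is (n - m) (n - m - 1) >= 0, which uses that n - m is an integer: it is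
   0 or at least 1. *)
have [e|mlt] := eqVneq m n; first by rewrite e subrr mul0r -e; lra.
have m1 : m%:R + 1 <= n%:R :> R by rewrite natr1 ler_nat ltn_neqAle mlt.
move: hS m1 (ler0n R m); set S := \sum_(h <- H) _; move: S (m%:R : R) (n%:R : R) => S y x hS m1 y0.
have : 0 <= (x - y) * (x - y - 1) by rewrite mulr_ge0 //; lra.
by rewrite (_ : _ * _ = 2 * ((x - y) * x) - (x * (x + 1) - y * (y + 1))); [lra|ring].
Qed.

End HookGaps.

(** * Mean, variance and cosine transform *)

Local Open Scope ring_scope.

Section Cumulants.
Variable R : realFieldType.
Implicit Types p q : {poly R}.

(* Mean and variance of the law with generating polynomial [p]. *)
Definition kappa1 p : R := p^`().[1] / p.[1].
Definition kappa2 p : R := p^`()^`().[1] / p.[1] + kappa1 p - kappa1 p ^+ 2.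

Lemma kappa1M p q : p.[1] != 0 -> q.[1] != 0 -> kappa1 (p * q) = kappa1 p + kappa1 q.
Proof. by move=> p1 q1; rewrite /kappa1 derivM !(hornerM, hornerD); field; rewrite p1 q1. Qed.

Lemma kappa2M p q : p.[1] != 0 -> q.[1] != 0 -> kappa2 (p * q) = kappa2 p + kappa2 q.
Proof.
move=> p1 q1; rewrite /kappa2 kappa1M // /kappa1 !(derivM, derivD) !(hornerM, hornerD).
by field; rewrite p1 q1.
Qed.

Lemma kappa_prod (I : eqType) (r : seq I) (F : I -> {poly R}) :
  (forall i, i \in r -> (F i).[1] != 0) ->
  [/\ (\prod_(i <- r) F i).[1] != 0, kappa1 (\prod_(i <- r) F i) = \sum_(i <- r) kappa1 (F i)
    & kappa2 (\prod_(i <- r) F i) = \sum_(i <- r) kappa2 (F i)].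
Proof.
elim: r => [_|i r IH Fr].
  by rewrite !big_nil /kappa2 /kappa1 -polyC1 derivC deriv0 horner0 hornerC oner_neq0 !mul0r; split=> //; ring.
have [|r0 k1 k2] := IH; first by move=> j jr; apply: Fr; rewrite inE jr orbT.
have i0 : (F i).[1] != 0 by apply: Fr; rewrite mem_head.
by rewrite !big_cons hornerM mulf_neq0 // kappa1M // kappa2M // k1 k2.
Qed.

Section PowerSum.
Variables (I : finType) (m : I -> nat).
Let p : {poly R} := \sum_(i : I) 'X^(m i).

Lemma powersum1 : p.[1] = #|I|%:R.
Proof.
rewrite horner_sum (eq_bigr (fun=> 1)) ?sumr_const //.
by move=> i _; rewrite hornerXn expr1n.
Qed.

Lemma kappa1_powersum : kappa1 p = (\sum_i (m i)%:R) / #|I|%:R.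
Proof.
rewrite /kappa1 powersum1; congr (_ / _); rewrite raddf_sum /= horner_sum.
by apply: eq_bigr => i _; rewrite derivXn hornerMn hornerXn expr1n.
Qed.

Lemma kappa2_powersum : kappa2 p = (\sum_i (m i)%:R ^+ 2) / #|I|%:R - kappa1 p ^+ 2.
Proof.
rewrite /kappa2; congr (_ - _); rewrite kappa1_powersum powersum1 -mulrDl; congr (_ / _).
rewrite raddf_sum /= raddf_sum /= horner_sum -big_split /=; apply: eq_bigr => i _.
rewrite derivXn derivMn derivXn !hornerMn hornerXn expr1n.
case: (m i) => [|k] /=; first by rewrite mulr0n expr0n add0r.
by rewrite -mulr_natr -[k.+1%:R]natr1; ring.
Qed.

End PowerSum.

Lemma horner1_bracket k : (bracket R k).[1] = k%:R.
Proof. by rewrite /bracket (powersum1 (fun j : 'I_k => j : nat)) card_ord. Qed.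

Lemma horner1_bracket_neq0 k : (0 < k)%N -> (bracket R k).[1] != 0.
Proof. by rewrite horner1_bracket pnatr_eq0 lt0n. Qed.

Lemma sum_ordr k : \sum_(j < k) j%:R = k%:R * (k%:R - 1) / 2 :> R.
Proof.
elim: k => [|k IH]; first by rewrite big_ord0 !mul0r.
by rewrite big_ord_recr /= IH -[k.+1%:R]natr1; field.
Qed.

Lemma kappa1_bracket k : (0 < k)%N -> kappa1 (bracket R k) = (k%:R - 1) / 2.
Proof.
move=> k0; have k0' : k%:R != 0 :> R by rewrite pnatr_eq0 -lt0n.
rewrite /bracket (kappa1_powersum (fun j : 'I_k => j : nat)) card_ord sum_ordr.
by field.
Qed.

Lemma kappa2_bracket k : (0 < k)%N -> kappa2 (bracket R k) = (k%:R ^+ 2 - 1) / 12.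
Proof.
move=> k0; have k0' : k%:R != 0 :> R by rewrite pnatr_eq0 -lt0n.
have := kappa1_bracket k0; rewrite /bracket (kappa2_powersum (fun j : 'I_k => j : nat)) => ->.
by rewrite card_ord sum_sq; field.
Qed.

Lemma kappa_Xn b : ('X^b : {poly R}).[1] != 0 /\ kappa1 'X^b = b%:R /\ kappa2 'X^b = 0.
Proof.
have -> : 'X^b = \sum_(i : 'I_1) 'X^b :> {poly R} by rewrite big_ord_recl big_ord0 addr0.
have k1 := kappa1_powersum (fun=> b : nat) : kappa1 (\sum_(i : 'I_1) 'X^b) = _.
have k2 := kappa2_powersum (fun=> b : nat) : kappa2 (\sum_(i : 'I_1) 'X^b) = _.
rewrite (powersum1 (fun=> b)) k2 k1 card_ord !big_ord_recl !big_ord0 oner_neq0; split=> //.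
by split; field.
Qed.

Variable l : blockpart.
Local Notation n := (bsize l).
Local Notation H := (block_hooks l).
Local Notation P := (majpoly R l).

Lemma majpoly1_neq0 : P.[1] != 0.
Proof. by rewrite powersum1 pnatr_eq0 -lt0n; apply/card_gt0P; exists (SYT_point l). Qed.

Let hooks1 : forall h, h \in H -> (bracket R h).[1] != 0.
Proof. by move=> h /block_hooks_gt0; exact: horner1_bracket_neq0. Qed.

Let top1 : forall k : 'I_n, k \in index_enum 'I_n -> (bracket R k.+1).[1] != 0.
Proof. by move=> k _; exact: horner1_bracket_neq0. Qed.

Lemma sum_hooks_sub (g : nat -> R) (c : R) :
  \sum_(h <- H) (g h - c) = \sum_(h <- H) g h - n%:R * c.
Proof. by rewrite sumrB big_const_seq count_predT iter_addr_0 size_block_hooks mulr_natl. Qed.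

Lemma kappa1_majpoly : kappa1 P = (min_maj l)%:R + gap1 R l / 2.
Proof.
have [h1 hk1 _] := kappa_prod hooks1; have [t1 tk1 _] := kappa_prod top1.
have [x1 [xk1 _]] := kappa_Xn (min_maj l).
have := congr1 kappa1 (majpoly_bracket R l).
rewrite kappa1M ?majpoly1_neq0 // kappa1M // hk1 tk1 xk1 => e.
apply: (addIr (\sum_(i <- H) kappa1 (bracket R i))); rewrite e -addrA; congr (_ + _).
have -> : \sum_(h <- H) kappa1 (bracket R h) = \sum_(h <- H) (h%:R - 1) / 2.
  by apply: eq_big_seq => h /block_hooks_gt0; exact: kappa1_bracket.
have -> : \sum_(k < n) kappa1 (bracket R k.+1) = \sum_(k < n) (k.+1%:R - 1) / 2.
  by apply: eq_bigr => k _; rewrite kappa1_bracket.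
by rewrite -!mulr_suml sum_hooks_sub sumrB sumr_const card_ord /gap1 -mulr_natl; field.
Qed.

Lemma kappa2_majpoly : kappa2 P = gap2 R l / 12.
Proof.
have [h1 _ hk2] := kappa_prod hooks1; have [t1 _ tk2] := kappa_prod top1.
have [x1 [_ xk2]] := kappa_Xn (min_maj l).
have := congr1 kappa2 (majpoly_bracket R l).
rewrite kappa2M ?majpoly1_neq0 // kappa2M // hk2 tk2 xk2 add0r => e.
apply: (addIr (\sum_(i <- H) kappa2 (bracket R i))); rewrite e.
have -> : \sum_(h <- H) kappa2 (bracket R h) = \sum_(h <- H) (h%:R ^+ 2 - 1) / 12.
  by apply: eq_big_seq => h /block_hooks_gt0; exact: kappa2_bracket.
have -> : \sum_(k < n) kappa2 (bracket R k.+1) = \sum_(k < n) (k.+1%:R ^+ 2 - 1) / 12.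
  by apply: eq_bigr => k _; rewrite kappa2_bracket.
rewrite -!mulr_suml (sum_hooks_sub (fun h => h%:R ^+ 2)) sumrB sumr_const card_ord /gap2.
by rewrite -mulr_natl; field.
Qed.

(** Stanley's formula at q = 1, that is, the hook length formula. It later supplies the
    normalization by the number of tableaux. *)
Lemma majpoly1 : #|{: SYT l}|%:R * \prod_(h <- H) h%:R = \prod_(k < n) k.+1%:R :> R.
Proof.
have := congr1 (fun p => p.[1]) (majpoly_bracket R l).
rewrite /= !hornerM powersum1 hornerXn expr1n mul1r !horner_prod.
under eq_bigr do rewrite horner1_bracket.
by move=> ->; apply: eq_bigr => k _; rewrite horner1_bracket.
Qed.

Lemma size_bracket k : size (bracket R k) = k.
Proof.
have -> : bracket R k = \poly_(i < k) 1.
  by rewrite poly_def; apply: eq_bigr => i _; rewrite scale1r.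
case: k => [|k]; first by rewrite poly_def big_ord0 size_poly0.
by rewrite (@size_poly_eq _ _ (fun=> 1)) ?oner_neq0.
Qed.

Lemma size_prod_bracket (I : eqType) (r : seq I) (m : I -> nat) :
  (forall i, i \in r -> (0 < m i)%N) ->
  (\prod_(i <- r) bracket R (m i) != 0) /\
  (size (\prod_(i <- r) bracket R (m i)))%:R = 1 + \sum_(i <- r) ((m i)%:R - 1) :> R.
Proof.
elim: r => [_|i r IH mr]; first by rewrite !big_nil size_poly1 addr0 oner_neq0.
have [|r0 sr] := IH; first by move=> j jr; apply: mr; rewrite inE jr orbT.
have m0 : (0 < m i)%N by apply: mr; rewrite mem_head.
have b0 : bracket R (m i) != 0 by rewrite -size_poly_gt0 size_bracket.
rewrite !big_cons mulf_neq0 //; split=> //.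
rewrite size_mul // size_bracket -subn1 natrB; last by rewrite addn_gt0 m0.
by rewrite natrD sr; ring.
Qed.

(** The bound is the degree of the generating polynomial, read off Stanley's formula. Since its
    coefficients are counts, no monomial 'X^(maj T) cancels. *)
Lemma maj_le (T : SYT l) : (maj T)%:R <= (min_maj l)%:R + gap1 R l.
Proof.
have P0 : P != 0 by apply: contraNneq majpoly1_neq0 => ->; rewrite horner0.
have hp : forall h, h \in H -> (0 < h)%N by exact: block_hooks_gt0.
have [h0 hs] := size_prod_bracket hp.
have tp (k : 'I_n) : k \in index_enum 'I_n -> (0 < k.+1)%N by [].
have [t0 ts] := size_prod_bracket tp.
have := congr1 (fun p => (size p)%:R : R) (majpoly_bracket R l).
rewrite size_mul // size_mul ?expf_neq0 ?polyX_eq0 // size_polyXn addSn /= -subn1 natrB; last first.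
  by rewrite addn_gt0 size_poly_gt0 P0.
rewrite !natrD hs ts (sum_hooks_sub (fun h => h%:R)) sumrB sumr_const card_ord -mulr_natl => e.
have mT : (maj T < size P)%N.
  rewrite ltnNge; apply/negP => /(nth_default 0); apply/eqP.
  rewrite coef_sum (bigD1 T) //= coefXn eqxx gt_eqF // ltr_pwDl //.
  by apply: sumr_ge0 => T' _; rewrite coefXn.
have : (maj T)%:R + 1 <= (size P)%:R :> R by rewrite natr1 ler_nat.
by rewrite /gap1; lra.
Qed.

End Cumulants.

(** * The cosine transform of maj *)

Section CosineTransform.
Variable R : realType.
Variable phi : R.

(* The real part of [exp (i a) * p (exp (2 i phi))]. *)
Definition costr (p : {poly R}) (a : R) : R := \sum_(j < size p) p`_j * cos (2 * j%:R * phi + a).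

Lemma costr_wide N (p : {poly R}) a : (size p <= N)%N ->
  costr p a = \sum_(j < N) p`_j * cos (2 * j%:R * phi + a).
Proof.
move=> pN; rewrite /costr (big_ord_widen N (fun j => p`_j * cos (2 * j%:R * phi + a))) //.
rewrite big_mkcond /=; apply: eq_bigr => j _; case: ltnP => // h.
by rewrite nth_default // mul0r.
Qed.

Lemma costr_sum (I : Type) (r : seq I) (F : I -> {poly R}) a :
  costr (\sum_(i <- r) F i) a = \sum_(i <- r) costr (F i) a.
Proof.
elim: r => [|i r IH]; first by rewrite !big_nil /costr size_poly0 big_ord0.
rewrite !big_cons -IH; set p := F i; set q := \sum_(j <- r) F j.
pose N := maxn (size p) (size q).
rewrite (@costr_wide N (p + q)) ?size_polyD // (@costr_wide N p) ?leq_maxl // (@costr_wide N q) ?leq_maxr //.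
by rewrite -big_split /=; apply: eq_bigr => j _; rewrite coefD mulrDl.
Qed.

Lemma costrMXn p b a : costr (p * 'X^b) a = costr p (2 * b%:R * phi + a).
Proof.
rewrite (@costr_wide (b + size p)); last first.
  by apply: leq_trans (size_polyMleq _ _) _; rewrite size_polyXn; lia.
rewrite big_split_ord /= big1 ?add0r; last first.
  by move=> j _; rewrite coefMXn ltn_ord mul0r.
apply: eq_bigr => j _; rewrite coefMXn ltnNge leq_addr /= addKn natrD; congr (_ * cos _); ring.
Qed.

Lemma costr_powersum (I : finType) (m : I -> nat) a :
  costr (\sum_(i : I) 'X^(m i)) a = \sum_i cos (2 * (m i)%:R * phi + a).
Proof.
rewrite costr_sum; apply: eq_bigr => i _; rewrite -[X in costr X]mul1r costrMXn.
by rewrite /costr size_poly1 big_ord_recl big_ord0 coef1 mul1r addr0 mulr0 mul0r add0r.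
Qed.

(** At exp (2 i phi) the polynomial [k] equals exp (i (k - 1) phi) sin (k phi) / sin phi, so
    multiplying by it rescales the transform and shifts its phase. *)
Lemma costr_bracket p k a : sin phi * costr (p * bracket R k) a =
  sin (k%:R * phi) * costr p (a + (k%:R - 1) * phi).
Proof.
have -> : p * bracket R k = \sum_(j < k) p * 'X^j by rewrite mulr_sumr.
rewrite costr_sum; under eq_bigr do rewrite costrMXn.
rewrite /costr exchange_big /= !mulr_sumr; apply: eq_bigr => j _.
rewrite -mulr_sumr mulrCA [RHS]mulrCA; congr (_ * _).
elim: k => [|k IH]; first by rewrite big_ord0 mulr0 !mul0r sin0 mul0r.
rewrite big_ord_recr /= mulrDr IH -[k.+1%:R]natr1 addrK.
set x := 2 * j%:R * phi + a; set y := k%:R * phi.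
have -> : 2 * j%:R * phi + (a + (k%:R - 1) * phi) = x + y - phi by rewrite /x /y; ring.
have -> : 2 * j%:R * phi + (2 * k%:R * phi + a) = x + y + y by rewrite /x /y; ring.
have -> : 2 * j%:R * phi + (a + y) = x + y by rewrite /x; ring.
have -> : (k%:R + 1) * phi = y + phi by rewrite /y; ring.
by move: (x + y) => z; rewrite cosB cosD sinD; ring.
Qed.

Lemma costr_prod_bracket (r : seq nat) p a :
  sin phi ^+ size r * costr (p * \prod_(h <- r) bracket R h) a =
  (\prod_(h <- r) sin (h%:R * phi)) * costr p (a + (\sum_(h <- r) (h%:R - 1)) * phi).
Proof.
elim: r p a => [|h r IH] p a; first by rewrite !big_nil mulr1 expr0 !mul1r mul0r addr0.
rewrite !big_cons /= exprS -mulrA [p * _]mulrA IH.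
rewrite mulrCA costr_bracket -!mulrA [RHS]mulrCA; congr (_ * (_ * costr p _)); ring.
Qed.

Variable l : blockpart.
Local Notation n := (bsize l).
Local Notation H := (block_hooks l).

Lemma sum_cos_maj s : sin phi != 0 ->
  (\sum_(T : SYT l) cos (2 * ((maj T)%:R - kappa1 (majpoly R l)) * phi + s)) *
    \prod_(h <- H) sin (h%:R * phi) =
  cos s * \prod_(k < n) sin (k.+1%:R * phi).
Proof.
move=> s0; pose r := [seq k.+1 | k <- iota 0 n].
pose A : R := \sum_(h <- H) (h%:R - 1); pose B : R := \sum_(h <- r) (h%:R - 1).
have rE (M : Type) (idx : M) (op : M -> M -> M) (F : nat -> M) :
    \big[op/idx]_(h <- r) F h = \big[op/idx]_(k < n) F k.+1.
  rewrite big_map; have <- : index_iota 0 n = iota 0 n by rewrite /index_iota subn0.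
  by rewrite big_mkord.
(* With this phase the side of 'X^(min_maj l) and the brackets [1], ..., [n] reduces to cos s; on
   the tableau side the phase becomes the centring at the mean. *)
pose a : R := s - 2 * (min_maj l)%:R * phi - B * phi.
have e1 := costr_prod_bracket H (majpoly R l) a.
have := costr_prod_bracket r 'X^(min_maj l) a.
rewrite rE -majpoly_bracket size_map size_iota -{1}(size_block_hooks l) e1 -/A -/B rE.
rewrite -[X in costr X (a + B * phi)]mul1r costrMXn {2}/costr size_poly1 big_ord_recl big_ord0 coef1 mul1r.
rewrite costr_powersum /= mulr0 mul0r add0r addr0.
have -> : 2 * (min_maj l)%:R * phi + (a + B * phi) = s by rewrite /a; ring.
rewrite [cos s * _]mulrC => <-; rewrite mulrC; congr (_ * _); apply: eq_bigr => T _; congr cos.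
rewrite kappa1_majpoly /a /B rE /gap1 sumrB sumr_const card_ord.
by rewrite /A (sum_hooks_sub l (fun h => h%:R)) -mulr_natl; field.
Qed.

Lemma mean_cos_maj s : sin phi != 0 -> (forall h, (0 < h <= n)%N -> sin (h%:R * phi) != 0) ->
  (\sum_(T : SYT l) cos (2 * ((maj T)%:R - kappa1 (majpoly R l)) * phi + s)) / #|{: SYT l}|%:R =
  cos s * ((\prod_(k < n) (sin (k.+1%:R * phi) / (k.+1%:R * phi))) /
           (\prod_(h <- H) (sin (h%:R * phi) / (h%:R * phi)))).
Proof.
move=> s0 sk.
have phi0 : phi != 0 by apply: contraNneq s0 => ->; rewrite sin0.
have c0 : #|{: SYT l}|%:R != 0 :> R.
  by rewrite pnatr_eq0 -lt0n; apply/card_gt0P; exists (SYT_point l).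
have hb h : h \in H -> (0 < h <= n)%N.
  move=> hH; rewrite (block_hooks_gt0 hH) leqNgt; apply/negP => nh.
  have := count_block_hooks l (ltn0Sn n); rewrite subnn leqn0 => /eqP c.
  by have : has (leq n.+1) H by [apply/hasP; exists h]; rewrite has_count c.
have S0 : \prod_(h <- H) sin (h%:R * phi) != 0.
  by rewrite prodf_seq_neq0; apply/allP => h /hb; exact: sk.
have H0 : \prod_(h <- H) h%:R != 0 :> R.
  by rewrite prodf_seq_neq0; apply/allP => h /hb /andP[h0 _] /=; rewrite pnatr_eq0 -lt0n.
(* Dividing each sine by its argument introduces n! over the product of the hooks, which is the
   number of tableaux, while the powers of phi cancel. *)
rewrite !big_split /= !prodfV !big_split /= -majpoly1.
have -> : \prod_(h <- H) phi = phi ^+ n.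
  by rewrite big_const_seq count_predT iter_mulr_1 size_block_hooks.
rewrite prodr_const card_ord.
have p0 : phi ^+ n != 0 by rewrite expf_neq0.
have := sum_cos_maj s s0; set S := \sum_(T : _) _.
move: (\prod_(h <- H) sin (h%:R * phi)) (\prod_(h <- H) h%:R)
  (\prod_(k < n) sin (k.+1%:R * phi)) (phi ^+ n) S S0 H0 p0.
move=> x y z w S x0 y0 w0 e; apply: (mulIf x0); apply: (mulIf c0).
have -> : S / #|{: SYT l}|%:R * x * #|{: SYT l}|%:R = S * x by field.
by rewrite e; field; rewrite x0 y0 w0 c0.
Qed.

End CosineTransform.

(** * Estimates of sin x / x *)

Local Open Scope classical_set_scope.
Local Open Scope ring_scope.

Section SineEstimates.
Variable R : realType.
Implicit Types x : R.

Lemma derive_ge0_homo (f df : R -> R) (a b : R) :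
  (forall x, x \in `[a, b] -> is_derive x 1 f (df x)) ->
  (forall x, x \in `[a, b] -> 0 <= df x) ->
  forall x y, a <= x -> x <= y -> y <= b -> f x <= f y.
Proof.
move=> fd df0 x y ax xy yb.
have d x' : x' \in `]a, b[ -> x' \in `[a, b] by rewrite !in_itv /= => /andP[/ltW-> /ltW->].
apply: (@ger0_derive1_le_cc R f a b) => //; rewrite ?in_itv /= ?ax ?yb ?(le_trans xy) ?(le_trans ax) //.
- by move=> z /d /fd dz; apply: ex_derive.
- by move=> z /d zi; have dz := fd _ zi; rewrite derive1E derive_val df0.
- by apply: derivable_within_continuous => z /fd dz; apply: ex_derive.
Qed.

Lemma derive_ge0_ge0 (f df : R -> R) (b : R) :
  (forall x, is_derive x 1 f (df x)) -> f 0 = 0 ->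
  (forall x, 0 <= x <= b -> 0 <= df x) -> forall x, 0 <= x <= b -> 0 <= f x.
Proof.
move=> fd f0 df0 x /andP[x0 xb]; rewrite -f0.
by apply: (@derive_ge0_homo f df 0 b) => // z; rewrite in_itv /=; exact: df0.
Qed.

Lemma sin_ge0_01 x : 0 <= x <= 1 -> 0 <= sin x.
Proof.
move=> /andP[x0 x1]; apply: sin_ge0_pi; rewrite x0 /=; apply: le_trans x1 _.
by have := @pi_ge2 R; lra.
Qed.

Lemma sin_le_id x : 0 <= x <= 1 -> sin x <= x.
Proof.
move=> x01; rewrite -subr_ge0.
apply: (@derive_ge0_ge0 (fun x => x - sin x) (fun x => 1 - cos x) 1) => //.
  by rewrite sin0 subr0.
Qed.

Lemma cos_ge_half x : 0 <= x <= 1 -> 1 / 2 <= cos x.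
Proof.
move=> x01; have : 0 <= cos x - 1 + x ^+ 2 / 2.
  apply: (@derive_ge0_ge0 (fun x => cos x - 1 + x ^+ 2 / 2) (fun x => x - sin x) 1) => //.
  - by move=> y; apply: is_derive_eq; rewrite -![_ *: _]/(_ * _); field.
  - by rewrite cos0 expr0n /= mul0r; lra.
  - by move=> y /sin_le_id; rewrite subr_ge0.
by case/andP: x01; nra.
Qed.


Lemma sin_sub_xcos_ge0 x : 0 <= x <= 1 -> 0 <= sin x - x * cos x.
Proof.
apply: (@derive_ge0_ge0 (fun x => sin x - x * cos x) (fun x => x * sin x) 1).
- by move=> y; apply: is_derive_eq; rewrite -![_ *: _]/(_ * _); ring.
- by rewrite sin0 mul0r subr0.
- by move=> y y01; rewrite mulr_ge0 ?sin_ge0_01 //; case/andP: y01.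
Qed.

Lemma sin_sub_xcos_le x : 0 <= x <= 1 -> sin x - x * cos x <= x ^+ 3 / 3.
Proof.
move=> x01; rewrite -subr_ge0.
apply: (@derive_ge0_ge0 (fun x => x ^+ 3 / 3 - (sin x - x * cos x)) (fun x => x ^+ 2 - x * sin x) 1) => //.
- by move=> y; apply: is_derive_eq; rewrite -![_ *: _]/(_ * _); field.
- by rewrite sin0 expr0n /= !mul0r !subr0.
- move=> y y01; rewrite expr2 -mulrBr mulr_ge0 ?subr_ge0 ?sin_le_id //; by case/andP: y01.
Qed.

(** Up to the positive factor x sin x, this and [sin_lower] say that the derivative of [lnsinc] lies
    between -4 x^3 and 0. *)
Lemma sin_upper x : 0 <= x <= 1 -> 0 <= sin x - x * cos x - x ^+ 2 * sin x / 3.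
Proof.
apply: (@derive_ge0_ge0 (fun x => sin x - x * cos x - x ^+ 2 * sin x / 3)
  (fun x => x / 3 * (sin x - x * cos x)) 1).
- by move=> y; apply: is_derive_eq; rewrite -![_ *: _]/(_ * _); field.
- by rewrite sin0 expr0n /= !mul0r !subr0.
- move=> y y01; rewrite mulr_ge0 ?sin_sub_xcos_ge0 // divr_ge0 //; by case/andP: y01.
Qed.

Lemma sin_lower x : 0 <= x <= 1 ->
  0 <= x * cos x - sin x + x ^+ 2 * sin x / 3 + 4 * x ^+ 4 * sin x.
Proof.
apply: (@derive_ge0_ge0 (fun x => x * cos x - sin x + x ^+ 2 * sin x / 3 + 4 * x ^+ 4 * sin x)
  (fun x => - (x / 3 * (sin x - x * cos x)) + 16 * x ^+ 3 * sin x + 4 * x ^+ 4 * cos x) 1).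
- by move=> y; apply: is_derive_eq; rewrite -![_ *: _]/(_ * _); field.
- by rewrite sin0 expr0n /= !(mul0r, mulr0) !(subr0, addr0).
- move=> y y01; have y0 : 0 <= y by case/andP: y01.
  have h1 := sin_sub_xcos_le y01; have h2 := sin_ge0_01 y01; have h3 := cos_ge_half y01.
  have h4 : 0 <= 16 * y ^+ 3 * sin y by rewrite !mulr_ge0 // exprn_ge0.
  have h5 : y / 3 * (sin y - y * cos y) <= y / 3 * (y ^+ 3 / 3) by apply: ler_wpM2l => //; lra.
  (* The only negative term of the derivative is at least -y^4 / 9, and 4 y^4 cos y >= 2 y^4
     outweighs it. *)
  have h6 : 4 * y ^+ 4 * (1 / 2) <= 4 * y ^+ 4 * cos y by apply: ler_wpM2l => //; rewrite mulr_ge0 // exprn_ge0.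
  have h7 : 0 <= y ^+ 4 by rewrite exprn_ge0.
  have e : y / 3 * (y ^+ 3 / 3) = y ^+ 4 / 9 by field.
  by rewrite e in h5; lra.
Qed.

(** The logarithm of sin x / x with its quadratic Taylor term -x^2 / 6 removed: that term yields the
    variance, and the rest is of order x^4. *)
Definition lnsinc x : R := ln (sin x) - ln x + x ^+ 2 / 6.

Lemma sin_gt0_01 x : 0 < x <= 1 -> 0 < sin x.
Proof.
move=> /andP[x0 x1]; apply: sin_gt0_pi; rewrite x0 /=; apply: le_lt_trans x1 _.
by have := @pi_ge2 R; lra.
Qed.

Lemma is_derive_lnsinc x : 0 < x <= 1 ->
  is_derive x 1 lnsinc (cos x / sin x - x^-1 + x / 3).
Proof.
move=> x01; have x0 : 0 < x by case/andP: x01.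
have s0 := sin_gt0_01 x01.
have d1 : is_derive x 1 (@ln R \o @sin R) (cos x / sin x).
  have := @is_derive1_comp R (@ln R) (@sin R) x _ _ (is_derive1_ln s0) (is_derive_sin x).
  by rewrite mulrC.
have d2 := is_derive1_ln x0.
have d3 : is_derive x 1 (fun x : R => x ^+ 2 / 6) (x / 3).
  by apply: is_derive_eq; rewrite -![_ *: _]/(_ * _); field.
exact: (is_deriveD (is_deriveB d1 d2) d3).
Qed.

Lemma lnsinc_noninc x y : 0 < x -> x <= y -> y <= 1 -> lnsinc y <= lnsinc x.
Proof.
move=> x0 xy y1; rewrite -lerN2.
apply: (@derive_ge0_homo (fun x => - lnsinc x) (fun x => - (cos x / sin x - x^-1 + x / 3)) x 1) => // z.
  rewrite in_itv /= => /andP[xz z1].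
  by apply: is_deriveN; apply: is_derive_lnsinc; rewrite (lt_le_trans x0).
rewrite in_itv /= => /andP[xz z1]; have z0 := lt_le_trans x0 xz.
have s0 : 0 < sin z by apply: sin_gt0_01; rewrite z0.
have := @sin_upper z; rewrite (ltW z0) z1 => /(_ isT) h.
have -> : - (cos z / sin z - z^-1 + z / 3) =
    (sin z - z * cos z - z ^+ 2 * sin z / 3) / (z * sin z) by field; rewrite !gt_eqF.
by rewrite divr_ge0 // mulr_ge0 // ltW.
Qed.

(** Adding x^4 reverses the monotonicity of [lnsinc]. Comparing hooks with 1, ..., n through both
    functions bounds the error from both sides. *)
Lemma lnsinc_nondec x y : 0 < x -> x <= y -> y <= 1 ->
  lnsinc x + x ^+ 4 <= lnsinc y + y ^+ 4.
Proof.
move=> x0 xy y1.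
apply: (@derive_ge0_homo (fun x => lnsinc x + x ^+ 4)
  (fun x => cos x / sin x - x^-1 + x / 3 + 4 * x ^+ 3) x 1) => // z.
  rewrite in_itv /= => /andP[xz z1]; have z0 := lt_le_trans x0 xz.
  have d1 : is_derive z 1 lnsinc (cos z / sin z - z^-1 + z / 3) by apply: is_derive_lnsinc; rewrite z0.
  have d2 : is_derive z 1 (fun x : R => x ^+ 4) (4 * z ^+ 3).
    by apply: is_derive_eq; rewrite -![_ *: _]/(_ * _); ring.
  exact: (is_deriveD d1 d2).
rewrite in_itv /= => /andP[xz z1]; have z0 := lt_le_trans x0 xz.
have s0 : 0 < sin z by apply: sin_gt0_01; rewrite z0.
have := @sin_lower z; rewrite (ltW z0) z1 => /(_ isT) h.
have -> : cos z / sin z - z^-1 + z / 3 + 4 * z ^+ 3 =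
    (z * cos z - sin z + z ^+ 2 * sin z / 3 + 4 * z ^+ 4 * sin z) / (z * sin z).
  by field; rewrite !gt_eqF.
by rewrite divr_ge0 // mulr_ge0 // ltW.
Qed.

End SineEstimates.

(** * The characteristic function of the normalized major index *)

Section CharacteristicFunction.
Variables (R : realType) (l : blockpart).
Local Notation n := (bsize l).
Local Notation H := (block_hooks l).

Lemma block_hooks_le h : h \in H -> (0 < h <= n)%N.
Proof.
move=> hH; rewrite (block_hooks_gt0 hH) leqNgt; apply/negP => nh.
have := count_block_hooks l (ltn0Sn n); rewrite subnn leqn0 => /eqP c.
by have : has (leq n.+1) H by [apply/hasP; exists h]; rewrite has_count c.
Qed.

Lemma gap2_ge0 : 0 <= gap2 R l.
Proof.
rewrite subr_ge0; apply: (sum_block_hooks_le (g := fun k => k%:R ^+ 2)) => a b a0 ab bn.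
by rewrite lerXn2r ?nnegrE // ler_nat.
Qed.

(** The function 2 n^2 k^2 - k^4 is nondecreasing for 0 <= k <= n, so the comparison of sums applies
    to it and controls fourth powers by squares. *)
Lemma gap4_le : \sum_(k < n) k.+1%:R ^+ 4 - \sum_(h <- H) h%:R ^+ 4 <= 2 * n%:R ^+ 2 * gap2 R l.
Proof.
have : \sum_(h <- H) (2 * n%:R ^+ 2 * h%:R ^+ 2 - h%:R ^+ 4) <=
    \sum_(k < n) (2 * n%:R ^+ 2 * k.+1%:R ^+ 2 - k.+1%:R ^+ 4) :> R.
  apply: (sum_block_hooks_le (g := fun k => 2 * n%:R ^+ 2 * k%:R ^+ 2 - k%:R ^+ 4)) => a b a0 ab bn.
  have ha : 0 <= a%:R :> R by []; have hab : a%:R <= b%:R :> R by rewrite ler_nat.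
  have hbn : b%:R <= n%:R :> R by rewrite ler_nat.
  move: (a%:R : R) (b%:R : R) (n%:R : R) ha hab hbn => x y z x0 xy yz.
  rewrite -subr_ge0; have -> : 2 * z ^+ 2 * y ^+ 2 - y ^+ 4 - (2 * z ^+ 2 * x ^+ 2 - x ^+ 4) =
    (y - x) * (y + x) * ((z - y) * (z + y) + (z - x) * (z + x)) by ring.
  apply: mulr_ge0; first by apply: mulr_ge0; lra.
  by apply: addr_ge0; apply: mulr_ge0; lra.
rewrite !sumrB -!mulr_sumr /gap2 mulrBr; lra.
Qed.

Lemma sinc_quotient (phi : R) : 0 < phi -> n%:R * phi <= 1 ->
  exists2 e, - (2 * n%:R ^+ 2 * phi ^+ 4 * gap2 R l) <= e <= 0 &
  (\prod_(k < n) (sin (k.+1%:R * phi) / (k.+1%:R * phi))) /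
    (\prod_(h <- H) (sin (h%:R * phi) / (h%:R * phi))) =
  expR (e - phi ^+ 2 * gap2 R l / 6).
Proof.
move=> phi0 nphi.
have inI (k : nat) : (0 < k <= n)%N -> 0 < k%:R * phi <= 1.
  move=> /andP[k0 kn]; rewrite mulr_gt0 ?ltr0n //=; apply: le_trans nphi.
  by rewrite ler_pM2r // ler_nat.
have sincE k : (0 < k <= n)%N ->
    sin (k%:R * phi) / (k%:R * phi) = expR (lnsinc (k%:R * phi) - (k%:R * phi) ^+ 2 / 6).
  move=> /inI x01; have /andP[x0 _] := x01; have s0 := sin_gt0_01 x01.
  by rewrite /lnsinc addrK -ln_div ?posrE // lnK // posrE divr_gt0.
pose A (k : nat) : R := lnsinc (k%:R * phi).
exists (\sum_(k < n) A k.+1 - \sum_(h <- H) A h).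
  apply/andP; split; last first.
    rewrite subr_le0 -lerN2 -!sumrN; apply: (sum_block_hooks_le (g := fun k => - A k)) => a b a0 ab bn.
    rewrite lerN2; apply: lnsinc_noninc.
    - by case/andP: (inI a (introT andP (conj a0 (leq_trans ab bn)))).
    - by rewrite ler_pM2r // ler_nat.
    - by case/andP: (inI b (introT andP (conj (leq_trans a0 ab) bn))).
  have : \sum_(h <- H) (A h + (h%:R * phi) ^+ 4) <= \sum_(k < n) (A k.+1 + (k.+1%:R * phi) ^+ 4).
    apply: (sum_block_hooks_le (g := fun k => A k + (k%:R * phi) ^+ 4)) => a b a0 ab bn.
    apply: lnsinc_nondec.
    - by case/andP: (inI a (introT andP (conj a0 (leq_trans ab bn)))).
    - by rewrite ler_pM2r // ler_nat.
    - by case/andP: (inI b (introT andP (conj (leq_trans a0 ab) bn))).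
  rewrite !big_split /= => h1.
  have h2 := ler_wpM2l (exprn_ge0 4 (ltW phi0)) gap4_le.
  have e1 : \sum_(h <- H) (h%:R * phi) ^+ 4 = phi ^+ 4 * \sum_(h <- H) h%:R ^+ 4.
    by rewrite mulr_sumr; apply: eq_bigr => h _; rewrite exprMn mulrC.
  have e2 : \sum_(k < n) (k.+1%:R * phi) ^+ 4 = phi ^+ 4 * \sum_(k < n) k.+1%:R ^+ 4.
    by rewrite mulr_sumr; apply: eq_bigr => h _; rewrite exprMn mulrC.
  rewrite e1 e2 in h1; rewrite mulrBr in h2; lra.
have e1 : \prod_(k < n) (sin (k.+1%:R * phi) / (k.+1%:R * phi)) =
    expR (\sum_(k < n) (A k.+1 - (k.+1%:R * phi) ^+ 2 / 6)).
  by rewrite expR_sum; apply: eq_bigr => k _; rewrite sincE // ltn_ord.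
have e2 : \prod_(h <- H) (sin (h%:R * phi) / (h%:R * phi)) =
    expR (\sum_(h <- H) (A h - (h%:R * phi) ^+ 2 / 6)).
  by rewrite expR_sum; apply: eq_big_seq => h hH; rewrite sincE // block_hooks_le.
rewrite e1 e2 -expRB; congr expR; rewrite !sumrB /gap2.
have -> : \sum_(k < n) (k.+1%:R * phi) ^+ 2 / 6 = phi ^+ 2 / 6 * \sum_(k < n) k.+1%:R ^+ 2.
  by rewrite mulr_sumr; apply: eq_bigr => h _; rewrite exprMn; field.
have -> : \sum_(h <- H) (h%:R * phi) ^+ 2 / 6 = phi ^+ 2 / 6 * \sum_(h <- H) h%:R ^+ 2.
  by rewrite mulr_sumr; apply: eq_bigr => h _; rewrite exprMn; field.
by field.
Qed.

Definition avg (f : R -> R) : R := (\sum_(T : SYT l) f (maj T)%:R) / #|{: SYT l}|%:R.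

Definition maj_mean : R := kappa1 (majpoly R l).
Definition maj_var : R := gap2 R l / 12.

Lemma card_SYT_gt0 : (0 < #|{: SYT l}|)%N.
Proof. by apply/card_gt0P; exists (SYT_point l). Qed.

Lemma avg_mean : avg id = maj_mean.
Proof. by rewrite /maj_mean kappa1_powersum. Qed.

Lemma avg_var : avg (fun x => (x - maj_mean) ^+ 2) = maj_var.
Proof.
have c0 : #|{: SYT l}|%:R != 0 :> R by rewrite pnatr_eq0 -lt0n card_SYT_gt0.
rewrite /maj_var -kappa2_majpoly kappa2_powersum -/maj_mean -avg_mean /avg.
set S1 := \sum_(T : SYT l) (maj T)%:R; set c := #|_|%:R in c0 *.
rewrite (eq_bigr (fun T : SYT l => (maj T)%:R ^+ 2 + ((maj T)%:R * (- 2 * (S1 / c)) + (S1 / c) ^+ 2))); last first.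
  by move=> T _; rewrite /=; ring.
rewrite !big_split /= -mulr_suml sumr_const -/S1 -mulr_natl -/c.
by field.
Qed.

Lemma avg_cos (t s : R) (sg := Num.sqrt maj_var) : 0 < maj_var -> 0 < t -> n%:R * t <= sg ->
  exists2 e, - (3 / 2 * n%:R ^+ 2 * t ^+ 4 / maj_var) <= e <= 0 &
  avg (fun x => cos (t * ((x - maj_mean) / sg) + s)) = cos s * expR (e - t ^+ 2 / 2).
Proof.
move=> v0 t0 nt; have sg0 : 0 < sg by rewrite sqrtr_gt0.
have sg2 : sg ^+ 2 = maj_var by rewrite sqr_sqrtr // ltW.
(* The transform has frequency 2 phi. From gap2 = 12 sg^2 one gets phi^2 gap2 / 6 = t^2 / 2 and 2
   n^2 phi^4 gap2 = 3/2 n^2 t^4 / sg^2. *)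
pose phi := t / (2 * sg); have phi0 : 0 < phi by rewrite divr_gt0 // mulr_gt0.
have nphi : n%:R * phi <= 1.
  by rewrite /phi mulrA ler_pdivrMr ?mulr_gt0 // mul1r; lra.
have [e eb eE] := sinc_quotient phi0 nphi.
have g2 : gap2 R l = 12 * sg ^+ 2 by rewrite sg2 /maj_var; field.
exists e.
  move: eb; rewrite g2 -sg2 (_ : 2 * _ * _ * _ = 3 / 2 * n%:R ^+ 2 * t ^+ 4 / sg ^+ 2) //.
  by rewrite /phi; field; rewrite gt_eqF.
have sk h : (0 < h <= n)%N -> sin (h%:R * phi) != 0.
  move=> /andP[h0 hn]; rewrite gt_eqF // sin_gt0_01 // mulr_gt0 ?ltr0n //=.
  by apply: le_trans nphi; rewrite ler_pM2r // ler_nat.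
have [n0|n0] := posnP n.
  have := g2; rewrite /gap2 n0 big_ord0 (size0nil (s := H)) ?size_block_hooks // big_nil subrr => /eqP.
  by rewrite eq_sym mulf_eq0 sqrf_eq0 pnatr_eq0 /= gt_eqF.
have s0 : sin phi != 0 by have := sk 1%N; rewrite mul1r; apply.
have := mean_cos_maj s s0 sk; rewrite eE -/maj_mean => m.
rewrite /avg (eq_bigr (fun T : SYT l => cos (2 * ((maj T)%:R - maj_mean) * phi + s))).
  by rewrite m; congr (_ * expR (_ - _)); rewrite g2 /phi; field; rewrite gt_eqF.
by move=> T _; congr (cos (_ + _)); rewrite /phi; field; rewrite gt_eqF.
Qed.

End CharacteristicFunction.

(** * The normal distribution *)

Section NormalExpectation.
Variable R : realType.
Local Notation mu := (@lebesgue_measure R).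
Local Notation g := (@normal_pdf R 0 1).

Lemma normal_pdf01E x : g x = normal_peak 1 * expR (- (x ^+ 2 / 2)).
Proof. by rewrite normal_pdfE ?oner_neq0 //= /normal_fun subr0 expr1n mulNr. Qed.

(** A class of test functions containing cosines, half lines and y^2, on which the normal mean is
    finite, hence linear and monotone. *)
Definition quadratic_growth (f : R -> R) : Prop :=
  measurable_fun [set: R] f /\
  exists A B : R, [/\ 0 <= A, 0 <= B & forall y, `|f y| <= A + B * y ^+ 2].

Definition normal_mean (f : R -> R) : R := \int[mu]_x (f x * g x).

(** The density is a multiple of exp (-x^2/4) twice; one factor absorbs the quadratic growth, since
    (A + B x^2) exp (-x^2/4) <= A + 4 B, and the other is a multiple of the normal density of
    variance 2. *)
Lemma integrable_quadratic_growth f : quadratic_growth f ->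
  mu.-integrable [set: R] (EFin \o (fun x => f x * g x)).
Proof.
move=> [mf [A [B [A0 B0 fAB]]]].
have s2 : Num.sqrt 2 != 0 :> R by rewrite gt_eqF // sqrtr_gt0.
have p1 : 0 < normal_peak (1 : R) by rewrite normal_peak_gt0 ?oner_neq0.
have p2 : 0 < normal_peak (Num.sqrt 2 : R) by rewrite normal_peak_gt0.
pose C := (A + 4 * B) * normal_peak 1 / normal_peak (Num.sqrt 2).
have iC : mu.-integrable [set: R] (fun x => C%:E * (normal_pdf 0 (Num.sqrt 2) x)%:E)%E.
  by apply: integrableZl => //; exact: integrable_normal_pdf.
apply: le_integrable iC => //.
  by apply/measurable_EFinP; apply: measurable_funM => //; exact: measurable_normal_pdf.
move=> x _ /=; rewrite lee_fin normrM (ger0_norm (normal_pdf_ge0 _ _ _)).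
apply: le_trans (ler_norm _); rewrite normal_pdf01E normal_pdfE //= /normal_fun subr0 sqr_sqrtr //.
have -> : C * (normal_peak (Num.sqrt 2) * expR (- x ^+ 2 / (2 *+ 2))) =
    (A + 4 * B) * (normal_peak 1 * expR (- (x ^+ 2 / 4))).
  rewrite /C (_ : - x ^+ 2 / (2 *+ 2) = - (x ^+ 2 / 4)); last by field.
  by field; rewrite gt_eqF.
have -> : expR (- (x ^+ 2 / 2)) = expR (- (x ^+ 2 / 4)) * expR (- (x ^+ 2 / 4)).
  by rewrite -expRD; congr expR; field.
rewrite [leLHS]mulrCA [leRHS]mulrCA; apply: ler_wpM2l; first exact: ltW.
rewrite mulrA; apply: ler_wpM2r; first exact: expR_ge0.
apply: le_trans (ler_wpM2r (expR_ge0 _) (fAB x)) _.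
have h0 : expR (- (x ^+ 2 / 4)) <= 1 by rewrite -expR0 ler_expR oppr_le0 divr_ge0 ?sqr_ge0.
have h1 : x ^+ 2 / 4 * expR (- (x ^+ 2 / 4)) <= 1.
  rewrite expRN ler_pdivrMr ?expR_gt0 // mul1r; apply: le_trans (expR_ge1Dx _); lra.
rewrite mulrDl; apply: lerD; first by rewrite ler_piMr.
have -> : B * x ^+ 2 * expR (- (x ^+ 2 / 4)) = 4 * B * (x ^+ 2 / 4 * expR (- (x ^+ 2 / 4))) by field.
by rewrite ler_piMr // mulr_ge0.
Qed.

Lemma normal_mean_cst c : normal_mean (cst c) = c.
Proof.
rewrite /normal_mean /= RintegralZl //; last exact: integrable_normal_pdf.
by rewrite /Rintegral integral_normal_pdf mulr1.
Qed.

Lemma quadratic_growth_bounded (f : R -> R) M : measurable_fun [set: R] f -> (forall y, `|f y| <= M) ->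
  quadratic_growth f.
Proof.
move=> mf fM; split => //; exists M, 0; split=> //; first exact: le_trans (fM 0).
by move=> y; rewrite mul0r addr0.
Qed.

Lemma measurable_cosM (t s : R) : measurable_fun [set: R] (fun y => cos (t * y + s)).
Proof.
apply: (measurableT_comp (f := @cos R)); first by apply: continuous_measurable_fun; exact: continuous_cos.
by apply: measurable_funD => //; apply: measurable_funM.
Qed.

Lemma quadratic_growth_cos t s : quadratic_growth (fun y => cos (t * y + s)).
Proof. by apply: (@quadratic_growth_bounded _ 1); [exact: measurable_cosM|move=> y; exact: cos_max]. Qed.

Lemma is_derive_normal_pdf (x : R) : is_derive x (1 : R) (g : R -> R) (- x * g x).
Proof.
have -> : g = fun x => normal_peak 1 * expR (- (x ^+ 2 / 2)) by apply/funext => y; rewrite normal_pdf01E.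
have d1 : is_derive x 1 (fun x : R => - (x ^+ 2 / 2)) (- x).
  by apply: is_derive_eq; rewrite -![_ *: _]/(_ * _); field.
have d2 := @is_derive1_comp R (@expR R) (fun x : R => - (x ^+ 2 / 2)) x _ _ (is_derive_expR _) d1.
have d3 : is_derive x 1 (cst (normal_peak 1 : R)) 0 by apply: is_derive_cst.
apply: (is_derive_eq (is_deriveM d3 d2)); rewrite -![_ *: _]/(_ * _) /=; ring.
Qed.

Lemma is_derive_affine (f : R -> R) (df t s x : R) :
  is_derive (t * x + s) (1 : R) f df -> is_derive x (1 : R) (fun x : R => f (t * x + s)) (t * df).
Proof.
move=> d; have d1 : is_derive x 1 (fun x : R => t * x + s) t.
  by apply: is_derive_eq; rewrite -![_ *: _]/(_ * _); ring.
by rewrite mulrC; exact: (@is_derive1_comp R f (fun x : R => t * x + s) x _ _ d d1).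
Qed.

Lemma quadratic_growth_linear (h : R -> R) : measurable_fun [set: R] h ->
  (forall y, `|h y| <= 1) -> quadratic_growth (fun y => y * h y).
Proof.
move=> mh h1; split; first exact: measurable_funM.
exists 1, 1; split=> // y; rewrite normrM mul1r.
apply: (@le_trans _ _ `|y|); first by rewrite ler_piMr.
have := sqr_ge0 (y - 1 : R); have := sqr_ge0 (y + 1 : R); case: (ger0P (y : R)) => *; lra.
Qed.

Lemma quadratic_growth_sqr : quadratic_growth (fun y : R => y ^+ 2).
Proof.
split; first exact: measurable_funX.
by exists 0, 1; split=> // y; rewrite add0r mul1r ger0_norm ?sqr_ge0.
Qed.

Lemma quadratic_growthD f h : quadratic_growth f -> quadratic_growth h ->
  quadratic_growth (fun y => f y + h y).
Proof.
move=> [mf [A [B [A0 B0 fAB]]]] [mh [A' [B' [A0' B0' hAB]]]]; split; first exact: measurable_funD.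
exists (A + A'), (B + B'); split; rewrite ?addr_ge0 // => y.
apply: le_trans (ler_normD _ _) _; apply: le_trans (lerD (fAB y) (hAB y)) _.
by rewrite le_eqVlt; apply/orP; left; apply/eqP; ring.
Qed.

Lemma quadratic_growthZ c f : quadratic_growth f -> quadratic_growth (fun y => c * f y).
Proof.
move=> [mf [A [B [A0 B0 fAB]]]]; split; first exact: measurable_funM.
exists (`|c| * A), (`|c| * B); split; rewrite ?mulr_ge0 // => y.
by rewrite normrM -mulrA -mulrDr ler_wpM2l.
Qed.

Lemma normal_meanD f h : quadratic_growth f -> quadratic_growth h ->
  normal_mean (fun y => f y + h y) = normal_mean f + normal_mean h.
Proof.
move=> gf gh; rewrite /normal_mean -RintegralD //; try exact: integrable_quadratic_growth.
by apply: eq_Rintegral => x _; rewrite mulrDl.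
Qed.

Lemma normal_meanZ c f : quadratic_growth f ->
  normal_mean (fun y => c * f y) = c * normal_mean f.
Proof.
move=> gf; rewrite /normal_mean -RintegralZl //; last exact: integrable_quadratic_growth.
by apply: eq_Rintegral => x _; rewrite mulrA.
Qed.

Lemma normal_mean_le f h : quadratic_growth f -> quadratic_growth h ->
  (forall y, f y <= h y) -> normal_mean f <= normal_mean h.
Proof.
move=> gf gh fh; apply: le_Rintegral => //; try exact: integrable_quadratic_growth.
by move=> x _; rewrite ler_wpM2r ?normal_pdf_ge0.
Qed.

Lemma measurable_sinM (t s : R) : measurable_fun [set: R] (fun y => sin (t * y + s)).
Proof.
apply: (measurableT_comp (f := @sin R)); first by apply: continuous_measurable_fun; exact: continuous_sin.
by apply: measurable_funD => //; apply: measurable_funM.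
Qed.

Lemma quadratic_growth_xsin t s : quadratic_growth (fun y => y * sin (t * y + s)).
Proof. by apply: quadratic_growth_linear; [exact: measurable_sinM|move=> y; exact: sin_max]. Qed.

Lemma integral_symmetric_itv (f : R -> R) : mu.-integrable [set: R] (EFin \o f) ->
  \int[mu]_(x in `[- n%:R, n%:R]) f x @[n --> \oo] --> \int[mu]_x f x.
Proof.
move=> fi.
have mf : measurable_fun [set: R] f by have /integrableP[/measurable_EFinP] := fi.
have fabs : mu.-integrable [set: R] (fun x => `|(f x)%:E|)%E by apply: integrable_abse.
pose fn (n : nat) (x : R) : \bar R := ((f \_ `[- n%:R, n%:R]) x)%:E.
have mfn n : measurable_fun [set: R] (fn n).
  apply/measurable_EFinP; apply/(measurable_restrict _ _ _) => //.
  by rewrite setTI; exact: measurable_funS mf.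
have fcvg : {ae mu, forall x, [set: R] x -> fn ^~ x @ \oo --> (f x)%:E}.
  apply/aeW => x _; apply: cvg_near_cst.
  have [k xk] : exists k : nat, `|x| <= k%:R.
    by exists (Num.truncn `|x|).+1; rewrite ltW // truncnS_gt.
  exists k => // n /= kn; rewrite /fn patchE mem_set //= in_itv /= -ler_norml.
  by apply: le_trans xk _; rewrite ler_nat.
have fdom : {ae mu, forall x n, [set: R] x -> (`|fn n x| <= `|(f x)%:E|)%E}.
  apply/aeW => x n _; rewrite /fn patchE; case: ifP => _ //.
  by rewrite /= normr0 lee_fin.
have mfE : measurable_fun [set: R] (EFin \o f) by exact/measurable_EFinP.
have [_ _] := @dominated_convergence _ _ _ mu setT measurableT fn (EFin \o f)
  (fun x => `|(f x)%:E|)%E mfn mfE fcvg fabs fdom.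
rewrite /= -[X in _ --> X]fineK; last exact: (integrable_fin_num measurableT fi).
move=> /fine_cvg h.
suff -> : (fun n : nat => \int[mu]_(x in `[- n%:R, n%:R]) f x) = fine \o (fun n => \int[mu]_x fn n x)%E by [].
apply/funext => n /=; congr fine; rewrite integral_mkcond.
by apply: eq_integral => x _; rewrite restrict_EFin.
Qed.

Lemma natr_expR_cvg : expR (- (n%:R ^+ 2 / 2)) @[n --> \oo] --> (0 : R).
Proof.
apply: (@squeeze_cvgr _ _ _ _ (cst 0) (fun n => n.+1%:R^-1 *+ 2)).
- apply: nearW => n; rewrite expR_ge0 /= expRN -[leRHS]mulr_natl.
  rewrite ler_pdivlMr ?ltr0n // mulrC ler_pdivrMr ?expR_gt0 //.
  have := expR_ge1Dx (n%:R ^+ 2 / 2 : R); have := sqr_ge0 (n%:R - 1 : R).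
  by rewrite -[n.+1%:R]natr1; have := ler0n R n; lra.
- exact: cvg_cst.
- rewrite -[X in _ --> X](mul0rn _ 2); apply: cvgMn; exact: cvg_harmonic.
Qed.

(** Integration by parts: g' = -y g, so f is the derivative of F y = sin (t y + s) g y. The integral
    of f over [-n, n] is a boundary term tending to 0. *)
Lemma normal_mean_parts t s :
  normal_mean (fun y => y * sin (t * y + s)) = t * normal_mean (fun y => cos (t * y + s)).
Proof.
have gc := quadratic_growth_cos t s; have gs := quadratic_growth_xsin t s.
pose f y := t * cos (t * y + s) * g y - y * sin (t * y + s) * g y.
pose F y := sin (t * y + s) * g y.
have dF x : is_derive x (1 : R) (F : R -> R) (f x).
  have d1 : is_derive x (1 : R) (fun y : R => sin (t * y + s)) (t * cos (t * x + s)).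
    exact: is_derive_affine.
  apply: (is_derive_eq (is_deriveM d1 (is_derive_normal_pdf x))).
  by rewrite -![_ *: _]/(_ * _) /f; ring.
have dg x : is_derive x (1 : R) (f : R -> R)
   ('D_1 (f : R -> R) x).
  apply: DeriveDef => //.
  have d1 : is_derive x (1 : R) (fun y : R => cos (t * y + s)) (t * - sin (t * x + s)).
    exact: is_derive_affine.
  have d2 : is_derive x (1 : R) (fun y : R => sin (t * y + s)) (t * cos (t * x + s)).
    exact: is_derive_affine.
  have d3 := is_derive_normal_pdf x.
  by apply: ex_derive.
have cf : continuous f by move=> x; apply/differentiable_continuous/derivable1_diffP; exact: ex_derive.
have cF : continuous F by move=> x; apply/differentiable_continuous/derivable1_diffP; exact: ex_derive.
have fi : mu.-integrable [set: R] (EFin \o f).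
  have i1 := integrable_quadratic_growth (quadratic_growthZ t gc).
  have i2 := integrable_quadratic_growth gs.
  by have := integrableB measurableT i1 i2; apply: eq_integrable => // x _; rewrite /= EFinB.
have If : \int[mu]_x f x = t * normal_mean (fun y => cos (t * y + s)) -
    normal_mean (fun y => y * sin (t * y + s)).
  rewrite -normal_meanZ // /normal_mean -RintegralB //.
    exact: (integrable_quadratic_growth (quadratic_growthZ t gc)).
  exact: integrable_quadratic_growth.
suff I0 : \int[mu]_x f x = 0 by apply/eqP; rewrite eq_sym -subr_eq0 -If I0.
have l1 := integral_symmetric_itv fi.
suff l2 : \int[mu]_(x in `[- n%:R, n%:R]) f x @[n --> \oo] --> (0 : R) by exact: cvg_unique l1 l2.
have FE n : (0 < n)%N -> \int[mu]_(x in `[- n%:R, n%:R]) f x = F n%:R - F (- n%:R).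
  move=> n0; rewrite /Rintegral (@continuous_FTC2 R f F) //.
  - by rewrite -subr_gt0 opprK -natrD ltr0n addn_gt0 n0.
  - exact: continuous_subspaceT.
  - split; first by move=> x _; exact: ex_derive.
      exact/cvg_at_right_filter/cF.
    exact/cvg_at_left_filter/cF.
  - by move=> x _; rewrite derive1E derive_val.
apply/norm_cvg0P; apply: (@squeeze_cvgr _ _ _ _ (cst 0) (fun n => 2 * normal_peak 1 * expR (- (n%:R ^+ 2 / 2)))).
- near=> n; rewrite normr_ge0 /= FE; last by near: n; exists 1%N.
  apply: le_trans (ler_normB _ _) _; rewrite /F !normrM !(ger0_norm (normal_pdf_ge0 _ _ _)).
  rewrite !normal_pdf01E sqrrN -mulrA mulr_natl mulr2n; apply: lerD.
    by rewrite ler_piMl ?sin_max // mulr_ge0 ?normal_peak_ge0 ?expR_ge0.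
  by rewrite ler_piMl ?sin_max // mulr_ge0 ?normal_peak_ge0 ?expR_ge0.
- exact: cvg_cst.
- rewrite -[X in _ --> X](mulr0 (2 * normal_peak 1)); apply: cvgM; first exact: cvg_cst.
  exact: natr_expR_cvg.
Unshelve. all: by end_near. Qed.

Lemma is_derive_normal_mean_cos t s :
  is_derive t (1 : R) (fun t : R => normal_mean (fun y => cos (t * y + s)))
    (- (t * normal_mean (fun y => cos (t * y + s)))).
Proof.
pose f (t y : R) := cos (t * y + s) * g y.
pose G (y : R) := (`|y| * g y).
have d1f a y : is_derive a (1 : R) (f ^~ y) (- (y * sin (a * y + s) * g y)).
  have d1 : is_derive a (1 : R) (fun a : R => cos (y * a + s)) (y * - sin (y * a + s)).
    exact: is_derive_affine.
  have := is_deriveM d1 (is_derive_cst (g y) a (1 : R)).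
  rewrite (_ : f ^~ y = (fun a => cos (y * a + s)) * cst (g y)); last first.
    by apply/funext => b; rewrite /f [b * y]mulrC.
  move=> d; apply: (is_derive_eq d); rewrite -![_ *: _]/(_ * _) /= [y * a]mulrC; ring.
have gG : mu.-integrable [set: R] (EFin \o G).
  apply: (integrable_quadratic_growth (f := fun y => `|y|)); split; first exact: measurableT_comp.
  exists 1, 1; split=> // y; rewrite normr_id mul1r.
  have := sqr_ge0 (y - 1 : R); have := sqr_ge0 (y + 1 : R); case: (ger0P (y : R)) => *; lra.
have I x : [set` `]t - 1, t + 1[] x -> mu.-integrable [set: R] (EFin \o f x).
  by move=> _; apply: integrable_quadratic_growth; exact: quadratic_growth_cos.
have D x y : [set` `]t - 1, t + 1[] x -> [set: R] y -> derivable (f ^~ y) x 1.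
  by move=> _ _; have dd := d1f x y; exact: ex_derive.
have B x y : [set` `]t - 1, t + 1[] x -> [set: R] y -> `|partial1of2 f x y| <= G y.
  move=> _ _; rewrite partial1of2E; have dd := d1f x y; rewrite derive_val normrN !normrM.
  by rewrite (ger0_norm (normal_pdf_ge0 _ _ _)) ler_wpM2r ?normal_pdf_ge0 // ler_piMr ?sin_max.
have It : [set` `]t - 1, t + 1[] t by rewrite /= in_itv /=; lra.
have G0 y : 0 <= G y by rewrite mulr_ge0 ?normal_pdf_ge0.
apply: DeriveDef; first exact: (derivable_under_integral measurableT It I D G0 gG B).
rewrite -derive1E (differentiation_under_integral measurableT It I D G0 gG B).
rewrite -normal_mean_parts -mulN1r -normal_meanZ; last exact: quadratic_growth_xsin.
apply: eq_Rintegral => y _; rewrite partial1of2E; have dd := d1f t y; rewrite derive_val.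
by rewrite mulN1r mulNr.
Qed.

(** By [is_derive_normal_mean_cos] the mean solves psi' = -t psi in t, so its product with exp
    (t^2/2) is constant. *)
Lemma normal_mean_cos t s :
  normal_mean (fun y => cos (t * y + s)) = cos s * expR (- (t ^+ 2 / 2)).
Proof.
pose psi (t : R) := normal_mean (fun y => cos (t * y + s)) * expR (t ^+ 2 / 2).
have d x : is_derive x (1 : R) psi 0.
  have d1 : is_derive x (1 : R) (fun x : R => x ^+ 2 / 2) x.
    by apply: is_derive_eq; rewrite -![_ *: _]/(_ * _); field.
  have d2 := @is_derive1_comp R (@expR R) (fun x : R => x ^+ 2 / 2) x _ _ (is_derive_expR _) d1.
  apply: (is_derive_eq (is_deriveM (is_derive_normal_mean_cos x s) d2)).
  by rewrite -![_ *: _]/(_ * _) /=; ring.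
have := is_derive_0_is_cst t 0 d; rewrite /psi expr0n mul0r expR0 mulr1.
have -> : normal_mean (fun y => cos (0 * y + s)) = cos s.
  by rewrite -(normal_mean_cst (cos s)); congr normal_mean; apply/funext => y; rewrite mul0r add0r.
by move=> <-; rewrite -mulrA -expRD subrr expR0 mulr1.
Qed.

End NormalExpectation.

(** * Trigonometric approximation of half lines *)

Section TrigonometricSums.
Variable R : realType.

Definition trigsum (s : seq (R * R * R)) (y : R) : R :=
  \sum_(c <- s) c.1.1 * cos (c.1.2 * y + c.2).

Definition trigonometric (f : R -> R) : Prop := exists s, f = trigsum s.

Lemma trigonometric_cos (c t a : R) : trigonometric (fun y => c * cos (t * y + a)).
Proof. by exists [:: (c, t, a)]; apply/funext => y; rewrite /trigsum big_seq1. Qed.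

Lemma trigonometric_cst (c : R) : trigonometric (fun=> c).
Proof.
rewrite (_ : (fun=> c) = (fun y => c * cos (0 * y + 0))); first exact: trigonometric_cos.
by apply/funext => y; rewrite mul0r addr0 cos0 mulr1.
Qed.

Lemma trigonometricD f h : trigonometric f -> trigonometric h ->
  trigonometric (fun y => f y + h y).
Proof.
by move=> [s ->] [s' ->]; exists (s ++ s'); apply/funext => y; rewrite /trigsum big_cat.
Qed.

Lemma trigonometricM f h : trigonometric f -> trigonometric h ->
  trigonometric (fun y => f y * h y).
Proof.
move=> [s ->] [s' ->].
exists (flatten [seq [:: (c.1.1 * d.1.1 / 2, c.1.2 + d.1.2, c.2 + d.2);
  (c.1.1 * d.1.1 / 2, c.1.2 - d.1.2, c.2 - d.2)] | c <- s, d <- s']).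
apply/funext => y; rewrite /trigsum big_flatten /= big_allpairs_dep mulr_suml; apply: eq_bigr => c _.
rewrite mulr_sumr; apply: eq_bigr => d _; rewrite big_cons big_seq1 /=.
have -> : (c.1.2 + d.1.2) * y + (c.2 + d.2) = (c.1.2 * y + c.2) + (d.1.2 * y + d.2) by ring.
have -> : (c.1.2 - d.1.2) * y + (c.2 - d.2) = (c.1.2 * y + c.2) - (d.1.2 * y + d.2) by ring.
by move: (c.1.2 * y + c.2) (d.1.2 * y + d.2) => v w; rewrite cosD cosB; field.
Qed.

Lemma trigonometricX f n : trigonometric f -> trigonometric (fun y => f y ^+ n).
Proof.
move=> tf; elim: n => [|n IH]; first exact: trigonometric_cst.
by under eq_fun do rewrite exprS; exact: trigonometricM.
Qed.

Lemma bernoulli_ge (v : R) n : -1 <= v -> 1 + n%:R * v <= (1 + v) ^+ n.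
Proof.
move=> v1; elim: n => [|n IH]; first by rewrite mul0r addr0 expr0.
rewrite exprS; apply: (@le_trans _ _ ((1 + v) * (1 + n%:R * v))); last by rewrite ler_wpM2l //; lra.
by rewrite -natr1; have := mulr_ge0 (ler0n R n) (sqr_ge0 v); nra.
Qed.

(* A trigonometric polynomial close to the indicator of y <= a on the half period
   around a: (1 - u^n)^(2^n) tends to 1 for 0 <= u < 1/2 and to 0 for 1/2 < u <= 1. *)
Definition step (L a : R) (n : nat) (y : R) : R :=
  (1 - ((1 + sin ((y - a) / L)) / 2) ^+ n) ^+ (2 ^ n).

Lemma trigonometric_step L a n : trigonometric (step L a n).
Proof.
rewrite /step.
have ts : trigonometric (fun y => (1 + sin ((y - a) / L)) / 2).
  rewrite (_ : (fun y => _) = (fun y => 1 / 2 + 1 / 2 * cos (L^-1 * y + (- a / L - pi / 2)))).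
    by apply: trigonometricD; [exact: trigonometric_cst|exact: trigonometric_cos].
  apply/funext => y; rewrite addrA cosBpihalf (_ : L^-1 * y + - a / L = (y - a) / L); last by ring.
  by field.
apply: trigonometricX; apply: trigonometricD; first exact: trigonometric_cst.
rewrite (_ : (fun y => _) = (fun y => -1 * ((1 + sin ((y - a) / L)) / 2) ^+ n)).
  by apply: trigonometricM; [exact: trigonometric_cst|exact: trigonometricX].
by apply/funext => y; rewrite mulN1r.
Qed.

Lemma step_bounds L a n y : 0 <= step L a n y <= 1.
Proof.
set u := (1 + sin ((y - a) / L)) / 2.
have u0 : 0 <= u by have := sin_geN1 ((y - a) / L); rewrite /u; lra.
have u1 : u <= 1 by have := sin_le1 ((y - a) / L); rewrite /u; lra.
have v0 : 0 <= u ^+ n by rewrite exprn_ge0.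
have v1 : u ^+ n <= 1 by rewrite exprn_ile1.
by rewrite /step -/u exprn_ge0 ?exprn_ile1 ?subr_ge0 //= lerBlDr lerDl.
Qed.

Lemma sin_le_sin01 (x y : R) : 0 <= x -> x <= y -> y <= 1 -> sin x <= sin y.
Proof.
move=> x0 xy y1; apply: (@derive_ge0_homo R (@sin R) (@cos R) 0 1) => // z; rewrite in_itv /= => z01.
by apply: le_trans (cos_ge_half z01); lra.
Qed.

Section StepError.
Variables (L a d : R) (n : nat).
Hypotheses (d0 : 0 < d) (dL : d <= L).
Let s := sin (d / L).
Definition steperr : R := (1 + sin (d / L))^-1 ^+ n.

Let L0 : 0 < L := lt_le_trans d0 dL.

Let s0 : 0 < s.
Proof. by apply: sin_gt0_01; rewrite divr_gt0 //= ler_pdivrMr // mul1r. Qed.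

(** With 2u = 1 + w, Bernoulli's inequality gives (1 - u^n)^(2^n) >= 1 - (2u)^n, and 2u <= 1 - s <=
    1 / (1 + s). *)
Lemma step_ge y : - L <= y - a -> y - a <= - d -> 1 - steperr <= step L a n y.
Proof.
move=> h1 h2; rewrite /step; set w := sin ((y - a) / L).
have ws : w <= - s.
  rewrite /w -[(y - a) / L]opprK sinN lerN2; apply: sin_le_sin01.
  - by rewrite divr_ge0 // ltW.
  - by rewrite -mulNr ler_pM2r ?invr_gt0 //; lra.
  - by rewrite -mulNr ler_pdivrMr // mul1r; lra.
have w1 : -1 <= w := sin_geN1 _.
set v := ((1 + w) / 2) ^+ n.
have v1 : v <= 1 by apply: exprn_ile1; have := s0; lra.
have := @bernoulli_ge (- v) (2 ^ n); rewrite lerN2 => /(_ v1); apply: le_trans.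
rewrite mulrN lerD2l lerN2 natrX -exprMn mulrC divfK // /steperr -/s.
rewrite lerXn2r ?nnegrE ?invr_ge0; try (by have := s0; lra).
by rewrite -[leRHS]mul1r ler_pdivlMr; have := s0; nra.
Qed.

(** For v = u^n, the product of (1 - v)^(2^n) and (1 + v)^(2^n) is at most 1, while by Bernoulli's
    inequality the second factor is at least 2^n v = (1 + w)^n >= (1 + s)^n. *)
Lemma step_le y : d <= y - a -> y - a <= L -> step L a n y <= steperr.
Proof.
move=> h1 h2; rewrite /step; set w := sin ((y - a) / L).
have ws : s <= w.
  apply: sin_le_sin01; first by rewrite divr_ge0 // ltW.
    by rewrite ler_pM2r ?invr_gt0.
  by rewrite ler_pdivrMr // mul1r.
have w1 : w <= 1 := sin_le1 _.
set v := ((1 + w) / 2) ^+ n.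
have v1 : v <= 1 by apply: exprn_ile1; have := s0; lra.
have v0 : 0 <= v by apply: exprn_ge0; have := s0; lra.
have b := @bernoulli_ge v (2 ^ n) (le_trans (lerN10 R) v0).
have e : (2 ^ n)%:R * v = (1 + w) ^+ n by rewrite natrX -exprMn mulrC divfK.
have p0 : 0 <= (1 - v) ^+ (2 ^ n) by rewrite exprn_ge0 // subr_ge0.
have p1 : (1 - v) ^+ (2 ^ n) * (1 + v) ^+ (2 ^ n) <= 1.
  by rewrite -exprMn exprn_ile1 //; nra.
have q : (1 + s) ^+ n <= (1 + w) ^+ n by rewrite lerXn2r ?nnegrE; have := s0; lra.
have q0 : 0 < (1 + s) ^+ n by rewrite exprn_gt0 //; have := s0; lra.
rewrite /steperr -/s exprVn -[leRHS]mul1r ler_pdivlMr //.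
apply: le_trans p1; apply: ler_wpM2l => //; lra.
Qed.

Lemma steperr_ge0 : 0 <= steperr.
Proof. by rewrite exprn_ge0 // invr_ge0; have := s0; lra. Qed.

(** Beyond distance L from a, nothing but 0 <= step <= 1 is known; as in Chebyshev's inequality, the
    quadratic term exceeds 1 there and covers the error. *)
Let far y : (y - a < - L) || (L < y - a) -> 1 <= (y - a) ^+ 2 / L ^+ 2.
Proof.
move=> h; rewrite ler_pdivlMr ?exprn_gt0 // mul1r.
by have := L0; move: (y - a) h => z /orP[] *; nra.
Qed.

Let tail_ge0 y : 0 <= (y - a) ^+ 2 / L ^+ 2.
Proof. by rewrite divr_ge0 ?sqr_ge0. Qed.

Lemma ind_le_step (y : R) : (y <= a - d)%R%:R <= step L a n y + (steperr + (y - a) ^+ 2 / L ^+ 2).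
Proof.
have /andP[p0 p1] := step_bounds L a n y; have e0 := steperr_ge0; have t0 := tail_ge0 y.
case: (leP y (a - d)) => h /=; last lra.
have [hL|hL] := leP (- L) (y - a).
  by have := @step_ge y hL; lra.
by have := @far y; rewrite hL => /(_ isT); lra.
Qed.

Lemma step_le_ind (y : R) : step L a n y <= (y <= a + d)%R%:R + (steperr + (y - a) ^+ 2 / L ^+ 2).
Proof.
have /andP[p0 p1] := step_bounds L a n y; have e0 := steperr_ge0; have t0 := tail_ge0 y.
case: (leP y (a + d)) => h /=; first lra.
have [hL|hL] := leP (y - a) L.
  have := @step_le y; rewrite hL; lra.
by have := @far y; rewrite hL orbT => /(_ isT); lra.
Qed.

End StepError.

Lemma steperr_cvg L d : 0 < d -> d <= L -> steperr L d n @[n --> \oo] --> 0.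
Proof.
move=> d0 dL; have L0 := lt_le_trans d0 dL.
have s0 : 0 < sin (d / L) by apply: sin_gt0_01; rewrite divr_gt0 //= ler_pdivrMr // mul1r.
by apply: cvg_expr; rewrite ger0_norm ?invr_ge0 ?invf_lt1; lra.
Qed.

End TrigonometricSums.

(** * From convergence of cosines to convergence on half lines *)

Section MeanFunctional.
Variable R : realType.
Local Notation mu := (@lebesgue_measure R).

Definition halfline (x y : R) : R := (y <= x)%R%:R.

(** Common abstraction of the average over tableaux and of the normal integral, with second moment
    at most [C]; the approximation argument is carried out once for both. *)
Definition is_mean (E : (R -> R) -> R) (C : R) : Prop :=
  [/\ forall f h, quadratic_growth f -> quadratic_growth h -> E (fun y => f y + h y) = E f + E h,
      forall c f, quadratic_growth f -> E (fun y => c * f y) = c * E f,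
      forall f h, quadratic_growth f -> quadratic_growth h -> (forall y, f y <= h y) -> E f <= E h,
      E (fun=> 1) = 1 & E (fun y => y ^+ 2) <= C].

Lemma measurable_halfline x : measurable_fun [set: R] (halfline x).
Proof.
rewrite (_ : halfline x = \1_`]-oo, x]); first exact: measurable_indic.
by apply/funext => y; rewrite /halfline indicE mem_setE in_itv.
Qed.

Lemma quadratic_growth_halfline x : quadratic_growth (halfline x).
Proof.
apply: (@quadratic_growth_bounded _ _ 1); first exact: measurable_halfline.
by move=> y; rewrite /halfline ger0_norm // lern1 leq_b1.
Qed.

Lemma quadratic_growth_cst (c : R) : quadratic_growth (fun=> c).
Proof. by apply: (@quadratic_growth_bounded _ _ `|c|) => //; exact: measurable_cst. Qed.

Lemma quadratic_growth_trigsum s : quadratic_growth (@trigsum R s).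
Proof.
elim: s => [|c s IH].
  rewrite (_ : trigsum _ = fun=> 0); first exact: quadratic_growth_cst.
  by apply/funext => y; rewrite /trigsum big_nil.
rewrite (_ : trigsum _ = fun y => c.1.1 * cos (c.1.2 * y + c.2) + trigsum s y).
  by apply: quadratic_growthD IH; apply: quadratic_growthZ; exact: quadratic_growth_cos.
by apply/funext => y; rewrite /trigsum big_cons.
Qed.

Lemma quadratic_growth_step L a n : quadratic_growth (@step R L a n).
Proof. by have [s ->] := trigonometric_step L a n; exact: quadratic_growth_trigsum. Qed.

Section OneMean.
Variables (E : (R -> R) -> R) (C : R).
Hypothesis mE : is_mean E C.

Lemma is_mean_cst c : E (fun=> c) = c.
Proof.
have [_ EZ _ E1 _] := mE; have := EZ c (fun=> 1) (quadratic_growth_cst 1).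
by rewrite E1 !mulr1.
Qed.

Lemma is_mean_trigsum s : E (trigsum s) = \sum_(c <- s) c.1.1 * E (fun y => cos (c.1.2 * y + c.2)).
Proof.
have [ED EZ _ _ _] := mE; elim: s => [|c s IH].
  rewrite big_nil (_ : trigsum _ = fun=> 0) ?is_mean_cst //.
  by apply/funext => y; rewrite /trigsum big_nil.
rewrite (_ : trigsum _ = fun y => c.1.1 * cos (c.1.2 * y + c.2) + trigsum s y); last first.
  by apply/funext => y; rewrite /trigsum big_cons.
rewrite ED; [|by apply: quadratic_growthZ; exact: quadratic_growth_cos|exact: quadratic_growth_trigsum].
by rewrite EZ ?IH ?big_cons //; exact: quadratic_growth_cos.
Qed.

(** The bound (y - a)^2 <= 2 a^2 + 2 y^2 makes the mean of the error depend on the second moment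
    only. *)
Let err_fun (L a d : R) n (y : R) : R := steperr L d n + (2 * a ^+ 2 / L ^+ 2) + 2 / L ^+ 2 * y ^+ 2.

Let quadratic_growth_err L a d n : quadratic_growth (err_fun L a d n).
Proof.
apply: quadratic_growthD; first exact: quadratic_growth_cst.
by apply: quadratic_growthZ; exact: quadratic_growth_sqr.
Qed.

Definition mean_err (L a d : R) n : R := steperr L d n + (2 * C + 2 * a ^+ 2) / L ^+ 2.

Let mean_err_fun (L a d : R) n : E (err_fun L a d n) <= mean_err L a d n.
Proof.
have [ED EZ _ _ E2] := mE.
rewrite /err_fun ED; [|exact: quadratic_growth_cst|by apply: quadratic_growthZ; exact: quadratic_growth_sqr].
rewrite EZ; last exact: quadratic_growth_sqr.
rewrite is_mean_cst /mean_err.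
have h : 2 / L ^+ 2 * E (fun y => y ^+ 2) <= 2 / L ^+ 2 * C.
  by rewrite ler_wpM2l // divr_ge0 ?sqr_ge0.
have -> : (2 * C + 2 * a ^+ 2) / L ^+ 2 = 2 * a ^+ 2 / L ^+ 2 + 2 / L ^+ 2 * C by ring.
by rewrite addrA lerD2l.
Qed.

Let err_fun_ge (L a d : R) n (y : R) : steperr L d n + (y - a) ^+ 2 / L ^+ 2 <= err_fun L a d n y.
Proof.
have -> : err_fun L a d n y = steperr L d n + (2 * a ^+ 2 + 2 * y ^+ 2) / L ^+ 2.
  by rewrite /err_fun; ring.
rewrite lerD2l ler_wpM2r ?invr_ge0 ?sqr_ge0 //.
by have := sqr_ge0 (y + a); nra.
Qed.

Lemma mean_halfline_le_step (L a d : R) n : 0 < d -> d <= L ->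
  E (halfline (a - d)) <= E (step L a n) + mean_err L a d n.
Proof.
move=> d0 dL; have [ED _ EM _ _] := mE.
apply: le_trans (_ : E (fun y => step L a n y + err_fun L a d n y) <= _).
  apply: EM; first exact: quadratic_growth_halfline.
    by apply: quadratic_growthD; [exact: quadratic_growth_step|exact: quadratic_growth_err].
  move=> y; apply: le_trans (ind_le_step a n d0 dL y) _; rewrite lerD2l; exact: err_fun_ge.
by rewrite (ED _ _ (quadratic_growth_step L a n) (quadratic_growth_err L a d n)) lerD2l mean_err_fun.
Qed.

Lemma mean_step_le_halfline (L a d : R) n : 0 < d -> d <= L ->
  E (step L a n) <= E (halfline (a + d)) + mean_err L a d n.
Proof.
move=> d0 dL; have [ED _ EM _ _] := mE.
apply: le_trans (_ : E (fun y => halfline (a + d) y + err_fun L a d n y) <= _).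
  apply: EM; first exact: quadratic_growth_step.
    by apply: quadratic_growthD; [exact: quadratic_growth_halfline|exact: quadratic_growth_err].
  move=> y; apply: le_trans (step_le_ind a n d0 dL y) _; rewrite lerD2l; exact: err_fun_ge.
by rewrite (ED _ _ (quadratic_growth_halfline _) (quadratic_growth_err L a d n)) lerD2l mean_err_fun.
Qed.

End OneMean.

(** A half line is squeezed between steps centred at x - d and x + d. The means of these
    trigonometric sums converge by hypothesis, and the approximation errors are uniform in N because
    the second moments are. *)
Lemma cvg_halfline_of_cos (E : nat -> (R -> R) -> R) (E0 : (R -> R) -> R) (C x : R) :
  0 <= C -> (forall N, is_mean (E N) C) -> is_mean E0 C ->
  (forall t s, E N (fun y => cos (t * y + s)) @[N --> \oo] --> E0 (fun y => cos (t * y + s))) ->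
  {for x, continuous (fun y => E0 (halfline y))} ->
  E N (halfline x) @[N --> \oo] --> E0 (halfline x).
Proof.
move=> C0 mE mE0 cE cont.
have ctrig f : trigonometric f -> E N f @[N --> \oo] --> E0 f.
  move=> [s ->]; rewrite (is_mean_trigsum mE0).
  have -> : (fun N => E N (trigsum s)) =
      (fun N => \sum_(c <- s) c.1.1 * E N (fun y => cos (c.1.2 * y + c.2))).
    by apply/funext => N; rewrite (is_mean_trigsum (mE N)).
  elim: s => [|c s IH].
    rewrite big_nil (_ : (fun N => _) = cst 0); first exact: cvg_cst.
    by apply/funext => N; rewrite big_nil.
  rewrite big_cons (_ : (fun N => _) = (fun N => c.1.1 * E N (fun y => cos (c.1.2 * y + c.2)) +
     \sum_(c <- s) c.1.1 * E N (fun y => cos (c.1.2 * y + c.2)))).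
    by apply: cvgD IH; apply: cvgM; [exact: cvg_cst|exact: cE].
  by apply/funext => N; rewrite big_cons.
apply/cvgrPdist_le => e e0.
have e16 : 0 < e / 16 by rewrite divr_gt0.
have /cvgrPdist_le/(_ _ (divr_gt0 e0 (ltr0n R 4))) := cont.
move=> [r /= r0 xr].
pose d := r / 4; have d0 : 0 < d by rewrite divr_gt0.
have xr' y : `|x - y| <= 2 * d -> `|E0 (halfline x) - E0 (halfline y)| <= e / 4.
  by move=> h; apply: xr => /=; apply: le_lt_trans h _; rewrite /d; lra.
pose B := 2 * C + 2 * (`|x| + d) ^+ 2.
have B0 : 0 <= B by rewrite addr_ge0 // mulr_ge0 // sqr_ge0.
(* L >= 1 and L >= 16 B / e give B / L^2 <= B / L <= e / 16. *)
pose L := d + 1 + 16 * B / e.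
have t0 : 0 <= 16 * B / e by rewrite divr_ge0 ?mulr_ge0 // ltW.
have dL : d <= L by rewrite /L; lra.
have BL a : `|a| <= `|x| + d -> (2 * C + 2 * a ^+ 2) / L ^+ 2 <= e / 16.
  move=> ha; have L1 : 1 <= L by rewrite /L; lra.
  have a2 : a ^+ 2 <= (`|x| + d) ^+ 2.
    by rewrite -real_normK ?num_real // lerXn2r ?nnegrE // (le_trans (normr_ge0 a)).
  rewrite ler_pdivrMr; last by rewrite exprn_gt0; lra.
  apply: (@le_trans _ _ B); first by rewrite /B; lra.
  apply: (@le_trans _ _ (e / 16 * L)); last by rewrite ler_pM2l // expr2 ler_peMl //; lra.
  have -> : B = e / 16 * (16 * B / e) by field; rewrite gt_eqF.
  by rewrite ler_pM2l // /L; lra.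
have [n hn] : exists n, steperr L d n <= e / 16.
  have /cvgrPdist_le/(_ _ e16)[n _ /(_ n (leqnn n))] := steperr_cvg d0 dL.
  by rewrite sub0r normrN => h; exists n; apply: le_trans (ler_norm _) h.
have errE a : `|a| <= `|x| + d -> mean_err C L a d n <= e / 8.
  by move=> /BL h; rewrite /mean_err; lra.
have hp : `|x + d| <= `|x| + d by apply: le_trans (ler_normD _ _) _; rewrite (gtr0_norm d0).
have hm : `|x - d| <= `|x| + d by apply: le_trans (ler_normB _ _) _; rewrite (gtr0_norm d0).
have cp := ctrig _ (trigonometric_step L (x + d) n).
have cm := ctrig _ (trigonometric_step L (x - d) n).
have e8 : 0 < e / 8 by rewrite divr_gt0.
(* On each side the total error is e/8 + e/8 for the two passages between half line and step, e/8
   for the convergence of the step, and e/4 for moving the limit half line by 2 d. *)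
near=> N.
have hp1 := mean_halfline_le_step (mE N) (x + d) n d0 dL.
have hp2 := mean_step_le_halfline mE0 (x + d) n d0 dL.
have hm1 := mean_step_le_halfline (mE N) (x - d) n d0 dL.
have hm2 := mean_halfline_le_step mE0 (x - d) n d0 dL.
rewrite addrK in hp1; rewrite subrK in hm1.
have ep := errE _ hp; have em := errE _ hm.
have /ler_normlP[np1 np2] : `|E0 (step L (x + d) n) - E N (step L (x + d) n)| <= e / 8.
  by near: N; move/cvgrPdist_le: cp; apply.
have /ler_normlP[nm1 nm2] : `|E0 (step L (x - d) n) - E N (step L (x - d) n)| <= e / 8.
  by near: N; move/cvgrPdist_le: cm; apply.
have /ler_normlP[kp1 kp2] : `|E0 (halfline x) - E0 (halfline (x + d + d))| <= e / 4.
  by apply: xr'; rewrite (_ : x - (x + d + d) = - (2 * d)); [rewrite normrN gtr0_norm // mulr_gt0|ring].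
have /ler_normlP[km1 km2] : `|E0 (halfline x) - E0 (halfline (x - d - d))| <= e / 4.
  by apply: xr'; rewrite (_ : x - (x - d - d) = 2 * d); [rewrite gtr0_norm // mulr_gt0|ring].
by apply/ler_normlP; split; lra.
Unshelve. all: by end_near. Qed.

Lemma is_mean_normal : is_mean (@normal_mean R) (@normal_mean R (fun y => y ^+ 2)).
Proof.
split=> //.
- exact: normal_meanD.
- exact: normal_meanZ.
- exact: normal_mean_le.
- exact: normal_mean_cst.
Qed.

Lemma normal_mean_sqr_ge0 : 0 <= @normal_mean R (fun y => y ^+ 2).
Proof. by apply: Rintegral_ge0 => x _; rewrite mulr_ge0 ?sqr_ge0 ?normal_pdf_ge0. Qed.

Lemma normal_probE x : normal_prob 0 1 `]-oo, x] = (normal_mean (halfline x))%:E.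
Proof.
rewrite /normal_prob /normal_mean /Rintegral fineK; last first.
  apply: integrable_fin_num => //; apply: integrable_quadratic_growth.
  exact: quadratic_growth_halfline.
rewrite [LHS]integral_mkcond; apply: eq_integral => y _; rewrite /halfline patchE mem_setE in_itv /=.
by case: (y <= x)%R; rewrite ?mul1r ?mul0r.
Qed.

Lemma is_mean_avg (I : finType) (X : I -> R) (C : R) : (0 < #|I|)%N ->
  (\sum_i X i ^+ 2) / #|I|%:R <= C -> is_mean (fun f => (\sum_i f (X i)) / #|I|%:R) C.
Proof.
move=> I0 XC; have c0 : 0 < #|I|%:R :> R by rewrite ltr0n.
split=> //.
- by move=> f h _ _; rewrite big_split mulrDl.
- by move=> c f _; rewrite -mulr_sumr mulrA.
- by move=> f h _ _ fh; rewrite ler_pM2r ?invr_gt0 //; apply: ler_sum.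
- by rewrite sumr_const divff // gt_eqF.
Qed.

End MeanFunctional.

(** * Asymptotic normality *)

Section UniformTableau.
Variables (R : realType) (l : blockpart).
Local Notation U := (@uniform_SYT R l).
Local Notation c := (#|{: SYT l}|%:R : R).

Lemma integral_uniform_SYT (f : SYT l -> R) :
  (\int[U]_T (f T)%:E = ((\sum_T f T) / c)%:E)%E.
Proof.
have -> : (\int[U]_T (f T)%:E = \int[U]_T \sum_(T0 : SYT l) (f T0 * \1_[set T0] T)%:E)%E.
  apply: eq_integral => T _; rewrite sumEFin; congr EFin.
  rewrite (bigD1 T) //= indicE mem_set // mulr1 big1 ?addr0 // => T0 T0T.
  rewrite indicE memNset ?mulr0 //= => e; by rewrite e eqxx in T0T.
have ii (T0 : SYT l) : U.-integrable [set: SYT l] (fun T => (\1_[set T0] T)%:E) by apply: integrable_indic.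
rewrite integral_sum //; last first.
  by move=> T0; under eq_fun do rewrite EFinM; apply: integrableZl.
rewrite mulr_suml -sumEFin; apply: eq_bigr => T0 _.
under eq_integral do rewrite EFinM.
rewrite integralZl // integral_indic // setIT EFinM; congr (_ * _)%E.
suff c1 : #|[set T0]%classic| = 1%N.
  have e : (uniform_SYT R [set T0]%classic = (c^-1)%:E)%E by rewrite /uniform_SYT c1 mul1r.
  exact: e.
rewrite -(card1 T0); apply: eq_card => T; rewrite [RHS]inE; apply/idP/eqP => [/set_mem //|->].
exact: mem_set.
Qed.

Lemma expectation_maj : ('E_U[maj_RV R l] = (maj_mean R l)%:E)%E.
Proof. by rewrite unlock integral_uniform_SYT -avg_mean. Qed.

Lemma variance_maj : ('V_U[maj_RV R l] = (maj_var R l)%:E)%E.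
Proof.
rewrite /variance unlock expectation_maj /= unlock integral_uniform_SYT -avg_var.
by congr (_ / _)%:E; apply: eq_bigr => T _; rewrite expr2.
Qed.

Definition std_maj (T : SYT l) : R :=
  if maj_var R l == 0 then 0 else ((maj T)%:R - maj_mean R l) / Num.sqrt (maj_var R l).

Lemma normalized_maj : normalized (maj_RV R l) = std_maj.
Proof.
by apply/funext => T; rewrite /normalized variance_maj expectation_maj /= eqe.
Qed.

Definition std_mean (f : R -> R) : R := (\sum_(T : SYT l) f (std_maj T)) / c.

Lemma cdf_std_maj x :
  cdf (normalized_RV (maj_RV R l)) x = (std_mean (halfline x))%:E.
Proof.
rewrite /cdf /distribution /pushforward /= /uniform_SYT /std_mean; congr (_ / _)%:E.
rewrite /halfline -natr_sum -sum1_card big_mkcond /=; congr _%:R; apply: eq_bigr => T _.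
rewrite normalized_maj; case: ifPn => [/set_mem/=|]; first by rewrite in_itv /= => ->.
rewrite notin_setE /= in_itv /= => /negP/negbTE; by move=> ->.
Qed.

Lemma is_mean_std : is_mean std_mean 1.
Proof.
apply: (is_mean_avg (X := std_maj)); first exact: card_SYT_gt0.
have [v0|v0] := eqVneq (maj_var R l) 0.
  rewrite big1 ?mul0r // => T _; by rewrite /std_maj v0 eqxx expr0n.
have vp : 0 < maj_var R l by rewrite lt_neqAle eq_sym v0 /= divr_ge0 ?gap2_ge0.
rewrite (eq_bigr (fun T : SYT l => ((maj T)%:R - maj_mean R l) ^+ 2 / maj_var R l)); last first.
  by move=> T _; rewrite /std_maj (negbTE v0) expr_div_n sqr_sqrtr // ltW.
by rewrite -mulr_suml mulrAC; have := avg_var R l; rewrite /avg => ->; rewrite divff.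
Qed.

Lemma std_mean_cos (t s : R) : 0 < maj_var R l -> 0 < t -> (bsize l)%:R * t <= Num.sqrt (maj_var R l) ->
  exists2 e, - (3 / 2 * (bsize l)%:R ^+ 2 * t ^+ 4 / maj_var R l) <= e <= 0 &
  std_mean (fun x => cos (t * x + s)) = cos s * expR (e - t ^+ 2 / 2).
Proof.
move=> v0 t0 nt; have [e eb eE] := avg_cos s v0 t0 nt; exists e => //; rewrite -eE.
by rewrite /std_mean /avg; congr (_ / _); apply: eq_bigr => T _; rewrite /std_maj gt_eqF.
Qed.

(** The maximum of maj exceeds its mean by at most gap1 / 2, by [maj_le] and [kappa1_majpoly]. *)
Lemma std_maj_le (C : R) (T : SYT l) : 0 <= C -> gap1 R l <= 2 * C * Num.sqrt (maj_var R l) ->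
  std_maj T <= C.
Proof.
move=> C0 h; rewrite /std_maj; case: ifPn => // v0.
have vp : 0 < maj_var R l by rewrite lt_neqAle eq_sym v0 /= divr_ge0 ?gap2_ge0.
rewrite ler_pdivrMr ?sqrtr_gt0 // /maj_mean kappa1_majpoly.
by have := maj_le R T; lra.
Qed.

Lemma maj_var_ge : (12 <= bsize l)%N -> (bsize l)%:R ^+ 2 * (aft l)%:R <= 288 * maj_var R l.
Proof. by move=> /(gap2_ge R) h; rewrite /maj_var; lra. Qed.

(** [gap2] is an integer, so a nonzero variance cannot be small. This handles shapes with fewer than
    12 cells, to which [maj_var_ge] does not apply. *)
Lemma maj_var_ge_min : maj_var R l = 0 \/ 1 / 12 <= maj_var R l.
Proof.
rewrite /maj_var; have [->|g0] := eqVneq (gap2 R l) 0; first by left; rewrite mul0r.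
right; rewrite ler_pM2r ?invr_gt0 //.
pose a := (\sum_(k < bsize l) k.+1 ^ 2)%N; pose b := (\sum_(h <- block_hooks l) h ^ 2)%N.
have e : gap2 R l = a%:R - b%:R.
  by rewrite /gap2 !natr_sum; congr (_ - _); apply: eq_bigr => i _; rewrite natrX.
have ab : (b <= a)%N by have := gap2_ge0 R l; rewrite e subr_ge0 ler_nat.
by move: g0; rewrite e -natrB // pnatr_eq0 -lt0n ler1n.
Qed.

End UniformTableau.

(** * Normality when aft tends to infinity *)

Section Forward.
Variables (R : realType) (lam : nat -> blockpart).
Hypothesis aft_cvg : aft (lam N) @[N --> \oo] --> \oo.

Let near_aft (A : nat) : \forall N \near \oo, (A <= aft (lam N))%N.
Proof. by move/cvgnyPge : aft_cvg; apply. Qed.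

Let near_aftr (x : R) : \forall N \near \oo, x <= (aft (lam N))%:R.
Proof.
near=> N; apply: le_trans (ltW (truncnS_gt x)) _.
by rewrite ler_nat; near: N; exact: near_aft.
Unshelve. all: by end_near. Qed.

Let var_ge N : (12 <= aft (lam N))%N ->
  0 < maj_var R (lam N) /\
  (bsize (lam N))%:R ^+ 2 * (aft (lam N))%:R <= 288 * maj_var R (lam N).
Proof.
move=> h; have n12 : (12 <= bsize (lam N))%N by apply: leq_trans h _; exact: leq_subr.
have := maj_var_ge R n12; split=> //.
have : 0 < (bsize (lam N))%:R ^+ 2 * (aft (lam N))%:R :> R.
  by rewrite mulr_gt0 ?exprn_gt0 ?ltr0n //; lia.
lra.
Qed.

Let cvg_cos_pos (t s : R) : 0 < t ->
  std_mean (lam N) (fun y => cos (t * y + s)) @[N --> \oo] --> cos s * expR (- (t ^+ 2 / 2)).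
Proof.
(* 432 = 288 * 3/2: as n^2 / v <= 288 / aft, the error exponent is at most D / aft in absolute
   value. *)
move=> t0; pose D := 432 * t ^+ 4.
have D0 : 0 < D by have := exprn_gt0 4 t0; rewrite /D; lra.
have c1 : continuous (fun x : R => cos s * expR (x - t ^+ 2 / 2)).
  by move=> x; apply: cvgM; [exact: cvg_cst|apply: (cvg_comp (fun x => x - t ^+ 2 / 2) (@expR R));
    [apply: cvgB; [exact: cvg_id|exact: cvg_cst]|exact: continuous_expR]].
apply/cvgrPdist_le => e e0.
have /cvgrPdist_le/(_ _ e0)[r /= r0 hr] := c1 0.
near=> N.
have a12 : (12 <= aft (lam N))%N by near: N; exact: near_aft.
have aA : 2 * (D / r) <= (aft (lam N))%:R by near: N; exact: near_aftr.
(* This gives 288 n^2 t^2 <= n^2 aft <= 288 v, hence n t <= sqrt v, the range in which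
   [std_mean_cos] holds. *)
have aB : 288 * t ^+ 2 <= (aft (lam N))%:R by near: N; exact: near_aftr.
have [v0 vn] := var_ge a12.
set v := maj_var R (lam N) in v0 vn; set n := (bsize (lam N))%:R in vn.
set a := (aft (lam N))%:R in aA aB vn.
have a0 : 0 < a by rewrite ltr0n (leq_trans _ a12).
have n0 : 0 <= n ^+ 2 := sqr_ge0 n.
have nt : n * t <= Num.sqrt v.
  have nt0 : 0 <= n * t by rewrite mulr_ge0 // ltW.
  rewrite -(ger0_norm nt0) -sqrtr_sqr ler_wsqrtr // exprMn.
  rewrite -(ler_pM2l (ltr0n R 288)); apply: le_trans vn.
  by rewrite mulrCA ler_wpM2l.
have [eps /andP[eps1 eps2] ->] := std_mean_cos s v0 t0 nt.
have h : `|0 - eps| < r.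
  rewrite sub0r normrN ler0_norm //; apply: (@le_lt_trans _ _ (D / a)); last first.
    have := ler_wpM2r (ltW r0) aA; rewrite -mulrA divfK ?gt_eqF // => Dr.
    by rewrite ltr_pdivrMr // mulrC; lra.
  rewrite lerNl; apply: le_trans eps1; rewrite lerN2 -/v -/n ler_pdivrMr // [leRHS]mulrAC ler_pdivlMr //.
  have := ler_wpM2l (exprn_ge0 4 (ltW t0)) vn; rewrite /D; lra.
have := hr eps h; rewrite /= sub0r; exact.
Unshelve. all: by end_near. Qed.

Let cvg_cos (t s : R) :
  std_mean (lam N) (fun y => cos (t * y + s)) @[N --> \oo] --> normal_mean (fun y => cos (t * y + s)).
Proof.
rewrite normal_mean_cos; have [t0|t0|->] := ltgtP t 0.
- have := @cvg_cos_pos (- t) (- s); rewrite oppr_gt0 sqrrN cosN => /(_ t0).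
  have -> // : (fun y => cos (- t * y - s)) = (fun y => cos (t * y + s)).
  by apply/funext => y; rewrite -cosN; congr cos; ring.
- exact: cvg_cos_pos.
rewrite expr0n mul0r oppr0 expR0 mulr1.
have -> : (fun y : R => cos (0 * y + s)) = (fun=> cos s) by apply/funext => y; rewrite mul0r add0r.
have -> : (fun N => std_mean (lam N) (fun=> cos s)) = cst (cos s); last exact: cvg_cst.
by apply/funext => N; exact: (is_mean_cst (is_mean_std R (lam N))).
Qed.

Lemma asymptotically_normal_of_aft : asymptotically_normal (fun N => maj_RV R (lam N)).
Proof.
move=> x cx; rewrite [X in _ --> X](normal_probE x).
rewrite (_ : (fun N => _) = EFin \o (fun N => std_mean (lam N) (halfline x))); last first.
  by apply/funext => N; exact: cdf_std_maj.
apply: cvg_EFin; first exact: nearW.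
pose C : R := 1 + normal_mean (fun y => y ^+ 2).
have Z0 := normal_mean_sqr_ge0 R.
have up E (A : R) : A <= C -> is_mean E A -> is_mean E C.
  by move=> hAC [h1 h2 h3 h4 h5]; split=> //; exact: le_trans hAC.
apply: (@cvg_halfline_of_cos R (fun N => std_mean (lam N)) (@normal_mean R) C).
- by rewrite /C; lra.
- by move=> N; apply: up (is_mean_std R (lam N)); rewrite /C; lra.
- by apply: up (is_mean_normal R); rewrite /C; lra.
- exact: cvg_cos.
have := cx; rewrite (_ : (fun y : R => _) = EFin \o (fun y => normal_mean (halfline y))); last first.
  by apply/funext => y; exact: normal_probE.
by move=> /fine_cvg.
Qed.

End Forward.

(** * Normality forces aft to tend to infinity *)

Section Converse.
Variable R : realType.
Local Notation mu := (@lebesgue_measure R).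

Let integrable_itvZ (m x y : R) : mu.-integrable [set: R] (EFin \o (fun z => m * \1_`]x, y] z)).
Proof.
have := integrableZl measurableT m (integrable_indic_itv x y false false).
by apply: eq_integrable => // z _; rewrite /= EFinM.
Qed.

Let Rintegral_itvZ (m x y : R) : x <= y -> \int[mu]_z (m * \1_`]x, y] z) = m * (y - x).
Proof.
move=> xy; rewrite RintegralZl //; last exact: integrable_indic_itv.
rewrite /Rintegral integral_indic // setIT.
rewrite [X in fine X](lebesgue_measure_itv (Interval (BRight x) (BRight y))) /=.
rewrite lte_fin; case: ltP => h; first by rewrite -EFinD.
by have -> : y = x; [apply/le_anti; rewrite h xy|rewrite subrr].
Qed.

Let halfline_sub (x y z : R) : x <= y -> halfline y z - halfline x z = \1_`]x, y] z.
Proof.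
move=> xy; rewrite /halfline indicE mem_setE in_itv /=.
case: (leP z x) => zx /=; first by rewrite (le_trans zx xy) subrr.
by rewrite subr0.
Qed.

Lemma normal_mean_halfline_sub (x y : R) : x <= y ->
  normal_mean (halfline y) - normal_mean (halfline x) = \int[mu]_z (\1_`]x, y] z * normal_pdf 0 1 z).
Proof.
move=> xy; rewrite /normal_mean -RintegralB //; try exact: (integrable_quadratic_growth (quadratic_growth_halfline _)).
by apply: eq_Rintegral => z _; rewrite -mulrBl halfline_sub.
Qed.

Let integrable_itv_pdf (x y : R) :
  mu.-integrable [set: R] (EFin \o (fun z => \1_`]x, y] z * normal_pdf 0 1 z)).
Proof.
apply: integrable_quadratic_growth; apply: (@quadratic_growth_bounded _ _ 1); first exact: measurable_indic.
by move=> z; rewrite indicE; case: (_ \in _); rewrite ?normr1 ?normr0.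
Qed.

Lemma normal_mean_halfline_lip (x y : R) : x <= y ->
  0 <= normal_mean (halfline y) - normal_mean (halfline x) <= normal_peak 1 * (y - x).
Proof.
move=> xy; rewrite normal_mean_halfline_sub //; apply/andP; split.
  by apply: Rintegral_ge0 => z _; rewrite mulr_ge0 ?normal_pdf_ge0.
rewrite -Rintegral_itvZ //.
apply: (le_Rintegral measurableT (integrable_itv_pdf x y) (integrable_itvZ _ x y)) => z _.
by rewrite mulrC ler_wpM2r // normal_pdf_ub ?oner_neq0.
Qed.

Lemma continuous_normal_mean_halfline : continuous (fun y : R => normal_mean (halfline y)).
Proof.
move=> x; apply/cvgrPdist_le => e e0.
have p0 : 0 < normal_peak (1 : R) by rewrite normal_peak_gt0 ?oner_neq0.
exists (e / normal_peak 1); first by rewrite /= divr_gt0.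
move=> y /= h; have h' : normal_peak 1 * `|x - y| <= e by rewrite mulrC -ler_pdivlMr // ltW.
have [xy|/ltW yx] := leP x y.
  have /andP[l1 l2] := normal_mean_halfline_lip xy.
  by rewrite distrC ger0_norm // (le_trans l2) // -[y - x]ger0_norm ?subr_ge0 // distrC.
have /andP[l1 l2] := normal_mean_halfline_lip yx.
by rewrite ger0_norm // (le_trans l2) // -[x - y]ger0_norm ?subr_ge0.
Qed.

(** On the interval from C to C + 1 the density is at least its value at the right end, so a
    positive mass lies beyond C. *)
Lemma normal_mean_halfline_lt1 (C : R) : 0 <= C -> normal_mean (halfline C) < 1.
Proof.
move=> C0; have C1 : C <= C + 1 by rewrite lerDl.
have p0 : 0 < normal_peak (1 : R) by rewrite normal_peak_gt0 ?oner_neq0.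
pose m : R := normal_pdf 0 1 (C + 1).
have m0 : 0 < m by rewrite /m normal_pdf01E mulr_gt0 ?expR_gt0.
have : normal_mean (halfline (C + 1)) <= 1.
  rewrite -[leRHS](normal_mean_cst (1 : R)); apply: normal_mean_le.
  - exact: quadratic_growth_halfline.
  - exact: quadratic_growth_cst.
  - by move=> y; rewrite /halfline lern1 leq_b1.
suff : m <= normal_mean (halfline (C + 1)) - normal_mean (halfline C) by lra.
rewrite normal_mean_halfline_sub // -[leLHS]mulr1 -[X in _ * X](addrK C) [1 + C]addrC -Rintegral_itvZ //.
apply: (le_Rintegral measurableT (integrable_itvZ _ _ _) (integrable_itv_pdf _ _)) => z _.
rewrite mulrC indicE mem_setE in_itv /=.
case: (boolP (C < z <= C + 1)) => [/andP[z1 z2]|]; last by rewrite !mul0r.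
rewrite !mul1r /m !normal_pdf01E ler_pM2l // ler_expR lerN2.
by rewrite ler_wpM2r // lerXn2r ?nnegrE //; lra.
Qed.

Lemma std_maj_bounded (l : blockpart) (M : nat) (T : SYT l) : (aft l <= M)%N ->
  std_maj R T <= 24 * M%:R.
Proof.
move=> aM; have M0 : 0 <= M%:R :> R by [].
have [v0|v12] := maj_var_ge_min R l.
  by rewrite /std_maj v0 eqxx mulr_ge0.
have vp : 0 < maj_var R l by lra.
apply: std_maj_le; first by rewrite mulr_ge0.
have g1 := gap1_le R l; rewrite natrM in g1.
have aM' : (aft l)%:R <= M%:R :> R by rewrite ler_nat.
have s0 := sqrtr_ge0 (maj_var R l); have s2 := sqr_sqrtr (ltW vp).
set s := Num.sqrt _ in s0 s2 *.
have n0 : 0 <= (bsize l)%:R :> R by [].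
have [n12|n12] := leqP 12 (bsize l).
  have [a0|a1] := posnP (aft l).
    by apply: le_trans g1 _; rewrite a0 mul0r !mulr_ge0.
  have h := maj_var_ge R n12.
  (* From n^2 <= 288 v and 17^2 = 289. *)
  have n17 : (bsize l)%:R <= 17 * s.
    rewrite -ler_sqr ?nnegrE ?mulr_ge0 // exprMn s2.
    have : (bsize l)%:R ^+ 2 * 1 <= (bsize l)%:R ^+ 2 * (aft l)%:R :> R by rewrite ler_wpM2l ?sqr_ge0 // ler1n.
    by lra.
  apply: le_trans g1 _; apply: le_trans (ler_pM _ _ aM' n17) _ => //.
  by have := mulr_ge0 M0 s0; lra.
have n12' : (bsize l)%:R <= 12 :> R by rewrite (ler_nat R _ 12) ltnW.
(* From v >= 1/12 > 1/16. Together with n <= 12 this gives gap1 <= 12 M <= 48 M s, which is where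
   the constant 24 comes from. *)
have s4 : 1 / 4 <= s by rewrite -ler_sqr ?nnegrE // s2; lra.
apply: le_trans g1 _; apply: le_trans (ler_pM _ _ aM' n12') _ => //.
by have := ler_wpM2l M0 s4; lra.
Qed.

Variable lam : nat -> blockpart.

Lemma aft_of_asymptotically_normal :
  asymptotically_normal (fun N => maj_RV R (lam N)) -> aft (lam N) @[N --> \oo] --> \oo.
Proof.
move=> an; apply/cvgnyPge => A; apply: contrapT => nA.
pose C : R := 24 * A%:R; have C0 : 0 <= C by rewrite mulr_ge0.
have E1 N : (aft (lam N) < A)%N -> std_mean (lam N) (halfline C) = 1.
  move=> aA; rewrite /std_mean (eq_bigr (fun=> 1)); last first.
    by move=> T _; rewrite /halfline (std_maj_bounded T (ltnW aA)).
  by rewrite sumr_const divff // pnatr_eq0 -lt0n card_SYT_gt0.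
have cont : {for C, continuous (fun y : R => normal_prob (0 : R) 1 `]-oo, y]%classic)}.
  rewrite (_ : (fun y : R => _) = EFin \o (fun y => normal_mean (halfline y))).
    by apply: cvg_EFin; [exact: nearW|exact: continuous_normal_mean_halfline].
  by apply/funext => y; exact: normal_probE.
have := an C cont; rewrite [X in _ --> X](normal_probE C).
rewrite (_ : (fun N => _) = EFin \o (fun N => std_mean (lam N) (halfline C))); last first.
  by apply/funext => N; exact: cdf_std_maj.
move=> /fine_cvg cv; have lt1 := normal_mean_halfline_lt1 C0.
(* Whenever aft < A the distribution function at C equals 1; being closer to the limit than 1 minus
   the limit therefore forces aft >= A. *)
apply: nA; have e0 : 0 < 1 - normal_mean (halfline C) by rewrite subr_gt0.
move/cvgrPdist_lt : cv => /(_ _ e0); apply: filterS => N /= h.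
rewrite leqNgt; apply/negP => aA; move: h; rewrite (E1 N aA) distrC ger0_norm ?ltxx //.
exact: ltW.
Qed.

End Converse.

Theorem theorem5p8 (R : realType) (lam : nat -> blockpart) :
  asymptotically_normal (fun N : nat => maj_RV R (lam N)) <->
  aft (lam N) @[N --> \oo] --> \oo.
Proof.
split; first exact: aft_of_asymptotically_normal.
exact: asymptotically_normal_of_aft.
Qed.
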